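(* Let $n \in \mathbb{Z}_{\geq2}$ and let $G = \mathbb{G}_m^n$. Let $C \subset G$ be a closed algebraic curve such that the Zariski closure $\overline{C}$ of $C$ in $\mathbb{A}^n$ is a line defined over a number field $K$. Suppose that $C$ contains the point $s_0 := (1,1,\dotsc,1)$, and that $C$ is not contained in a proper algebraic subgroup of $G$. Let $x \colon \overline{C} \to \mathbb{A}^1$ be an isomorphism of algebraic curves over $K$ satisfying $x(s_0)=0$. Let \[ \Xi = \{ x(s) : s \in \overline{C}(\overline{K}) \setminus C(\overline{K}) \}. \] Let $H$ be an upper bound for $H(\Xi)=\sum_{\alpha\in\Xi}h(\alpha)$. Then, for every point $s \in C(\overline{K}) \cap \Sigma_2$, letting $\delta = \max\{1,\tau(K(s))\}$, we have: \begin{enumerate} \item[(i)] for all values of $\delta\in\mathbb{Z}_{\ge 1}$, letting $\lambda = \binom{n+\delta}{\delta}$, \[ h(x(s)) < n \bigl( 8\lambda^3 - 3.8\lambda^2 \bigr) \bigl( \log(\delta) + 2 \bigr) (H+1); \] \item[(ii)] if $\delta \geq \tfrac{1}{4}(n+2)$, then \[ h(x(s)) < 8n\, C_1(n)^2\, C_2(n)\, \delta^n \bigl( \log(3\delta) + 2 \bigr)(H+1). \] \end{enumerate}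
   Context: $\Sigma_2$ denotes the union of all algebraic subgroups of $\mathbb{G}_m^n$ of codimension at least $2$. For $\alpha\in\overline{\mathbb{Q}}$, $h(\alpha)$ is the absolute logarithmic Weil height. For a number field $L$, $\tau(L)$ is the number of complex places of $L$, i.e. $\tau(L)=\tfrac12([L:\mathbb{Q}]-\#\mathrm{Hom}(L,\mathbb{R}))$. For positive integers $\eta$ define \[ C_1(\eta)=\begin{cases}\dfrac{2}{(4k+1)(4k)}\dbinom{5k+2}{4k-1} & \text{if } \eta=4k-1,\ k\in\mathbb{Z}_{\ge1},\\[2mm] \dfrac{1}{4k+2}\dbinom{5k+3}{4k+1} & \text{if }\eta=4k+1,\ k\in\mathbb{Z}_{\ge0},\\[2mm] \tfrac32\,C_1(\eta-1)&\text{if $\eta$ is even,}\end{cases}\qquad C_2(\eta)=\begin{cases}\dfrac{3^\eta}{\eta!}&\text{if $\eta$ is odd,}\\[2mm] \dfrac53\cdot\dfrac{3^\eta}{\eta!}&\text{if $\eta$ is even.}\end{cases}\] *)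

(* Defs.v *)
From HB Require Import structures.
From mathcomp Require Import all_boot all_order all_algebra all_field.
From mathcomp Require Import finmap boolp classical_sets functions cardinality.
From mathcomp Require Import fsbigop reals exp complex.
(* Not imported: its notations clash with those of the analysis library. *)
From mathcomp Require mpoly.

Set Implicit Arguments.
Unset Strict Implicit.
Unset Printing Implicit Defensive.
Import Order.TTheory GRing.Theory Num.Theory.
Local Open Scope classical_set_scope.
Local Open Scope ring_scope.

(* Number fields are [fieldExtType rat]; their common algebraic closure is
   [algC].  Varieties are identified with their sets of [algC]-points. *)

Section NumberField.
Variable R : realType.
Implicit Type L : fieldExtType rat.

(* The morphisms are taken as plain functions, to get a set in a [choiceType];
   the set is finite. *)
Definition embeddings L (F : nzRingType) : set (L -> F) :=
  range (fun g : {rmorphism L -> F} => g : L -> F).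

Definition nb_real_embeddings L : nat := #|` fset_set (@embeddings L R)|%fset.

Definition tau L : nat := (\dim {:L} - nb_real_embeddings L)./2.

(* The finite places of L, as normalized discrete valuations v : L^* ->> Z.
   The value of v at 0 carries no meaning; it is set to 0 so that distinct
   functions are distinct places. *)
Definition finite_place L (v : L -> int) : Prop :=
  [/\ v 0 = 0,
      exists2 a, a != 0 & v a = 1,
      forall a b, a != 0 -> b != 0 -> v (a * b) = v a + v b &
      forall a b, a != 0 -> b != 0 -> a + b != 0 ->
        Num.min (v a) (v b) <= v (a + b)].

Definition valuation_ring L (v : L -> int) : set L :=
  [set a | a = 0 \/ 0 <= v a].

Definition valuation_ideal L (v : L -> int) : set L :=
  [set a | a = 0 \/ 0 < v a].

(* The cosets a + m_v for a in O_v. *)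
Definition residue_field L (v : L -> int) : set (set L) :=
  (fun a => [set b | valuation_ideal v (b - a)]) @` valuation_ring v.

Definition place_norm L (v : L -> int) : nat :=
  #|` fset_set (residue_field v)|%fset.

(* The normalized absolute value ||a||_v = |a|_v ^ [L_v : Q_v]. *)
Definition finite_abs L (v : L -> int) (a : L) : R :=
  if a == 0 then 0 else (place_norm v)%:R ^ (- v a).

(* The sum over [embeddings] counts every complex place twice, i.e. with its
   local degree. *)
Definition field_height L (a : L) : R :=
  ((\dim {:L})%:R)^-1 *
  (\sum_(f \in @embeddings L R[i]) ln (Num.max 1 (complex.Re `|f a|)) +
   \sum_(v \in @finite_place L) ln (Num.max 1 (finite_abs v a))).

(* A number field isomorphic to Q(r) for a finite sequence r, with an
   embedding whose image is Q(r). *)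
Definition numfield (r : seq algC) : fieldExtType rat :=
  projT1 (num_field_exists r).

Definition numfield_emb (r : seq algC) : {rmorphism numfield r -> algC} :=
  projT1 (projT2 (num_field_exists r)).

Definition height (a : algC) : R :=
  field_height (sval (num_field_proj (numfield_emb [:: a])) a).

End NumberField.

Section AffineSpace.
Variable n : nat.
Implicit Types (X Y Z : set ('I_n -> algC)) (s t : 'I_n -> algC).

Definition zariski_closure X : set ('I_n -> algC) :=
  [set s | forall P : mpoly.mpoly n algC,
     (forall t, X t -> mpoly.meval t P = 0) -> mpoly.meval s P = 0].

Definition zariski_closed_in X Z : Prop := Z = X `&` zariski_closure Z.

Definition zariski_irreducible Z : Prop :=
  Z !=set0 /\
  forall X Y, zariski_closed_in setT X -> zariski_closed_in setT Y ->
    Z `<=` X `|` Y -> Z `<=` X \/ Z `<=` Y.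

Definition irreducible_chain X (k : nat) (Z : nat -> set ('I_n -> algC)) :=
  (forall i, (i <= k)%N ->
     zariski_closed_in X (Z i) /\ zariski_irreducible (Z i)) /\
  (forall i, (i < k)%N -> Z i `<` Z i.+1).

(* n - dim X >= c, where dim is the Krull dimension. *)
Definition codim_ge (c : nat) X : Prop :=
  forall k (Z : nat -> set _), irreducible_chain X k Z -> (k + c <= n)%N.

Definition Gm : set ('I_n -> algC) := [set s | forall i, s i != 0].

Definition algebraic_subgroup X : Prop :=
  [/\ zariski_closed_in Gm X,
      X (fun=> 1),
      forall s t, X s -> X t -> X (fun i => s i * t i) &
      forall s, X s -> X (fun i => (s i)^-1)].

Definition Sigma (c : nat) : set ('I_n -> algC) :=
  [set s | exists X, [/\ algebraic_subgroup X, codim_ge c X & X s]].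

Variables (K : fieldExtType rat) (iota : {rmorphism K -> algC}).

Definition line_over X : Prop :=
  exists p d : 'I_n -> K,
    (exists i, d i != 0) /\
    X = range (fun (t : algC) (i : 'I_n) => iota (p i) + t * iota (d i)).

(* X is a closed subvariety of A^n, so that its regular functions are the
   restrictions of polynomials; only the restriction of x to X matters. *)
Definition iso_to_A1_over X (x : ('I_n -> algC) -> algC) : Prop :=
  exists (P : mpoly.mpoly n K) (Q : 'I_n -> {poly K}),
    let y (t : algC) (i : 'I_n) : algC := (map_poly iota (Q i)).[t] in
    [/\ forall s, X s -> x s = mpoly.meval s (mpoly.map_mpoly iota P),
        forall t : algC, X (y t),
        forall s, X s -> y (x s) = s &
        forall t : algC, x (y t) = t].

(* K(s) *)
Definition point_field s : fieldExtType rat :=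
  numfield ([seq iota b | b <- vbasis {:K}] ++ [seq s i | i : 'I_n]).

End AffineSpace.

Arguments Gm : clear implicits.

Section Constants.
Variable R : realType.

Definition C1_odd (eta : nat) : R :=
  if (eta %% 4 == 3)%N then
    let k := (eta.+1 %/ 4)%N in
    2 / ((4 * k + 1) * (4 * k))%N%:R * 'C(5 * k + 2, 4 * k - 1)%:R
  else
    let k := (eta %/ 4)%N in
    1 / (4 * k + 2)%N%:R * 'C(5 * k + 3, 4 * k + 1)%:R.

Definition C1 (eta : nat) : R :=
  if odd eta then C1_odd eta else 3 / 2 * C1_odd eta.-1.

Definition C2 (eta : nat) : R :=
  if odd eta then 3 ^+ eta / eta`!%:R else 5 / 3 * (3 ^+ eta / eta`!%:R).

End Constants.

(* Main.v *)
(* Idea.  The line is x |-> (1 - x / xi_i)_i with the xi_i in Xi distinct and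
   nonzero, because C lies in no subgroup s_i = 1 or s_i = s_j.  By Dedekind's
   independence of characters, a point s in a subgroup of codimension >= 1
   satisfies prod_i s_i ^ e_i = 1 for some e <> 0, and this single relation
   already bounds h(x(s)) linearly in n and H, whatever delta is.  Let |e_1| be
   the largest exponent and z = s_1, c_j = xi_1 / xi_j, so that
   s_j = (1 - c_j) + c_j z.  At a place where z is small compared with all the
   1 - c_j, each |s_j| is comparable to |1 - c_j|, and the relation gives
   |log|z|| <= sum_j |log|s_j||; at the other places |z| is bounded below
   directly.  Summing over the places bounds h(1 / z) = h(z), hence h(x).

   The heights require the product formula and the independence of the height
   from the number field L.  Both follow from ord_p (N b) = sum_(v | p) f_v v(b).
   Here the intersection O of the valuation rings over p is integral over Z_(p)
   (Chevalley extension of places), and a basis of O / p O adapted to the places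
   is a basis of L, by nondegeneracy of the trace form; so sum_v e_v f_v = [L : Q].
   In such a basis f_v rows of the matrix of a uniformizer at v are divisible by
   p, so its norm has order >= f_v, and equality for p forces equality
   everywhere. *)

Require Import Defs.
From mathcomp Require Import all_boot all_order all_algebra all_field.
From mathcomp Require Import finmap boolp classical_sets functions cardinality.
From mathcomp Require Import fsbigop reals exp complex.
From HB Require Import structures.
From mathcomp Require Import zify ring lra.
From mathcomp Require mpoly.
Import (canonicals) mpoly.
Set Implicit Arguments.
Unset Strict Implicit.
Unset Printing Implicit Defensive.
Import Order.TTheory GRing.Theory Num.Theory.
Local Open Scope classical_set_scope.
Local Open Scope ring_scope.

(** * Finite places of a number field *)

Section FinitePlace.
Variable L : fieldExtType rat.
Implicit Types (v : L -> int) (a b : L) (k : int).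

(** Heights in two fields are not compared by extending places. For a number a and a prime p, the
    sum of min(0, v(a)) f_v over v | p is read off from ord_p of the norm of one auxiliary
    polynomial in a, and that norm is determined by the minimal polynomial of a and the degree of
    the field; the archimedean part is a sum over conjugates. Sums over the finite places are
    truncated to the primes below a bound B, chosen large for the finitely many numbers at hand, so
    that all estimates concern finite sums.

    The relation yields h(x) <= (3n - 2)(sum_i h(xi_i) + log 2) < 3n(H + 1). The claimed bounds have
    the form n c (H + 1) with c >= 3: in (i), 8 lambda^3 - 3.8 lambda^2 >= 4.2 because lambda >= 1,
    and log delta + 2 >= 2; in (ii), 8 (log(3 delta) + 2) >= 16 and C_1(n) >= 1, while delta >= (n +
    2)/4 makes C_2(n) delta^n >= 1. *)

Lemma ratrL_eq0 (q : rat) : ((q%:A : L) == 0) = (q == 0).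
Proof. exact: (fmorph_eq0 (in_alg L)). Qed.

Lemma intrLE (z : int) : z%:~R = z%:~R%:A :> L.
Proof. by rewrite -[RHS]/(in_alg L _) rmorph_int. Qed.

Lemma intrL_eq0 (z : int) : ((z%:~R : L) == 0) = (z == 0).
Proof. by rewrite intrLE ratrL_eq0 intr_eq0. Qed.

Lemma natrL_eq0 (m : nat) : ((m%:R : L) == 0) = (m == 0%N).
Proof. exact: (intrL_eq0 m). Qed.

(** Treats v(0) as infinite, against the conventional value [v 0 = 0], so that the bound is stable
    under sums and products without side conditions. *)
Definition vge v k a := (a == 0) || (k <= v a).

Lemma vge0r v k : vge v k 0. Proof. by rewrite /vge eqxx. Qed.

Lemma vge_val v a : vge v (v a) a. Proof. by rewrite /vge lexx orbT. Qed.

Lemma vge_le v k k' a : k' <= k -> vge v k a -> vge v k' a.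
Proof.
by rewrite /vge => le_k /orP[->//|/(le_trans le_k)->]; rewrite orbT.
Qed.

Lemma vge_neq0 v k a : a != 0 -> vge v k a = (k <= v a).
Proof. by rewrite /vge => /negPf->. Qed.

Section Valuation.
Variables (v : L -> int) (vP : finite_place v).

Lemma valM a b : a != 0 -> b != 0 -> v (a * b) = v a + v b.
Proof. by case: vP => _ _ + _; apply. Qed.

Lemma val1 : v 1 = 0.
Proof.
have h : v 1 = v 1 + v 1 by rewrite -valM ?oner_neq0 // mulr1.
lia.
Qed.

Lemma valN a : v (- a) = v a.
Proof.
have [->|a0] := eqVneq a 0; first by rewrite oppr0.
have N10 : (-1 : L) != 0 by rewrite oppr_eq0 oner_eq0.
have h : v (-1) + v (-1) = 0 by rewrite -valM // mulrNN mulr1 val1.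
by rewrite -mulN1r valM //; lia.
Qed.

Lemma valV a : a != 0 -> v a^-1 = - v a.
Proof.
move=> a0; have h : v a + v a^-1 = 0.
  by rewrite -valM ?invr_eq0 // mulfV // val1.
lia.
Qed.

Lemma valX a m : a != 0 -> v (a ^+ m) = v a * m%:Z.
Proof.
move=> a0; elim: m => [|m IH]; first by rewrite expr0 val1 mulr0.
rewrite exprS valM ?expf_neq0 // IH; lia.
Qed.

Lemma vgeN k a : vge v k (- a) = vge v k a.
Proof. by rewrite /vge oppr_eq0 valN. Qed.

Lemma vgeD k a b : vge v k a -> vge v k b -> vge v k (a + b).
Proof.
rewrite /vge; have [->|a0 /=] := eqVneq a 0; first by rewrite add0r.
have [->|b0 /=] := eqVneq b 0; first by rewrite addr0 (negPf a0).
move=> va vb; have [//|ab0 /=] := eqVneq (a + b) 0.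
have [_ _ _ /(_ _ _ a0 b0 ab0)] := vP; apply: le_trans.
by rewrite le_min va vb.
Qed.

Lemma vgeB k a b : vge v k a -> vge v k b -> vge v k (a - b).
Proof. by move=> va vb; apply: vgeD; rewrite ?vgeN. Qed.

Lemma vgeM k k' a b : vge v k a -> vge v k' b -> vge v (k + k') (a * b).
Proof.
rewrite /vge mulf_eq0; have [//|a0 /=] := eqVneq a 0.
have [//|b0 /=] := eqVneq b 0; rewrite valM //; exact: lerD.
Qed.

Lemma vge_sum (I : Type) (r : seq I) (P : pred I) (F : I -> L) k :
  (forall i, P i -> vge v k (F i)) -> vge v k (\sum_(i <- r | P i) F i).
Proof. by move=> h; elim/big_ind: _ => //; [exact: vge0r|exact: vgeD]. Qed.

Lemma vgeX a m k : vge v k a -> vge v (k * m%:Z) (a ^+ m).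
Proof.
move=> h; elim: m => [|m IH]; first by rewrite expr0 mulr0 /vge val1 lexx orbT.
have -> : k * m.+1%:Z = k + k * m%:Z by lia.
by rewrite exprS; apply: vgeM.
Qed.

Lemma vge_nat m : vge v 0 m%:R.
Proof.
elim: m => [|m IH]; first exact: vge0r.
by rewrite -addn1 natrD vgeD // /vge val1 lexx orbT.
Qed.

Lemma vge_int z : vge v 0 z%:~R.
Proof.
case: z => m; first exact: vge_nat.
by rewrite NegzE rmorphN /= vgeN; exact: vge_nat.
Qed.

Lemma vge_mulz k z a : vge v k a -> vge v k (z%:~R * a).
Proof. by rewrite -{2}[k]add0r; apply: vgeM; exact: vge_int. Qed.

Lemma vge_div k k' a b : b != 0 -> v b <= k' -> vge v (k + k') a -> vge v k (a / b).
Proof.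
move=> b0 vb va; have -> : k = (k + k') - k' by lia.
apply: vgeM => //; rewrite vge_neq0 ?invr_eq0 // valV //; lia.
Qed.

(** If a + b had larger valuation than a, then so would a = (a + b) - b. *)
Lemma vge_lt k a b : a != 0 -> v a < k -> vge v k b -> (a + b != 0) /\ v (a + b) = v a.
Proof.
move=> a0 ak; have [->|b0] := eqVneq b 0; first by rewrite addr0.
rewrite vge_neq0 // => kb.
have ab0 : a + b != 0.
  apply/eqP=> /eqP; rewrite addr_eq0 => /eqP ab; move: ak; rewrite ab valN; lia.
split=> //; apply/eqP; rewrite eq_le; apply/andP; split.
  rewrite leNgt; apply/negP => lt.
  have : vge v (Num.min k (v (a + b))) (a + b - b).
    by apply: vgeB; rewrite vge_neq0 // ge_min ?lexx ?orbT // kb.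
  rewrite addrK vge_neq0 // ge_min; lia.
have : vge v (v a) (a + b).
  by apply: vgeD; rewrite vge_neq0 // (le_trans (ltW ak)).
by rewrite vge_neq0.
Qed.

(** Serves to exclude linear relations whose terms have distinct valuations. *)
Lemma sum_neq0_min (I : finType) (F : I -> L) (i0 : I) :
  F i0 != 0 -> (forall i, i != i0 -> vge v (v (F i0) + 1) (F i)) ->
  \sum_i F i != 0.
Proof.
move=> F0 h; rewrite (bigD1 i0) //=.
have [] // := @vge_lt (v (F i0) + 1) (F i0) (\sum_(i | i != i0) F i) F0.
  by lia.
exact: vge_sum.
Qed.

Variables (p : nat) (p_pr : prime p) (vp : 0 < v p%:R).

(** By Bezout, 1 is a combination of z and p, and would have positive valuation if z had. *)
Lemma v_int_coprime z : ~~ (p %| z)%Z -> v z%:~R = 0.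
Proof.
move=> pz.
have z0 : z%:~R != 0 :> L by rewrite intrL_eq0; apply: contraNneq pz => ->.
have := vge_int z; rewrite vge_neq0 // => vz.
apply/eqP; rewrite eq_le vz andbT leNgt; apply/negP => {}vz.
have cop : coprimez z p.
  by rewrite coprimezE coprime_sym prime_coprime.
have [[x y] /= e] := coprimezP _ _ cop.
have /negP[] : ~~ vge v 1 1 by rewrite /vge oner_eq0 val1.
have <- : x%:~R * z%:~R + y%:~R * (p%:R) = 1 :> L.
  by have /(congr1 (fun t : int => t%:~R : L)) := e; rewrite rmorphD !rmorphM.
apply: vgeD; apply: vge_mulz; rewrite vge_neq0 ?natrL_eq0 //; try lia.
by rewrite -lt0n prime_gt0.
Qed.

End Valuation.
End FinitePlace.

(** * Weak approximation *)

Lemma seq_int_bound (T : eqType) (s : seq T) (F : T -> int) :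
  exists M : nat, forall x, x \in s -> F x <= M%:Z.
Proof.
elim: s => [|x s [M IH]]; first by exists 0%N.
exists (`|F x| + M)%N => y; rewrite inE => /orP[/eqP->|/IH]; lia.
Qed.

Section Approximation.
Variable L : fieldExtType rat.
Implicit Types (v w : L -> int) (a b : L) (vs : seq (L -> int)).

Lemma uniformizer v : finite_place v -> exists2 a, a != 0 & v a = 1.
Proof. by case. Qed.

(** Units at v are units at w, so dividing by powers of a uniformizer pi of v gives w = w(pi) v. As
    w takes the value 1 and w(pi) >= 0, w(pi) = 1. *)
Lemma place_le_eq v w : finite_place v -> finite_place w ->
  (forall a, a != 0 -> 0 <= v a -> 0 <= w a) -> v = w.
Proof.
move=> vP wP le_vw; have [pi pi0 vpi] := uniformizer vP.
have unitw a : a != 0 -> v a = 0 -> w a = 0.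
  move=> a0 va; have h1 := le_vw _ a0; have h2 := le_vw a^-1.
  move: h2; rewrite invr_eq0 !valV // va oppr0 lexx => /(_ a0 isT).
  move: h1; rewrite va lexx => /(_ isT); lia.
have key a : a != 0 -> 0 <= v a -> w a = v a * w pi.
  move=> a0; case va: (v a) => [k|//] _.
  have pik0 : pi ^+ k != 0 by rewrite expf_neq0.
  have ak0 : a / pi ^+ k != 0 by rewrite mulf_neq0 ?invr_eq0.
  have : w (a / pi ^+ k) = 0.
    by apply: unitw => //; rewrite valM ?invr_eq0 // valV // valX // va vpi; lia.
  rewrite valM ?invr_eq0 // valV // valX // => h; lia.
have {}key a : a != 0 -> w a = v a * w pi.
  move=> a0; have [/key->//|va] := leP 0 (v a).
  have := key a^-1; rewrite invr_eq0 !valV // => /(_ a0) h.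
  have {}h : - w a = - v a * w pi by apply: h; lia.
  lia.
have [b b0 wb] := uniformizer wP; move: (key _ b0); rewrite wb => h.
have wpi : 0 <= w pi by apply: le_vw; rewrite // vpi.
have {wpi h} wpi : w pi = 1.
  move: (v b) (w pi) wpi h => x y y0 h; have [x0|x0] := leP x 0; nia.
apply/funext => a; have [->|a0] := eqVneq a 0; first by case: vP wP => -> _ _ _ [->].
by rewrite key // wpi mulr1.
Qed.

(** Neither valuation ring contains the other; the quotient of the two witnesses separates v from w
    strictly. *)
Lemma separate2 v w : finite_place v -> finite_place w -> v <> w ->
  exists a, [/\ a != 0, v a < 0 & 0 < w a].
Proof.
have half v1 v2 : finite_place v1 -> finite_place v2 -> v1 <> v2 ->
    exists a, [/\ a != 0, 0 <= v1 a & v2 a < 0].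
  move=> P1 P2 ne; apply: contrapT => H; apply: ne; apply: place_le_eq => // a a0 va.
  by rewrite leNgt; apply/negP => wa; apply: H; exists a.
move=> vP wP ne; have [a [a0 va wa]] := half _ _ vP wP ne.
have [b [b0 wb vb]] := half _ _ wP vP (nesym ne).
exists (b / a); rewrite mulf_neq0 ?invr_eq0 // !valM ?invr_eq0 // !valV //.
by split => //; lia.
Qed.

Lemma val_add1_gt0 v a : finite_place v -> vge v 1 a -> (1 + a != 0) /\ v (1 + a) = 0.
Proof.
move=> vP va; rewrite -[X in _ = X](val1 vP).
by apply: (@vge_lt _ _ vP 1) => //; rewrite ?oner_neq0 // val1.
Qed.

Lemma val_add1_lt0 v a : finite_place v -> a != 0 -> v a < 0 ->
  (1 + a != 0) /\ v (1 + a) = v a.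
Proof.
by move=> vP a0 va; rewrite addrC; apply: (@vge_lt _ _ vP 0) => //; rewrite /vge val1 ?lexx ?orbT.
Qed.

(** In the induction, a separates v from vs and b separates v from w; a large power of a outweighs b
    on vs. If w a < 0, this power would spoil w, and a^r / (1 + a^r), a unit at both v and w, takes
    its place. *)
Lemma separate v vs : finite_place v -> (forall w, w \in vs -> finite_place w) ->
  v \notin vs -> exists a, [/\ a != 0, v a < 0 & forall w, w \in vs -> 0 < w a].
Proof.
move=> vP; elim: vs => [_ _|w vs IH vsP].
  have [pi pi0 vpi] := uniformizer vP.
  by exists pi^-1; split; rewrite ?invr_eq0 // valV // vpi.
rewrite inE negb_or => /andP[/eqP ne vvs].
have wP : finite_place w by apply: vsP; rewrite mem_head.
have {}vsP u : u \in vs -> finite_place u by move=> uvs; apply: vsP; rewrite inE uvs orbT.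
have [a [a0 va vsa]] := IH vsP vvs.
have [b [b0 vb wb]] := separate2 vP wP ne.
have [M Mb] := seq_int_bound vs (fun u => - u b).
pose r := M.+1; have ar0 : a ^+ r != 0 by rewrite expf_neq0.
have usr u : u \in vs -> 0 < u b + u a * r.
  by move=> uvs; have := Mb _ uvs; have := vsa _ uvs; rewrite /r; nia.
have [wa|wa] := leP 0 (w a).
  exists (a ^+ r * b); rewrite mulf_neq0 //; split=> // [|u].
    by rewrite valM // valX // /r; nia.
  rewrite inE => /orP[/eqP->|uvs].
    by rewrite valM // valX // /r; nia.
  have uP := vsP _ uvs; rewrite valM // valX //; have := usr _ uvs; lia.
have var : v (a ^+ r) < 0 by rewrite valX // /r; nia.
have war : w (a ^+ r) < 0 by rewrite valX // /r; nia.
have [ar10 var1] := val_add1_lt0 vP ar0 var.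
have [_ war1] := val_add1_lt0 wP ar0 war.
exists (b * (a ^+ r / (1 + a ^+ r))).
have q0 : a ^+ r / (1 + a ^+ r) != 0 by rewrite mulf_neq0 // invr_eq0.
rewrite mulf_neq0 //; split=> // [|u].
  by rewrite !valM ?invr_eq0 // valV // var1; lia.
rewrite inE => /orP[/eqP->|uvs].
  by rewrite !valM ?invr_eq0 // valV // war1; lia.
have uP := vsP _ uvs; have ua := vsa _ uvs.
have [|_ uar1] := @val_add1_gt0 u (a ^+ r) uP.
  by rewrite vge_neq0 // valX // /r; nia.
rewrite !valM ?invr_eq0 // valV // uar1 valX //; have := usr _ uvs; lia.
Qed.

(** With a large at v and small on vs, a^r / (1 + a^r) tends to 1 at v and to 0 on vs as r grows. *)
Lemma approx_idem v vs (N : int) : finite_place v ->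
  (forall w, w \in vs -> finite_place w) -> v \notin vs ->
  exists2 e, vge v N (e - 1) & forall w, w \in vs -> vge w N e.
Proof.
move=> vP vsP vvs; have [a [a0 va vsa]] := separate vP vsP vvs.
pose r := `|N|.+1; have ar0 : a ^+ r != 0 by rewrite expf_neq0.
have var : v (a ^+ r) < 0 by rewrite valX // /r; nia.
have [ar10 var1] := val_add1_lt0 vP ar0 var.
exists (a ^+ r / (1 + a ^+ r)) => [|w wvs].
  have -> : a ^+ r / (1 + a ^+ r) - 1 = - (1 + a ^+ r)^-1.
    by field.
  rewrite vgeN // vge_neq0 ?invr_eq0 // valV // var1 valX // /r; nia.
have wP := vsP _ wvs; have wa := vsa _ wvs.
have [|_ war1] := @val_add1_gt0 w (a ^+ r) wP.
  by rewrite vge_neq0 // valX // /r; nia.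
rewrite vge_neq0 ?mulf_neq0 ?invr_eq0 // valM ?invr_eq0 // valV // war1 valX // /r; nia.
Qed.

Lemma approximation vs (y : (L -> int) -> L) (N : (L -> int) -> int) :
  uniq vs -> (forall w, w \in vs -> finite_place w) ->
  exists z, forall w, w \in vs -> vge w (N w) (z - y w).
Proof.
move=> uvs vsP.
have [N' hN] := seq_int_bound vs N.
(* M bounds the poles of the targets, so idempotents of precision N' + M still have precision N'
   after multiplication by a target. *)
have [M hM] := seq_int_bound [seq (v, w) | v <- vs, w <- vs] (fun u => - u.2 (y u.1)).
have ex v : exists e, v \in vs ->
    vge v (N' + M)%N%:Z (e - 1) /\ forall w, w \in vs -> w != v -> vge w (N' + M)%N%:Z e.
  have [vvs|_] := boolP (v \in vs); last by exists 0.
  have [||e h1 h2] := @approx_idem v (rem v vs) (N' + M)%N%:Z (vsP _ vvs).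
  - by move=> w /mem_rem/vsP.
  - by rewrite mem_rem_uniq // inE eqxx.
  exists e => _; split=> // w wvs wv; apply: h2.
  by rewrite mem_rem_uniq // inE wv.
have [e he] := choice ex.
exists (\sum_(v <- vs) e v * y v) => w wvs.
have wP := vsP _ wvs.
rewrite (bigD1_seq w) //= -addrAC.
have small v : v \in vs -> forall b, vge w (N' + M)%N%:Z b -> vge w (N w) (b * y v).
  move=> vvs b vb.
  apply: (@vge_le _ _ ((N' + M)%N%:Z - M%:Z)); first by have := hN _ wvs; lia.
  apply: vgeM => //; have [->|yv0] := eqVneq (y v) 0; first exact: vge0r.
  rewrite vge_neq0 //.
  by have := hM (v, w); rewrite allpairs_f // => /(_ isT) /=; lia.
apply: vgeD => //.
  have -> : e w * y w - y w = (e w - 1) * y w by ring.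
  by apply: small => //; have [] := he _ wvs.
rewrite big_seq_cond; apply: vge_sum => // v /andP[vvs vw]; apply: small => //.
by have [_] := he _ vvs; apply => //; rewrite eq_sym.
Qed.

(** A power of a uniformizer has the right valuation at one place; approximating these powers to
    precision k + 1 keeps the valuations. *)
Lemma exists_val vs (k : (L -> int) -> int) :
  uniq vs -> (forall w, w \in vs -> finite_place w) ->
  exists2 t, t != 0 & forall w, w \in vs -> w t = k w.
Proof.
(* Elsewhere [t != 0] comes from a place of the list, so the empty list is separate. *)
case: vs => [|v0 vs']; first by exists 1; rewrite ?oner_neq0.
set vs := v0 :: vs' => uvs vsP.
have ex w : exists a, finite_place w -> a != 0 /\ w a = k w.
  have [wP|] := pselect (finite_place w); last by exists 0.
  have [pi pi0 wpi] := uniformizer wP.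
  exists (if 0 <= k w then pi ^+ `|k w| else (pi ^+ `|k w|)^-1) => _.
  have [kw|kw] := leP 0 (k w).
    by rewrite expf_neq0 // valX // wpi; split=> //; lia.
  rewrite invr_eq0 expf_neq0 // valV ?expf_neq0 // valX // wpi; split=> //; lia.
have [y hy] := choice ex.
have [z hz] := approximation y (fun w => k w + 1) uvs vsP.
have key w : w \in vs -> z != 0 /\ w z = k w.
  move=> wvs; have wP := vsP _ wvs; have [y0 wy] := hy _ wP.
  rewrite -{1}(subrK (y w) z) -{2}(subrK (y w) z) addrC -wy.
  by apply: (@vge_lt _ _ wP (k w + 1)) => //; [lia|exact: hz].
exists z; first by have [] := key v0 (mem_head _ _).
by move=> w /key[].
Qed.

End Approximation.

(** * Bases of quotients of fractional ideals *)

Section Combinations.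
Variable L : fieldExtType rat.
Implicit Types (s t : seq L) (c d : nat -> int).

(** Integers stand for their classes modulo p. Taking the coefficients as a function on [nat] makes
    concatenation of lists a shift of indices. *)
Definition zcomb c s : L := \sum_(0 <= i < size s) (c i)%:~R * s`_i.

Lemma zcomb_nil c : zcomb c [::] = 0.
Proof. by rewrite /zcomb big_geq. Qed.

Lemma zcomb_cons c y s : zcomb c (y :: s) = (c 0%N)%:~R * y + zcomb (c \o S) s.
Proof. by rewrite /zcomb big_nat_recl. Qed.

Lemma zcomb_cat c s t :
  zcomb c (s ++ t) = zcomb c s + zcomb (fun i => c (size s + i)%N) t.
Proof.
elim: s c => [|y s IH] c; first by rewrite zcomb_nil add0r.
by rewrite cat_cons !zcomb_cons IH addrA.
Qed.

Lemma eq_zcomb c d s : (forall i, (i < size s)%N -> c i = d i) -> zcomb c s = zcomb d s.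
Proof. by move=> e; apply: eq_big_nat => i /andP[_ /e->]. Qed.

Lemma zcombB c d s : zcomb (fun i => c i - d i) s = zcomb c s - zcomb d s.
Proof. by rewrite /zcomb -sumrB; apply: eq_bigr => i _; rewrite rmorphB mulrBl. Qed.

Lemma zcombZ z c s : zcomb (fun i => z * c i) s = z%:~R * zcomb c s.
Proof. by rewrite /zcomb mulr_sumr; apply: eq_bigr => i _; rewrite rmorphM mulrA. Qed.

Lemma zcomb_map a c s : zcomb c [seq a * y | y <- s] = a * zcomb c s.
Proof.
elim: s c => [|y s IH] c; first by rewrite !zcomb_nil mulr0.
by rewrite map_cons !zcomb_cons IH mulrDr mulrCA.
Qed.

(* Dividing by the content makes the relation primitive. *)
Lemma zcomb_not_free (p : nat) s : prime p -> ~~ free s ->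
  exists c, zcomb c s = 0 /\ exists2 i, (i < size s)%N & ~~ (p %| c i)%Z.
Proof.
move=> p_pr; rewrite -[s in free s]/(tval (in_tuple s)) => /freeP nfree.
have [k [ks [i0 ki0]]] : exists k : 'I_(size s) -> rat,
    \sum_i k i *: s`_i = 0 /\ exists i, k i != 0.
  apply: contrapT => H; apply: nfree => k ks i; apply/eqP.
  by apply: contrapT => /negP ki; apply: H; exists k; split=> //; exists i.
(* The rational coefficients become a polynomial, for which clearing denominators and dividing by
   the content are available. *)
pose q := \poly_(i < size s) (if insub i is Some j then k j else 0).
have qE (i : 'I_(size s)) : q`_i = k i.
  by rewrite coef_poly ltn_ord; case: insubP (ltn_ord i) => [j _ /val_inj->|/negPf->].
have [r [a a0 qr]] := rat_poly_scale q.
have r0 : r != 0.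
  apply: contraNneq ki0 => r0; rewrite -qE qr r0 rmorph0 scaler0 coef0 //.
have sz_r : (size r <= size s)%N.
  have -> : size r = size q.
    by rewrite qr size_scale ?invr_eq0 ?intr_eq0 // size_map_poly_id0 // intr_eq0 lead_coef_eq0.
  exact: size_poly.
exists (fun i => (zprimitive r)`_i); split; last first.
  apply: contrapT => H.
  have : (p %| zcontents (zprimitive r))%Z.
    rewrite dvdz_contents; apply/polyOverP => i.
    have [|si] := ltnP i (size s).
      by move=> si; apply: contrapT => /negP pi; apply: H; exists i.
    by rewrite nth_default ?dvdz0 // size_zprimitive (leq_trans sz_r).
  by rewrite zcontents_primitive r0 dvdz1 /=; apply/negP; rewrite neq_ltn prime_gt1 ?orbT.
have e0 : (zcontents r)%:~R * zcomb (fun i => (zprimitive r)`_i) s = 0.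
  rewrite -zcombZ /zcomb big_mkord.
  apply/eqP; rewrite -(mulrI_eq0 _ (x := (a%:~R : L)^-1)); last first.
    by apply: mulfI; rewrite invr_eq0 intrL_eq0.
  apply/eqP; rewrite -[RHS]ks mulr_sumr; apply: eq_bigr => i _.
  rewrite -qE qr -coefZ -zpolyEprim coefZ coef_map /= mulrA.
  rewrite -[in RHS]mulr_algl; congr (_ * _).
  rewrite -[RHS]/(in_alg L _) rmorphM fmorphV !rmorph_int //.
by apply/eqP; move/eqP: e0; rewrite mulf_eq0 intrL_eq0 zcontents_eq0 (negPf r0).
Qed.

Lemma zcomb_dependent (p : nat) s : prime p -> (\dim {:L} < size s)%N ->
  exists c, zcomb c s = 0 /\ exists2 i, (i < size s)%N & ~~ (p %| c i)%Z.
Proof.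
move=> p_pr ds; apply: zcomb_not_free p_pr _.
by rewrite /free neq_ltn (leq_ltn_trans (dimvS (subvf _))).
Qed.

End Combinations.

Lemma finite_setT_fin (I : finType) : finite_set [set: I].
Proof. by apply/finite_seqP; exists (enum I); apply/seteqP; split=> x //= _; rewrite mem_enum. Qed.

Lemma card_fset_set_range (I : finType) (T : choiceType) (g : I -> T) :
  injective g -> #|` fset_set (range g)|%fset = #|I|.
Proof.
move=> ginj; have fI := finite_setT_fin I; rewrite fset_set_image // card_imfset //=.
have -> : fset_set [set: I] = [fset x in I]%fset.
  by apply/fsetP => x; rewrite in_fset_set // mem_set // !inE.
by rewrite card_imfset //= -cardE.
Qed.

Section Lattices.
Variables (L : fieldExtType rat) (p : nat) (p_pr : prime p).
Implicit Types (v w : L -> int) (a b y : L) (vs : seq (L -> int)) (s t : seq L).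

Definition place_over v := finite_place v /\ 0 < v p%:R.

Definition fideal vs (k : (L -> int) -> int) y := all (fun v => vge v (k v) y) vs.

Section Fixed.
Variables (vs : seq (L -> int)) (vsP : forall v, v \in vs -> place_over v).

Lemma fidealB k y z : fideal vs k y -> fideal vs k z -> fideal vs k (y - z).
Proof.
move=> /allP hy /allP hz; apply/allP => v vvs.
by apply: vgeB; [case: (vsP vvs)|exact: hy|exact: hz].
Qed.

Lemma fideal0 k : fideal vs k 0. Proof. by apply/allP => v _; exact: vge0r. Qed.

Lemma fidealN k y : fideal vs k y -> fideal vs k (- y).
Proof. by move=> h; rewrite -sub0r fidealB ?fideal0. Qed.

Lemma fidealD k y z : fideal vs k y -> fideal vs k z -> fideal vs k (y + z).
Proof. by move=> hy hz; rewrite -[z]opprK fidealB ?fidealN. Qed.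

Lemma fideal_mulz k (z : int) y : fideal vs k y -> fideal vs k (z%:~R * y).
Proof.
move=> /allP h; apply/allP => v vvs.
by apply: vge_mulz; [case: (vsP vvs)|exact: h].
Qed.

Lemma fideal_zcomb k c s : all (fideal vs k) s -> fideal vs k (zcomb c s).
Proof.
elim: s c => [|y s IH] c; first by rewrite zcomb_nil fideal0.
by move=> /= /andP[hy hs]; rewrite zcomb_cons fidealD ?fideal_mulz ?IH.
Qed.

Lemma fideal_le k k' y : (forall v, v \in vs -> k' v <= k v) -> fideal vs k y -> fideal vs k' y.
Proof.
by move=> le_k /allP h; apply/allP => v vvs; apply: vge_le (le_k _ vvs) (h _ vvs).
Qed.

Lemma fideal_mulp k k' (z : int) y : (forall v, v \in vs -> k' v <= k v + v p%:R) ->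
  (p %| z)%Z -> fideal vs k y -> fideal vs k' (z%:~R * y).
Proof.
move=> le_k /dvdzP[x ->] /allP h; apply/allP => v vvs.
have [vP vp] := vsP vvs; apply: (vge_le (le_k _ vvs)).
rewrite addrC; apply: vgeM => //; last exact: h.
by rewrite rmorphM; apply: vge_mulz => //; exact: vge_val.
Qed.

(* [s] is a basis of the F_p-space I(k) / I(k'), where I(k) is the fractional
   ideal of elements of valuation at least [k] at the places of [vs]. *)
Definition modbasis vs k k' s :=
  [/\ all (fideal vs k) s,
      forall y, fideal vs k y -> exists c, fideal vs k' (y - zcomb c s) &
      forall c, fideal vs k' (zcomb c s) -> forall i, (i < size s)%N -> (p %| c i)%Z].

Lemma modbasis_nil k k' : (forall v, v \in vs -> k' v <= k v) -> modbasis vs k k' [::].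
Proof.
move=> le_k; split=> // y hy; exists (fun=> 0).
by rewrite zcomb_nil subr0; exact: fideal_le hy.
Qed.

Lemma modbasis_cat k1 k2 k3 s t :
  (forall v, v \in vs -> k1 v <= k2 v) -> (forall v, v \in vs -> k2 v <= k3 v) ->
  (forall v, v \in vs -> k3 v <= k1 v + v p%:R) ->
  modbasis vs k1 k2 s -> modbasis vs k2 k3 t -> modbasis vs k1 k3 (s ++ t).
Proof.
move=> le12 le23 le31 [s1 s2 s3] [t1 t2 t3]; split.
- rewrite all_cat s1; apply/allP => y yt; apply: (fideal_le le12); exact: (allP t1).
- move=> y hy; have [c hc] := s2 _ hy; have [d hd] := t2 _ hc.
  exists (fun i => if (i < size s)%N then c i else d (i - size s)%N).
  rewrite zcomb_cat opprD addrA.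
  rewrite (@eq_zcomb _ _ c); last by move=> i ->.
  rewrite [X in _ - X](@eq_zcomb _ _ d) // => i _.
  by rewrite ltnNge leq_addr /= addKn.
- move=> c; rewrite zcomb_cat => h.
  have h2 : fideal vs k2 (zcomb c s).
    rewrite -[zcomb c s](addrK (zcomb (fun i => c (size s + i)%N) t)).
    by apply: fidealB; [exact: fideal_le h|exact: fideal_zcomb].
  have pc := s3 _ h2.
  have h3 : fideal vs k3 (zcomb (fun i => c (size s + i)%N) t).
    rewrite -[zcomb _ t](addKr (zcomb c s)) addrC; apply: fidealB => //.
    rewrite /zcomb big_nat; elim/big_ind: _ => [||i si]; [exact: fideal0|exact: fidealD|].
    by apply: (fideal_mulp le31); [exact: pc|apply: (allP s1); apply: mem_nth].
  have pd := t3 _ h3.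
  move=> i; rewrite size_cat => hi; have [/pc//|si] := ltnP i (size s).
  by have := pd (i - size s)%N; rewrite subnKC // => -> //; rewrite ltn_subLR.
Qed.

End Fixed.

(** A longest independent list is a basis. More than [L : Q] elements satisfy a primitive integral
    relation, hence are dependent modulo p, which bounds the length. *)
Lemma residue_basis v : place_over v ->
  exists2 s, modbasis [:: v] (fun=> 0) (fun=> 1) s & (size s <= \dim {:L})%N.
Proof.
move=> vp; have [vP vp0] := vp.
have vsP w : w \in [:: v] -> place_over w by rewrite inE => /eqP->.
pose indep s := all (fideal [:: v] (fun=> 0)) s /\ forall c, fideal [:: v] (fun=> 1) (zcomb c s) ->
  forall i, (i < size s)%N -> (p %| c i)%Z.
have indep_le s : indep s -> (size s <= \dim {:L})%N.
  move=> [_ h]; rewrite leqNgt; apply/negP => /(zcomb_dependent p_pr)[c [c0 [i si]]].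
  by rewrite h // c0 fideal0.
pose P m := `[< exists2 s, indep s & size s = m >].
have ex : exists m, P m by exists 0%N; apply/asboolP; exists [::].
have bound m : P m -> (m <= \dim {:L})%N by move/asboolP => [s /indep_le + <-].
case: (ex_maxnP ex bound) => m /asboolP[s [s1 s3] sm] maxm.
exists s; last by apply: indep_le.
split=> // y hy.
have nP : ~ indep (y :: s).
  move=> h; suff : P m.+1 by move/maxm; rewrite ltnn.
  by apply/asboolP; exists (y :: s); rewrite //= sm.
have [c [hc [i si pi]]] : exists c, fideal [:: v] (fun=> 1) (zcomb c (y :: s)) /\
    exists2 i, (i < size (y :: s))%N & ~~ (p %| c i)%Z.
  apply: contrapT => H; apply: nP; split; first by apply/andP; split.
  move=> c hc i si; apply: contrapT => /negP pi; apply: H; exists c; split=> //.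
  by exists i.
move: hc; rewrite zcomb_cons => hc.
have pc0 : ~~ (p %| c 0%N)%Z.
  apply/negP => pc0; case: i => [|i] in si pi; first by rewrite pc0 in pi.
  rewrite (s3 (c \o S)) // in pi.
  rewrite -[zcomb _ _](addKr ((c 0%N)%:~R * y)) addrC fidealB //.
  by apply: (fideal_mulp vsP _ pc0 hy) => w /=; rewrite inE => /eqP->; lia.
(* m' inverts the coefficient of y modulo p, so the relation can be solved for y. *)
have [[m' l] /= e] : exists uv : int * int, uv.1 * c 0%N + uv.2 * p = 1.
  apply/coprimezP.
  by rewrite coprimezE coprime_sym prime_coprime.
exists (fun i => - m' * c i.+1).
rewrite zcombZ.
have -> : y - (- m')%:~R * zcomb (c \o S) s =
   m'%:~R * ((c 0%N)%:~R * y + zcomb (c \o S) s) + (l * p)%:~R * y.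
  have e' : (m' * c 0%N)%:~R + (l * p)%:~R = 1 :> L by rewrite -rmorphD /= e.
  have ey : y = ((m' * c 0%N)%:~R + (l * p)%:~R) * y by rewrite e' mul1r.
  rewrite [X in X - _]ey mulrNz rmorphM /=; ring.
apply: (fidealD vsP); first exact: (fideal_mulz vsP).
apply: (fideal_mulp vsP _ _ hy); last exact: dvdz_mull.
by move=> w; rewrite inE => /eqP ->; lia.
Qed.

(** Combinations of s with coefficients in 0, ..., p - 1 represent each residue class exactly
    once. *)
Lemma place_norm_basis v s : place_over v -> 
  modbasis [:: v] (fun=> 0) (fun=> 1) s -> place_norm v = (p ^ size s)%N.
Proof.
move=> vp [s1 s2 s3]; have [vP vp0] := vp.
have vsP w : w \in [:: v] -> place_over w by rewrite inE => /eqP->.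
pose coset a : set L := [set b | valuation_ideal v (b - a)].
have idealE b : valuation_ideal v b <-> vge v 1 b.
  rewrite /valuation_ideal /vge /=; split=> [[->|vb]|/orP[/eqP|vb]]; rewrite ?eqxx ?orbT //.
  - by apply/orP; right; lia.
  - by left.
  - by right; lia.
have invE k b : fideal [:: v] k b = vge v (k v) b by rewrite /fideal /= andbT.
have cosetP a b : coset a = coset b <-> vge v 1 (a - b).
  split=> [e|h].
    have : coset a a by rewrite /coset /= subrr; apply/idealE; exact: vge0r.
    by rewrite e => /idealE.
  apply/seteqP; split=> x /idealE hx; apply/idealE.
    by rewrite -(subrKA a) vgeD.
  by rewrite -(subrKA b) vgeD // -vgeN // opprB.
pose cf (f : {ffun 'I_(size s) -> 'I_p}) (i : nat) : int :=
  if insub i is Some j then (f j : nat)%:Z else 0.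
have cfE f (i : 'I_(size s)) : cf f i = f i.
  by rewrite /cf; case: insubP (ltn_ord i) => [j _ /val_inj->|/negPf->].
pose g f := coset (zcomb (cf f) s).
have p_gt0 := prime_gt0 p_pr.
have ginj : injective g.
  move=> f f' /cosetP; rewrite -zcombB => h; apply/ffunP => i.
  have := s3 (fun j => cf f j - cf f' j) _ i (ltn_ord i); rewrite invE !cfE => /(_ h) /dvdzP[q e].
  apply/val_inj => /=; have := ltn_ord (f i); have := ltn_ord (f' i).
  move: (f i : nat) (f' i : nat) e => x y e hy hx {h s3}.
  have [q1|q1] := leP 1 q; first by nia.
  by have [q2|q2] := leP q (- 1); nia.
rewrite /place_norm; have -> : residue_field v = range g.
  apply/seteqP; split=> [_ [a va <-]|_ [f _ <-]]; last first.
    exists (zcomb (cf f) s) => //.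
    have := fideal_zcomb vsP (cf f) s1; rewrite invE /vge /valuation_ring /=.
    by case/orP => [/eqP|]; [left|right].
  have [|c] := s2 a.
    by rewrite invE /vge; case: va => [->|->]; rewrite ?eqxx ?orbT.
  rewrite invE => hc.
  have cp i : (`|(c i %% p)%Z| < p)%N.
    have := modz_ge0 (c i) (_ : p%:Z != 0); have := ltz_pmod (c i) (_ : 0 < p%:Z).
    by lia.
  exists [ffun i : 'I_(size s) => Ordinal (cp i)] => //.
  apply/cosetP; rewrite -vgeN // opprB.
  rewrite -(subrKA (zcomb c s)) vgeD // -zcombB -[X in vge v X]/((fun=> 1) v) -invE.
  rewrite /zcomb big_nat; elim/big_ind: _ => [||i si]; [exact: fideal0|exact: (fidealD vsP)|].
  apply: (fideal_mulp vsP _ _ (k := fun=> 0)).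
  - by move=> w; rewrite inE => /eqP->; lia.
  - have -> : cf [ffun j : 'I_(size s) => Ordinal (cp j)] i = (c i %% p)%Z.
      rewrite (cfE _ (Ordinal (si : (i < size s)%N))) ffunE /= gez0_abs // modz_ge0 //; lia.
    by apply/dvdzP; exists (c i %/ p)%Z; have := divz_eq (c i) p; lia.
  by apply: (allP s1); apply: mem_nth.
by rewrite card_fset_set_range // card_ffun !card_ord.
Qed.

End Lattices.

(** * Filtrations of fractional ideals and local degrees *)

Section Chains.
Variables (L : fieldExtType rat) (p : nat) (p_pr : prime p).
Implicit Types (v w : L -> int) (a b y : L) (vs : seq (L -> int)) (s t : seq L).
Implicit Types k : (L -> int) -> int.

(** The residue degree f_v; [place_normE] shows that the norm is indeed a power of p. *)
Definition rdeg v := logn p (place_norm v).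

Lemma rdeg_basis v : place_over p v ->
  exists2 s, modbasis p [:: v] (fun=> 0) (fun=> 1) s & size s = rdeg v.
Proof.
move=> vp; have [s sb _] := residue_basis p_pr vp; exists s => //.
by rewrite /rdeg (place_norm_basis p_pr vp sb) pfactorK.
Qed.

Lemma place_normE v : place_over p v -> place_norm v = (p ^ rdeg v)%N.
Proof.
move=> vp; have [s sb <-] := rdeg_basis vp; exact: place_norm_basis vp sb.
Qed.

Lemma rdeg_gt0 v : place_over p v -> (0 < rdeg v)%N.
Proof.
move=> vp; have [vP _] := vp; have [[|y s] [_ s2 _] <-] // := rdeg_basis vp.
have [|c] := s2 1; first by rewrite /fideal /= /vge val1 // lexx orbT.
by rewrite zcomb_nil subr0 /fideal /= andbT vge_neq0 ?oner_neq0 // val1.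
Qed.

Lemma rdeg_le v : place_over p v -> (rdeg v <= \dim {:L})%N.
Proof.
move=> vp; have [s sb ss] := residue_basis p_pr vp.
by rewrite /rdeg (place_norm_basis p_pr vp sb) pfactorK.
Qed.

Variables (vs : seq (L -> int)) (uvs : uniq vs).
Hypothesis vsP : forall v, v \in vs -> place_over p v.

Let vsfin v : v \in vs -> finite_place v. Proof. by case/vsP. Qed.

Definition incr v k w : int := k w + (w == v)%:Z.

(** I(k) / I(k + [v]) is a copy of the residue field at v: a residue basis is lifted to elements
    integral on vs and multiplied by some t with valuations k. *)
Lemma modbasis_step v k : v \in vs ->
  exists2 s, modbasis p vs k (incr v k) s & size s = rdeg v.
Proof.
move=> vvs; have vp := vsP vvs; have vP := vsfin vvs.
have [s0 [s1 s2 s3] ss] := rdeg_basis vp.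
have [t t0 tk] := exists_val k uvs vsfin.
have invE k' b : fideal [:: v] k' b = vge v (k' v) b by rewrite /fideal /= andbT.
(* z has the residue of y at v (precision 1) and is integral at the other places (precision 0). *)
have ex y : exists z, forall w, w \in vs -> vge w (w == v)%:Z (z - (if w == v then y else 0)).
  exact: (approximation (fun w => if w == v then y else 0) (fun w => (w == v)%:Z) uvs vsfin).
have [z hz] := choice ex.
have zv y : vge v 1 (z y - y) by have := hz y v vvs; rewrite eqxx.
have zw y w : w \in vs -> w != v -> vge w 0 (z y).
  by move=> wvs /negPf wv; have := hz y w wvs; rewrite wv subr0.
have zc c : vge v 1 (zcomb c (map z s0) - zcomb c s0).
  elim: {s1 s2 s3 ss} s0 c => [|y s IH] c; first by rewrite !zcomb_nil subr0 vge0r.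
  rewrite map_cons !zcomb_cons opprD addrACA -mulrBr vgeD //; by apply: vge_mulz => //; exact: zv.
have zcw c w : w \in vs -> w != v -> vge w 0 (zcomb c (map z s0)).
  move=> wvs wv; have wP := vsfin wvs.
  elim: {s1 s2 s3 ss zc} s0 c => [|y s IH] c; first by rewrite !zcomb_nil vge0r.
  by rewrite map_cons !zcomb_cons vgeD // vge_mulz // zw.
have tmul w m y : w \in vs -> vge w (k w + m) (t * y) = vge w m y.
  move=> wvs; have wP := vsfin wvs; rewrite /vge mulf_eq0 (negPf t0) /=.
  by have [//|y0 /=] := eqVneq y 0; rewrite valM // tk // lerD2l.
exists [seq t * y | y <- map z s0]; last by rewrite !size_map.
split.
- apply/allP => _ /mapP[_ /mapP[y ys ->] ->]; apply/allP => w wvs /=.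
  rewrite -[k w]addr0 tmul //; have [->|wv] := eqVneq w v; last exact: zw.
  rewrite -[z y](subrK y) vgeD //; first by apply: (vge_le _ (zv y)).
  by have := allP s1 _ ys; rewrite invE.
- move=> y /allP hy.
  have hyt w : w \in vs -> vge w 0 (y / t).
    move=> wvs; rewrite -tmul // addr0 mulrC divfK //; exact: hy.
  have [|c] := s2 (y / t); first by rewrite invE hyt.
  rewrite invE => hc; exists c; apply/allP => w wvs /=.
  rewrite zcomb_map.
  have -> : y - t * zcomb c (map z s0) = t * (y / t - zcomb c (map z s0)).
    by rewrite mulrBr mulrCA divff // mulr1.
  rewrite /incr tmul //; have [->|wv] := eqVneq w v; last first.
    by apply: vgeB; [exact: vsfin|exact: hyt|exact: zcw].
  rewrite -(subrKA (zcomb c s0)); apply: (vgeD vP); first exact: hc.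
  by rewrite -(vgeN vP) opprB; exact: zc.
- move=> c /allP hc i; rewrite !size_map => hi; apply: (s3 c) => //.
  have := hc v vvs; rewrite zcomb_map /incr eqxx tmul // invE => h.
  by rewrite -[zcomb _ _](subKr (zcomb c (map z s0))) vgeB.
Qed.

(** k is raised to k' by one unit at one place at a time; each unit at v adds a residue basis of f_v
    elements. *)
Lemma modbasis_chain k k' :
  (forall v, v \in vs -> k v <= k' v) ->
  (forall v, v \in vs -> k' v <= k v + v p%:R) ->
  exists2 s, modbasis p vs k k' s &
    (size s)%:Z = \sum_(v <- vs) (k' v - k v) * (rdeg v)%:Z.
Proof.
move: {2}(\sum_(v <- vs) `|k' v - k v|)%N (erefl (\sum_(v <- vs) `|k' v - k v|)%N) => N.
elim: N k => [|N IH] k hN le1 le2.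
  have kk v : v \in vs -> k' v = k v.
    move=> vvs; move/eqP: hN; rewrite sum_nat_seq_eq0 => /allP /(_ _ vvs) /=; lia.
  exists [::]; first by apply: modbasis_nil => // v /kk->.
  by rewrite big_seq big1 // => v /kk->; rewrite subrr mul0r.
have [v vvs kv] : exists2 v, v \in vs & k v < k' v.
  apply: contrapT => H; move/eqP: hN; apply/negP.
  rewrite big_seq big1 // => v vvs; apply/eqP; rewrite absz_eq0 subr_eq0; apply/eqP.
  apply: le_anti; rewrite le1 // andbT leNgt; apply/negP => ?; apply: H; by exists v.
have [s sb ss] := modbasis_step k vvs.
have i1 w : w \in vs -> k w <= incr v k w by move=> _; rewrite /incr; lia.
have i2 w : w \in vs -> incr v k w <= k' w.
  by move=> wvs; rewrite /incr; have [->|] := eqVneq w v; have := le1 _ wvs; lia.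
have [||t tb tt] := IH (incr v k) _ i2.
- move: hN; rewrite !(bigD1_seq v) //= /incr eqxx.
  rewrite [in X in _ -> X](eq_bigr (fun w => `|k' w - k w|%N)); last first.
    by move=> w /negPf->; rewrite addr0.
  by move=> h; lia.
- by move=> w wvs; have := le2 _ wvs; rewrite /incr; have := i1 _ wvs; lia.
exists (s ++ t); first exact: (modbasis_cat vsP i1 i2 le2 sb tb).
rewrite size_cat PoszD tt ss !(bigD1_seq v) //= /incr eqxx.
rewrite (eq_bigr (fun w => (k' w - k w) * (rdeg w)%:Z)); last first.
  by move=> w /negPf->; rewrite addr0.
rewrite -[nat_of_bool true]/1%N; move: (\sum_(w <- _ | _) _) => X; lia.
Qed.

Lemma modbasis_size k k' s : modbasis p vs k k' s -> (size s <= \dim {:L})%N.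
Proof.
move=> [_ _ h]; rewrite leqNgt; apply/negP => /(zcomb_dependent p_pr)[c [c0 [i si]]].
by rewrite h // c0 fideal0.
Qed.

(** Here v(p) is the ramification index e_v, and the left side is the F_p-dimension of I(0) /
    I(v(p)), whose bases are linearly independent over Q. Since vs is any list of places over p,
    this also bounds their number. *)
Lemma sum_local_degrees_le :
  \sum_(v <- vs) v p%:R * (rdeg v)%:Z <= (\dim {:L})%:Z.
Proof.
have [|v vvs|s sb] := @modbasis_chain (fun=> 0) (fun v => v p%:R).
- by move=> v /vsP[_] /ltW.
- by rewrite add0r.
under eq_bigr do rewrite subr0.
by move=> <-; have := modbasis_size sb.
Qed.

Lemma size_places_le : (size vs <= \dim {:L})%N.
Proof.
rewrite -lez_nat (le_trans _ sum_local_degrees_le) // -sum1_size.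
rewrite (big_morph _ PoszD (erefl _)) big_seq [leRHS]big_seq; apply: ler_sum => v vvs.
have [_ vp0] := vsP vvs; have := rdeg_gt0 (vsP vvs); nia.
Qed.

End Chains.

(** Lists of distinct places over p have length at most [L : Q], so a longest one contains them
    all. *)
Lemma places_finite (L : fieldExtType rat) (p : nat) : prime p ->
  exists vs : seq (L -> int), uniq vs /\ forall v, v \in vs <-> place_over p v.
Proof.
move=> p_pr.
pose P m := `[< exists vs : seq (L -> int),
  [/\ uniq vs, forall v, v \in vs -> place_over p v & size vs = m] >].
have ex : exists m, P m by exists 0%N; apply/asboolP; exists [::].
have bound m : P m -> (m <= \dim {:L})%N.
  by move/asboolP => [vs [uvs vsP <-]]; apply: (size_places_le p_pr uvs vsP).
case: (ex_maxnP ex bound) => m /asboolP[vs [uvs vsP sm]] maxm.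
exists vs; split=> // v; split; first exact: vsP.
move=> vp; apply: contrapT => /negP vvs.
suff : P m.+1 by move/maxm; rewrite ltnn.
apply/asboolP; exists (v :: vs); split; rewrite /= ?vvs ?sm //.
by move=> w; rewrite inE => /orP[/eqP->|/vsP].
Qed.

(** * Existence of places *)

Section MaximalNonunital.
Variables (L : fieldExtType rat) (p : nat) (p_pr : prime p).
Implicit Types (m : set L) (x y a b : L).

(** Candidates for the maximal ideal of a valuation ring. Maximality among such sets replaces
    maximality among pairs of a subring and an ideal. *)
Definition nonunital m :=
  [/\ forall a b, m a -> m b -> m (a - b), forall a b, m a -> m b -> m (a * b) & ~ m 1].

Variable m : set L.
Hypotheses (m_nu : nonunital m) (mp : m p%:R).
Hypothesis m_max : forall m', nonunital m' -> m `<=` m' -> m' `<=` m.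

Let mB a b : m a -> m b -> m (a - b). Proof. by case: m_nu => h _ _; apply: h. Qed.
Let mM a b : m a -> m b -> m (a * b). Proof. by case: m_nu => _ h _; apply: h. Qed.
Let m1 : ~ m 1. Proof. by case: m_nu. Qed.
Let m0 : m 0. Proof. by rewrite -(subrr p%:R); apply: mB. Qed.
Let mN a : m a -> m (- a). Proof. by move=> ma; rewrite -sub0r; apply: mB. Qed.
Let mD a b : m a -> m b -> m (a + b).
Proof. by move=> ma mb; rewrite -[b]opprK; apply: mB => //; apply: mN. Qed.
Let m_sum (I : Type) (r : seq I) (P : pred I) (F : I -> L) :
  (forall i, P i -> m (F i)) -> m (\sum_(i <- r | P i) F i).
Proof. by move=> h; elim/big_ind: _ => //; exact: mD. Qed.

(* For a maximal [m], this is a valuation ring with maximal ideal [m]. *)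
Definition vring x := forall a, m a -> m (x * a).

Let B1 : vring 1. Proof. by move=> a; rewrite mul1r. Qed.
Let BB x y : vring x -> vring y -> vring (x - y).
Proof. by move=> bx by_ a ma; rewrite mulrBl; apply: mB; [apply: bx|apply: by_]. Qed.
Let BM x y : vring x -> vring y -> vring (x * y).
Proof. by move=> bx by_ a ma; rewrite -mulrA; apply: bx; apply: by_. Qed.
Let Bm a : m a -> vring a. Proof. by move=> ma b mb; apply: mM. Qed.
Let B0 : vring 0. Proof. exact: Bm. Qed.
Let BN x : vring x -> vring (- x).
Proof. by move=> bx; rewrite -sub0r; apply: BB. Qed.
Let BD x y : vring x -> vring y -> vring (x + y).
Proof. by move=> bx by_; rewrite -[y]opprK; apply: BB => //; apply: BN. Qed.
Let BX x k : vring x -> vring (x ^+ k).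
Proof. by move=> bx; elim: k => [|k IH]; rewrite ?expr0 ?exprS //; apply: BM. Qed.
Let B_int (z : int) : vring z%:~R.
Proof.
have Bn (k : nat) : vring k%:R.
  by elim: k => [|k IH] //; rewrite -addn1 natrD; apply: BD.
by case: z => k; [exact: Bn|rewrite NegzE mulrNz; apply: BN; exact: Bn].
Qed.

Let pin (P : {poly L}) := forall i, m P`_i.

(* Chevalley's argument: of two relations of minimal degrees, the one of larger
   degree can be shortened with the help of the other. *)
Let no_both N (P Q : {poly L}) x : x != 0 -> pin P -> pin Q ->
  (size P + size Q <= N)%N -> P.[x] = 1 -> Q.[x^-1] = 1 -> False.
Proof.
elim: N P Q x => [|N IH] P Q x x0 hP hQ.
  rewrite leqn0 addn_eq0 size_poly_eq0 => /andP[/eqP-> _] /eqP.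
  by rewrite horner0 eq_sym oner_eq0.
wlog sQP : P Q x x0 hP hQ / (size Q <= size P)%N => [wl|] sN Px Qx.
  have [sQP|sPQ] := leqP (size Q) (size P); first exact: (wl P Q x).
  apply: (wl Q P x^-1) => //; rewrite ?invr_eq0 ?invrK //; first exact: ltnW.
  by rewrite addnC.
have [sP|sP] := leqP (size P) 1.
  by move: Px; rewrite (size1_polyC sP) hornerC => P0; apply: m1; rewrite -P0.
case Er : (size P) => [|r] in sP sQP sN *; first by [].
have r_gt0 : (0 < r)%N by [].
(* Q(1/x) = 1 expresses x^r (1 - Q_0) through powers below r. Multiplying P(x) = 1 by 1 - Q_0,
   substituting this in the leading term and adding Q_0 gives P'(x) = 1. *)
pose P' := \poly_(j < r) ((j == 0%N)%:R * Q`_0 + (1 - Q`_0) * P`_j + P`_r * Q`_(r - j)).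
apply: (IH P' Q x) => //.
- move=> i; rewrite coef_poly; case: ifP => // _.
  apply: mD; last exact: mM.
  apply: mD; first by case: (i == 0%N); rewrite ?mul1r ?mul0r.
  by rewrite mulrBl mul1r; apply: mB => //; apply: mM.
- by move: sN; rewrite addSn ltnS; apply: leq_trans; rewrite leq_add2r size_poly.
rewrite horner_poly.
have eP : \sum_(j < r) P`_j * x ^+ j = 1 - P`_r * x ^+ r.
  by apply/eqP; rewrite eq_sym subr_eq -Px (horner_coef_wide _ (eq_leq Er)) big_ord_recr.
have eQ : \sum_(j < r) Q`_(r - j) * x ^+ j = x ^+ r * (1 - Q`_0).
  have -> : 1 - Q`_0 = \sum_(i < r) Q`_i.+1 * x^-1 ^+ i.+1.
    apply/eqP; rewrite subr_eq -Qx (horner_coef_wide _ sQP) big_ord_recl /= expr0 mulr1 addrC.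
    by apply/eqP.
  rewrite mulr_sumr (reindex_inj rev_ord_inj) /=; apply: eq_bigr => i _.
  have -> : (r - (r - i.+1) = i.+1)%N by rewrite subKn.
  rewrite mulrCA; congr (_ * _).
  by rewrite exprVn; apply: (canRL (mulfK _)); rewrite ?expf_neq0 // -exprD subnK.
have eD : \sum_(j < r) (nat_of_ord j == 0%N)%:R * (Q`_0 * x ^+ j) = Q`_0.
  rewrite (bigD1 (Ordinal r_gt0)) //= mul1r mulr1 big1 ?addr0 // => j.
  by rewrite -val_eqE /= => /negPf->; rewrite mul0r.
under eq_bigr do rewrite !mulrDl -!mulrA.
by rewrite !big_split /= -!mulr_sumr eP eQ eD; ring.
Qed.

(** The values at z of polynomials with coefficients in m form a set closed under differences and
    products. If it does not contain 1, maximality puts it inside m, so z m is contained in m. By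
    [no_both], 1 is not obtained from both x and 1/x. *)
Let B_or x : x != 0 -> vring x \/ vring x^-1.
Proof.
have key z : z != 0 -> vring z \/ exists2 P, pin P & P.[z] = 1.
  move=> z0; have [|h] := pselect (exists2 P, pin P & P.[z] = 1); first by right.
  left; pose m' := [set P.[z] | P in pin].
  have nu' : nonunital m'.
    split=> [_ _ [P hP <-] [Q hQ <-]|_ _ [P hP <-] [Q hQ <-]|[P hP P1]].
    - by exists (P - Q); rewrite ?hornerD ?hornerN // => i; rewrite coefB; apply: mB.
    - by exists (P * Q); rewrite ?hornerM // => i; rewrite coefM; apply: m_sum => j _; apply: mM.
    - by apply: h; exists P.
  have mm' : m `<=` m'.
    move=> a ma; exists a%:P; rewrite ?hornerC // => i; rewrite coefC.
    by case: ifP.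
  move=> a ma; apply: (m_max nu' mm'); exists (a *: 'X); last first.
    by rewrite hornerZ hornerX mulrC.
  by move=> i; rewrite coefZ coefX; case: (i == 1%N); rewrite ?mulr1 ?mulr0.
move=> x0; have [|[P hP Px]] := key x x0; first by left.
have [|[Q hQ Qx]] := key x^-1 (invr_neq0 x0); first by right.
by case: (no_both x0 hP hQ (leqnn _) Px Qx).
Qed.

Let vunit x := [/\ x != 0, vring x & vring x^-1].

(** The nonunits are closed under subtraction because u / w or w / u lies in the ring; they contain
    m, hence equal m by maximality. *)
Let m_or_unit x : vring x -> m x \/ vunit x.
Proof.
pose m' := [set z | vring z /\ (z = 0 \/ ~ vring z^-1)].
have sub' u w : m' u -> m' w -> u != 0 -> w != 0 -> u - w != 0 ->
    vring (u / w) -> ~ vring (u - w)^-1.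
  move=> [_ hu] [_ hw] u0 w0 uw0 buw b; case: hw => [w0'|]; first by rewrite w0' eqxx in w0.
  apply; have -> : w^-1 = (u / w - 1) * (u - w)^-1 by field; apply/andP.
  by apply: BM => //; apply: BB.
have nu' : nonunital m'.
  split=> [u w hu hw|u w hu hw|[_ [/eqP|]]]; last 2 first.
  - by rewrite oner_eq0.
  - by rewrite invr1.
  - have [[bu _] [bw _]] := (hu, hw); split; first exact: BB.
    have [->|uw0] := eqVneq (u - w) 0; [by left|right].
    have [u0|u0] := eqVneq u 0.
      rewrite u0 sub0r invrN => /BN; rewrite opprK => b.
      have [_ [w0|//]] := hw; by rewrite u0 w0 subrr eqxx in uw0.
    have [w0|w0] := eqVneq w 0.
      by rewrite w0 subr0; case: hu => _ [u0'|//]; rewrite u0' eqxx in u0.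
    have uwV0 : u / w != 0 by rewrite mulf_neq0 // invr_eq0.
    case: (B_or uwV0) => [|b]; first exact: sub'.
    rewrite -opprB invrN => /BN; rewrite opprK; apply: sub' => //.
      by rewrite subr_eq0 eq_sym -subr_eq0.
    by rewrite invf_div in b.
  have [[bu _] [bw hw']] := (hu, hw); split; first exact: BM.
  have [->|uw0] := eqVneq (u * w) 0; [by left|right] => b.
  case: hw' => [w0|]; first by rewrite w0 mulr0 eqxx in uw0.
  move: uw0; rewrite mulf_eq0 negb_or => /andP[u0 w0]; apply.
  have -> : w^-1 = u * (u * w)^-1 by field; apply/andP.
  exact: BM.
have mm' : m `<=` m'.
  move=> a ma; split; first exact: Bm.
  have [->|a0] := eqVneq a 0; [by left|right] => b.
  by apply: m1; rewrite -(mulVf a0); apply: b.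
move=> bx; have [|h] := pselect (m' x); first by move/(m_max nu' mm'); left.
right; split=> //.
  by apply/negP => /eqP x0; apply: h; split=> //; left.
by apply: contrapT => b; apply: h; split=> //; right.
Qed.

Let unit_nm x : vunit x -> ~ m x.
Proof. by move=> [x0 _ b] mx; apply: m1; rewrite -(mulVf x0); apply: b. Qed.

Let unitM x y : vunit x -> vunit y -> vunit (x * y).
Proof.
move=> [x0 bx bx'] [y0 by_ by']; split; rewrite ?mulf_neq0 ?invfM //; exact: BM.
Qed.

Let unitV x : vunit x -> vunit x^-1.
Proof. by move=> [x0 bx bx']; split; rewrite ?invr_eq0 ?invrK. Qed.

Let unitX x k : vunit x -> vunit (x ^+ k).
Proof.
by move=> [x0 bx bx']; split; rewrite ?expf_neq0 // -?exprVn; apply: BX.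
Qed.

Let unit_int (z : int) : ~~ (p %| z)%Z -> vunit z%:~R.
Proof.
move=> pz; have [mz|//] := m_or_unit (B_int z); case: m1.
have [[u w] /= e] : exists uv : int * int, uv.1 * z + uv.2 * p = 1.
  by apply/coprimezP; rewrite coprimezE coprime_sym prime_coprime.
have -> : 1 = u%:~R * z%:~R + w%:~R * p%:R :> L.
  by have /(congr1 (fun t : int => t%:~R : L)) := e; rewrite rmorphD !rmorphM.
by apply: mD; apply: B_int.
Qed.

Let p0 : (p%:R : L) != 0. Proof. by rewrite natrL_eq0 -lt0n prime_gt0. Qed.

Let m_exp a k : m a -> m (a ^+ k.+1).
Proof. by move=> ma; elim: k => [|k IH] //; rewrite exprS; apply: mM. Qed.

Let unit_pX (k : int) : vunit (p%:R ^ k) -> k = 0.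
Proof.
case: k => [[|k]|k] //; first by move/unit_nm; case; exact: m_exp.
by move/unitV/unit_nm; case; rewrite NegzE invr_expz opprK; exact: m_exp.
Qed.

Let unit_rat (z1 z2 : int) : z1 != 0 -> z2 != 0 ->
  exists k, vunit (z1%:~R / z2%:~R * p%:R ^ k).
Proof.
have key (z : int) : z != 0 -> exists k, vunit (z%:~R * p%:R ^ k).
  move=> z0; have z_gt0 : (0 < `|z|)%N by rewrite absz_gt0.
  have [q pq] := pfactor_coprime p_pr z_gt0; move: (logn p _) => l e.
  exists (- l%:Z).
  have -> : z%:~R * p%:R ^ (- l%:Z) = (sgz z * q%:Z)%:~R :> L.
    have -> : z = sgz z * q%:Z * (p ^ l)%N by rewrite -mulrA -PoszM -e -intEsg.
    rewrite rmorphM /= -[X in _ * X * _]/((p ^ l)%N%:R) natrX -invr_expz -exprnP.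
    rewrite mulfK ?expf_neq0 //; congr (_%:~R).
    by rewrite -mulrA -PoszM -e -intEsg.
  by apply: unit_int; rewrite dvdzE abszM absz_sg z0 mul1n -prime_coprime.
move=> /key[k1 u1] /key[k2 u2]; exists (k1 - k2).
have -> : z1%:~R / z2%:~R * p%:R ^ (k1 - k2) = z1%:~R * p%:R ^ k1 * (z2%:~R * p%:R ^ k2)^-1 :> L.
  rewrite expfzDr // invfM -invr_expz; ring.
by apply: unitM => //; apply: unitV.
Qed.

(** Divisibility in the ring is total, so t can be taken of least valuation. *)
Let max_elt (s : seq L) : s != [::] -> (forall x, x \in s -> x != 0) ->
  exists2 t, t \in s & forall u, u \in s -> vring (u / t).
Proof.
elim: s => [//|x s IH] _ s0; have x0 : x != 0 by apply: s0; rewrite mem_head.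
have xx : vring (x / x) by rewrite divff.
have [->|sn] := eqVneq s [::].
  by exists x; rewrite ?mem_head // => u; rewrite inE => /eqP->.
have [u us|t ts ht] := IH sn; first by apply: s0; rewrite inE us orbT.
have t0 : t != 0 by apply: s0; rewrite inE ts orbT.
have xt0 : x / t != 0 by rewrite mulf_neq0 ?invr_eq0.
have [b|b] := B_or xt0.
  exists t; first by rewrite inE ts orbT.
  by move=> u; rewrite inE => /orP[/eqP->|/ht].
exists x; first exact: mem_head.
move=> u; rewrite inE => /orP[/eqP->|us] //.
by have := BM (ht _ us) b; rewrite invf_div mulrA divfK.
Qed.

Let n := \dim {:L}.

(* Among the terms of a linear dependency between the powers of [x], two must
   have the same valuation. *)
Let pow_rat x : x != 0 -> exists2 d, (0 < d <= n)%N & exists k, vunit (x ^+ d * p%:R ^ k).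
Proof.
move=> x0; pose s := [seq x ^+ i | i <- iota 0 n.+1].
have ss : size s = n.+1 by rewrite size_map size_iota.
have si i : (i < n.+1)%N -> s`_i = x ^+ i.
  by move=> hi; rewrite (nth_map 0%N) ?size_iota // nth_iota.
have [|c [c0 [i0 hi0 pi0]]] := @zcomb_dependent L p s p_pr; first by rewrite ss.
pose S := [seq i <- iota 0 n.+1 | c i != 0].
pose T i : L := (c i)%:~R * x ^+ i.
have T0 i : i \in S -> T i != 0.
  by rewrite mem_filter => /andP[ci _]; rewrite mulf_neq0 ?expf_neq0 ?intrL_eq0.
have sumT : \sum_(i <- S) T i = 0.
  rewrite big_filter -[RHS]c0 /zcomb ss /index_iota subn0 [LHS]big_mkcond.
  rewrite big_seq [RHS]big_seq; apply: eq_bigr => i; rewrite mem_iota add0n => /andP[_ hi].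
  by rewrite si // /T; have [->|//] := eqVneq (c i) 0; rewrite mul0r.
have [||_ /mapP[i1 i1S ->] hi1] := @max_elt (map T S).
- rewrite -size_eq0 size_map size_eq0; apply/negP => /eqP S0.
  have : i0 \in S; last by rewrite S0.
  rewrite mem_filter mem_iota add0n leq0n -ss hi0 !andbT.
  by apply: contraNneq pi0 => ->.
- by move=> _ /mapP[i iS ->]; apply: T0.
have uS : uniq S by rewrite filter_uniq ?iota_uniq.
have [i iS [ii1 ui]] : exists2 i, i \in S & i != i1 /\ vunit (T i / T i1).
  apply: contrapT => H; apply: m1.
  have -> : 1 = - \sum_(i <- S | i != i1) T i / T i1.
    move/eqP: sumT; rewrite (bigD1_seq i1) //= addr_eq0 => /eqP e.
    by rewrite -mulr_suml -mulNr -e divff ?T0.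
  apply: mN; rewrite big_seq_cond; apply: m_sum => i /andP[iS ii1].
  have [//|u] := m_or_unit (hi1 _ (map_f T iS)).
  by case: H; exists i.
have [ci cn] : c i != 0 /\ (i < n.+1)%N.
  by move: iS; rewrite mem_filter mem_iota add0n => /andP[-> /andP[_ ->]].
have [ci1 cn1] : c i1 != 0 /\ (i1 < n.+1)%N.
  by move: i1S; rewrite mem_filter mem_iota add0n => /andP[-> /andP[_ ->]].
have main u w : c u != 0 -> c w != 0 -> (w < u < n.+1)%N -> vunit (T u / T w) ->
    exists2 d, (0 < d <= n)%N & exists k, vunit (x ^+ d * p%:R ^ k).
  move=> cu cw /andP[wu un] uu; exists (u - w)%N; first by lia.
  have [k uk] := unit_rat cw cu.
  have eu : x ^+ u = x ^+ (u - w) * x ^+ w by rewrite -exprD subnK // ltnW.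
  exists k; have := unitM uu uk; rewrite /T eu.
  have cu0 : (c u)%:~R != 0 :> L by rewrite intrL_eq0.
  have cw0 : (c w)%:~R != 0 :> L by rewrite intrL_eq0.
  have xw0 : x ^+ w != 0 by rewrite expf_neq0.
  congr (vunit _); field.
  by rewrite cu0 cw0 xw0.
have [lt|lt] := ltnP i i1; last first.
  by apply: (main i i1) => //; apply/andP; split=> //; rewrite ltn_neqAle eq_sym ii1.
by apply: (main i1 i) => //; rewrite ?lt // -invf_div; apply: unitV.
Qed.

(** A common multiple of the exponents d of [pow_rat]: for every x != 0, x^N is a unit times a power
    of p, which makes the value group embed in the integers. *)
Let N := n`!.

Let pow_N x : exists k : int, x != 0 -> vunit (x ^+ N * p%:R ^ (- k)).
Proof.
have [->|x0] := eqVneq x 0; first by exists 0.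
have [d /andP[d0 dn] [k uk]] := pow_rat x0.
have /dvdnP[q Nq] : (d %| N)%N by apply: dvdn_fact; rewrite d0.
exists (- k * q%:Z) => _.
have := unitX q uk; rewrite exprMn -exprM mulnC -Nq [(_ ^ k) ^+ q]exprnP exprz_exp.
by rewrite mulNr opprK.
Qed.

(** The exponent w(x) of p in x^N is a valuation with ring [vring]. Its values are the multiples of
    the least positive one, d, so w / d is normalized. *)
Lemma place_of_maximal_nonunital : exists v, place_over p v /\ forall c, m c -> c != 0 -> 0 < v c.
Proof.
have [w hw] := choice pow_N.
have w_uniq x k : x != 0 -> vunit (x ^+ N * p%:R ^ (- k)) -> w x = k.
  move=> x0 ux; have := unitM ux (unitV (hw x x0)).
  have xN : x ^+ N != 0 by rewrite expf_neq0.
  rewrite invfM mulrACA divff // mul1r invr_expz opprK -expfzDr // => /unit_pX; lia.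
have wM x y : x != 0 -> y != 0 -> w (x * y) = w x + w y.
  move=> x0 y0; apply: w_uniq; first by rewrite mulf_neq0.
  have := unitM (hw x x0) (hw y y0).
  by rewrite mulrACA -exprMn -expfzDr // -opprD.
have N0 : (0 < N)%N by rewrite fact_gt0.
have w_m x : x != 0 -> m x -> 0 < w x.
  move=> x0 mx; rewrite ltNge; apply/negP => wx.
  apply: (unit_nm (hw x x0)); rewrite mulrC.
  have -> : - w x = `|w x|%N%:Z by lia.
  apply: (BX _ (B_int p)).
  by rewrite -(prednK N0); apply: m_exp.
have w_B x : x != 0 -> 0 <= w x <-> vring x.
  move=> x0; split=> [wx|bx]; last first.
    have [/(w_m _ x0)/ltW//|ux] := m_or_unit bx.
    suff -> : w x = 0 by [].
    by apply: w_uniq; rewrite // oppr0 expr0z mulr1; exact: unitX.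
  have [//|b] := B_or x0; have [mx|] := m_or_unit b; last by case=> _ _; rewrite invrK.
  have := w_m _ (invr_neq0 x0) mx.
  have : w x + w x^-1 = 0.
    rewrite -wM ?invr_eq0 // divff //; apply: w_uniq; rewrite ?oner_neq0 //.
    by rewrite oppr0 expr0z mulr1 expr1n; split; rewrite ?oner_neq0 ?invr1.
  lia.
have wp : 0 < w p%:R by exact: w_m.
pose P k := `[< (0 < k)%N /\ exists2 x, x != 0 & w x = k%:Z >].
have exP : exists k, P k.
  exists `|w p%:R|%N; apply/asboolP; split; first by lia.
  by exists p%:R => //; lia.
case: (ex_minnP exP) => d /asboolP[d0 [pi pi0 wpi]] dmin.
have w0 : w 1 = 0.
  have h : w 1 = w 1 + w 1 by rewrite -wM ?oner_neq0 // mulr1.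
  lia.
have wV x : x != 0 -> w x^-1 = - w x.
  move=> x0; have h : w x + w x^-1 = 0 by rewrite -wM ?invr_eq0 // divff.
  lia.
have wX x k : x != 0 -> w (x ^+ k) = w x * k%:Z.
  move=> x0; elim: k => [|k IH]; first by rewrite expr0 w0 mulr0.
  rewrite exprS wM ?expf_neq0 // IH; lia.
have d_dvd x : x != 0 -> w x = (w x %/ d)%Z * d%:Z.
  move=> x0; have e := divz_eq (w x) d.
  have r0 : 0 <= (w x %% d)%Z by apply: modz_ge0; lia.
  have rd : (w x %% d)%Z < d%:Z by apply: ltz_pmod; lia.
  suff r1 : (w x %% d)%Z = 0 by lia.
  apply/eqP; apply: contraT => rn.
  suff : P `|(w x %% d)%Z|%N by move/dmin; lia.
  apply/asboolP; split; first by lia.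
  move: (w x %/ d)%Z (w x %% d)%Z e r0 => q r e r0.
  have -> : `|r|%N%:Z = r by lia.
  have [q0|q0] := leP 0 q.
    have eq : `|q|%N%:Z = q by lia.
    exists (x / pi ^+ `|q|); first by rewrite mulf_neq0 ?invr_eq0 ?expf_neq0.
    by rewrite wM ?invr_eq0 ?expf_neq0 // wV ?expf_neq0 // wX // wpi eq e; lia.
  have eq : `|q|%N%:Z = - q by lia.
  exists (x * pi ^+ `|q|); first by rewrite mulf_neq0 ?expf_neq0.
  by rewrite wM ?expf_neq0 // wX // wpi eq e; lia.
pose v x := if x == 0 then 0 else (w x %/ d)%Z.
have vE x : x != 0 -> w x = v x * d%:Z.
  by move=> x0; rewrite /v (negPf x0) -d_dvd.
have d_gt0 : 0 < d%:Z by lia.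
have dn0 : d%:Z != 0 by rewrite gt_eqF.
have vpos x : x != 0 -> 0 < w x -> 0 < v x by move=> /vE->; rewrite pmulr_lgt0.
exists v; split; last by move=> c mc c0; apply: vpos => //; apply: w_m.
split; last exact: vpos.
split.
- by rewrite /v eqxx.
- by exists pi => //; apply: (mulIf dn0); rewrite -vE // wpi mul1r.
- move=> a b a0 b0; apply: (mulIf dn0).
  by rewrite mulrDl -!vE ?mulf_neq0 // wM.
have wD a b : a != 0 -> b != 0 -> a + b != 0 -> w a <= w b -> w a <= w (a + b).
  move=> a0 b0 ab0 ab.
  have ba0 : b / a != 0 by rewrite mulf_neq0 ?invr_eq0.
  have e : a + b = a * (1 + b / a) by field.
  have u0 : 1 + b / a != 0 by apply: contraNneq ab0; rewrite e => ->; rewrite mulr0.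
  have : vring (1 + b / a).
    by apply: BD => //; apply/w_B; rewrite // wM ?invr_eq0 // wV //; lia.
  by move/(w_B _ u0); rewrite e wM //; lia.
move=> a b a0 b0 ab0; rewrite ge_min; apply/orP.
have [ab|/ltW ab] := leP (w a) (w b).
  by left; have := wD _ _ a0 b0 ab0 ab; rewrite !vE // ler_pM2r.
right; have := wD b a b0 a0; rewrite addrC => /(_ ab0 ab).
by rewrite (vE b) // (vE (a + b)) // ler_pM2r.
Qed.

End MaximalNonunital.

(** Consider the values P(1/y), P integral with P(0) divisible by p. If 1 = P(1/y), reversing the
    coefficients of 1 - P gives F. Otherwise these values extend to a maximal nonunital set, whose
    place is positive at 1/y. *)
Lemma integral_or_place (L : fieldExtType rat) (p : nat) (y : L) : prime p ->
  (exists2 F : {poly int}, ~~ (p %| lead_coef F)%Z & (map_poly intr F).[y] = 0) \/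
  exists2 v, place_over p v & v y < 0.
Proof.
move=> p_pr; have [->|y0] := eqVneq y 0.
  left; exists 'X; last by rewrite map_polyX hornerX.
  by rewrite lead_coefX dvdz1 /= neq_ltn prime_gt1 ?orbT.
pose ev (P : {poly int}) : L := (map_poly intr P).[y^-1].
pose m0 := [set ev P | P in [set P : {poly int} | (p %| P`_0)%Z]].
have [[P pP evP]|h] := pselect (m0 1).
  left; pose Q := 1 - P; pose d := size Q.
  have Q0 : Q`_0 != 0.
    rewrite coefB coef1 eqxx subr_eq0; apply: contraTneq pP => <-.
    by rewrite dvdz1 /= neq_ltn prime_gt1 ?orbT.
  have d_gt0 : (0 < d)%N by rewrite /d lt0n size_poly_eq0; apply: contraNneq Q0 => ->; rewrite coef0.
  pose F := \poly_(i < d) Q`_(d.-1 - i).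
  have sF : size F = d.
    by rewrite /F size_poly_eq // subnn.
  exists F.
    rewrite lead_coefE sF coef_poly ltn_predL d_gt0 subnn coefB coef1 eqxx.
    apply: contraTN pP => p1; apply/negP => pP.
    have : (p %| 1 - P`_0 + P`_0)%Z by apply: rpredD.
    by rewrite subrK dvdz1 /= eqn_leq leqNgt prime_gt1.
  have evQ : ev Q = 0 by rewrite /ev rmorphB rmorph1 hornerD hornerN hornerC -/(ev P) evP subrr.
  have sm (G : {poly int}) : (size (map_poly intr G : {poly L}) <= size G)%N by exact: size_poly.
  rewrite (horner_coef_wide _ (sm F)) sF.
  transitivity (y ^+ d.-1 * ev Q); last by rewrite evQ mulr0.
  rewrite /ev (horner_coef_wide _ (sm Q)) -/d mulr_sumr (reindex_inj rev_ord_inj) /=.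
  apply: eq_bigr => i _; rewrite !coef_map /= coef_poly.
  have id : (i < d)%N := ltn_ord i.
  have -> : (d - i.+1 < d)%N by lia.
  have -> : (d.-1 - (d - i.+1) = i)%N by lia.
  rewrite mulrCA; congr (_ * _); rewrite exprVn; apply: (canRL (mulfK _)); rewrite ?expf_neq0 //.
  by rewrite -exprD; congr (_ ^+ _); lia.
right.
have m0_nu : nonunital m0.
  split=> // [_ _ [P pP <-] [Q pQ <-]|_ _ [P pP <-] [Q pQ <-]].
    exists (P - Q); last by rewrite /ev rmorphB hornerD hornerN.
    by rewrite /= coefB; apply: rpredB.
  exists (P * Q); last by rewrite /ev rmorphM hornerM.
  by rewrite /= coefM big_ord1 dvdz_mulr.
(* Adjoining m0 to each set makes the union of the empty chain admissible in Zorn's lemma. *)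
pose PP := [set m : set L | nonunital (m0 `|` m)].
have chain F : F `<=` PP -> total_on F subset -> PP (\bigcup_(X in F) X).
  move=> FP Ft.
  have two a b : (m0 `|` \bigcup_(X in F) X) a -> (m0 `|` \bigcup_(X in F) X) b ->
      (m0 a /\ m0 b) \/ exists2 X, F X & (m0 `|` X) a /\ (m0 `|` X) b.
    move=> [ma|[X FX Xa]] [mb|[Z FZ Zb]]; [by left|right..].
    - by exists Z => //; split; [left|right].
    - by exists X => //; split; [right|left].
    - have [XZ|ZX] := Ft _ _ FX FZ.
        by exists Z => //; split; right => //; apply: XZ.
      by exists X => //; split; right => //; apply: ZX.
  have sub X : F X -> m0 `|` X `<=` m0 `|` \bigcup_(X in F) X.
    by move=> FX a [ma|Xa]; [left|right; exists X].
  have [s1 s2 s3] := m0_nu.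
  split=> [a b ha hb|a b ha hb|[//|[X FX X1]]].
  - have [[ma mb]|[X FX [Xa Xb]]] := two _ _ ha hb; first by left; apply: s1.
    by apply: (sub X FX); have [t1 _ _] := FP _ FX; apply: t1.
  - have [[ma mb]|[X FX [Xa Xb]]] := two _ _ ha hb; first by left; apply: s2.
    by apply: (sub X FX); have [_ t2 _] := FP _ FX; apply: t2.
  - by have [_ _] := FP _ FX; apply; right.
have [A [PA Amax]] := Zorn_bigcup chain.
pose m := m0 `|` A.
have mpin (P : {poly int}) : (p %| P`_0)%Z -> m (ev P) by move=> pP; left; exists P.
have mp : m p%:R.
  have -> : p%:R = ev p%:Z%:P by rewrite /ev map_polyC hornerC.
  by apply: mpin; rewrite coefC dvdzz.
have my : m y^-1.
  have -> : y^-1 = ev 'X by rewrite /ev map_polyX hornerX.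
  by apply: mpin; rewrite coefX dvdz0.
have mmax m' : nonunital m' -> m `<=` m' -> m' `<=` m.
  move=> m'nu mm' a m'a; apply: contrapT => ma; apply: (Amax m').
    split; first by move=> b Ab; apply: mm'; right.
    by move/(_ a m'a) => Aa; apply: ma; right.
  suff -> : PP m' = nonunital m' by [].
  rewrite /PP /=; congr nonunital; apply/seteqP; split=> b; last by right.
  by case=> // mb; apply: mm'; left.
have [v [vp hv]] := place_of_maximal_nonunital p_pr PA mp mmax.
exists v => //; have := hv _ my (invr_neq0 y0); have [vP _] := vp; rewrite valV //; lia.
Qed.

(** * Embeddings, norm and trace *)

Lemma num_field_pchar0 (L : fieldExtType rat) : [pchar L] =i pred0.
Proof. by move=> q; rewrite !inE natrL_eq0; case: q => [|q] //; rewrite andbF. Qed.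

Section Embeddings.
Variables (C : numClosedFieldType) (L : fieldExtType rat).
Let n := \dim {:L}.

Lemma num_field_gen : exists theta : L, forall y : L,
  exists q : {poly rat}, y = (map_poly (in_alg L) q).[theta].
Proof.
have sepL : separable 1%VS {:L} by apply/separableP => y _; apply/pcharf0_separable/num_field_pchar0.
have := eq_adjoin_separable_generator sepL (sub1v _).
set theta := separable_generator _ _ => e; exists theta => y.
have yL : y \in <<1; theta>>%VS by rewrite -e memvf.
have /polyOver1P[q Dq] := Fadjoin_polyOver 1 theta y.
by exists q; rewrite -Dq Fadjoin_poly_eq.
Qed.

(** Sending a primitive element to any of the n distinct roots of its minimal polynomial defines an
    embedding. C is kept general: [R[i]] serves the archimedean places, [algC] the algebraic
    integers and the norms. *)
Lemma embeddings_enum : exists f : 'I_n -> {rmorphism L -> C},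
  (forall g : {rmorphism L -> C}, exists k, g =1 f k) /\
  exists theta, (injective (fun k => f k theta)).
Proof.
have [theta gen] := num_field_gen.
have /polyOver1P[mu Dmu] := minPolyOver 1 theta.
have mu_dvd q : ((map_poly (in_alg L) q).[theta] == 0) = (mu %| q).
  apply/idP/idP => [q0|].
    rewrite -(dvdp_map (in_alg L)) -Dmu minPoly_dvdp //.
    by apply/polyOver1P; exists q.
  rewrite -(dvdp_map (in_alg L)) -Dmu => /dvdpP[r ->].
  by rewrite hornerM minPolyxx mulr0.
have sep : separable_poly (map_poly (ratr : rat -> C) mu).
  have := pcharf0_separable 1%AS (num_field_pchar0 L) theta.
  by rewrite /separable_element Dmu !separable_map.
have gen1 : <<1; theta>>%VS = fullv.
  apply/eqP; rewrite eqEsubv subvf; apply/subvP => y _.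
  have [q ->] := gen y; apply: mempx_Fadjoin; apply/polyOver1P; by exists q.
have size_mu : size mu = n.+1.
  rewrite -(size_map_poly (in_alg L)) -Dmu size_minPoly /n.
  by have := dim_Fadjoin 1 theta; rewrite gen1 dimv1 muln1 => ->.
have [rs Drs] := closed_field_poly_normal (map_poly (ratr : rat -> C) mu).
have mu_monic : mu \is monic.
  by rewrite -(map_monic (in_alg L)) -Dmu monic_minPoly.
rewrite lead_coef_map (monicP mu_monic) rmorph1 scale1r in Drs.
have size_rs : size rs = n.
  by apply/eqP; rewrite -eqSS -size_mu -(size_map_poly (ratr : {rmorphism rat -> C})) Drs size_prod_XsubC.
have uniq_rs : uniq rs by rewrite -separable_prod_XsubC -Drs.
have [q hq] := choice gen.
have ex z : z \in rs -> exists f : {rmorphism L -> C}, f theta = z.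
  move=> zrs; pose F y := (map_poly (ratr : rat -> C) (q y)).[z].
  have muz : (map_poly (ratr : rat -> C) mu).[z] = 0 by apply/rootP; rewrite Drs root_prod_XsubC.
  have FE y r : y = (map_poly (in_alg L) r).[theta] -> F y = (map_poly (ratr : rat -> C) r).[z].
    move=> yr; apply/eqP; rewrite -subr_eq0 /F -hornerN -hornerD -rmorphB /=.
    have : mu %| q y - r by rewrite -mu_dvd rmorphB hornerD hornerN -hq -yr subrr.
    by move=> /dvdpP[t ->]; rewrite rmorphM hornerM /= muz mulr0.
  have FB : zmod_morphism F.
    move=> a b; rewrite (FE (a - b) (q a - q b)); last by rewrite rmorphB hornerD hornerN -!hq.
    by rewrite rmorphB hornerD hornerN.
  have FM : monoid_morphism F.
    split; first by rewrite (FE 1 1) ?rmorph1 ?hornerC.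
    move=> a b; rewrite (FE (a * b) (q a * q b)); last by rewrite rmorphM hornerM -!hq.
    by rewrite rmorphM hornerM.
  pose hA := GRing.isZmodMorphism.Build L C F FB.
  pose hM := GRing.isMonoidMorphism.Build L C F FM.
  pose G : {rmorphism L -> C} := HB.pack F hA hM.
  exists G; rewrite -[LHS]/(F theta) (FE theta 'X) ?map_polyX ?hornerX //.
have rsi (i : 'I_n) : rs`_i \in rs by rewrite mem_nth // size_rs.
have [f hf] := choice (fun i => ex _ (rsi i)).
have ftheta (g : {rmorphism L -> C}) y : g y = (map_poly (ratr : rat -> C) (q y)).[g theta].
  rewrite {1}(hq y) -horner_map -map_poly_comp /=; congr (_.[_]).
  by apply: eq_map_poly => t /=; rewrite rmorphZ_num rmorph1 mulr1.
exists f; split.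
  move=> g; have : g theta \in rs.
    rewrite -root_prod_XsubC -Drs; apply/rootP.
    transitivity (g (map_poly (in_alg L) mu).[theta]).
      rewrite -horner_map -map_poly_comp /=; congr (_.[_]).
      by apply: eq_map_poly => t /=; rewrite rmorphZ_num rmorph1 mulr1.
    by rewrite -Dmu minPolyxx rmorph0.
  move=> gin; have gi : (index (g theta) rs < n)%N by rewrite -size_rs index_mem.
  exists (Ordinal gi) => y; rewrite ftheta [RHS]ftheta hf /= nth_index //.
exists theta => i j; rewrite !hf => /eqP; rewrite nth_uniq ?size_rs // => /eqP; exact: val_inj.
Qed.

Definition emb : 'I_n -> {rmorphism L -> C} := projT1 (cid embeddings_enum).

Lemma emb_onto (g : {rmorphism L -> C}) : exists k, g =1 emb k.
Proof. by rewrite /emb; case: cid => f /= [+ _]; apply. Qed.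

Lemma emb_separated : exists theta, injective (fun k => emb k theta).
Proof. by rewrite /emb; case: cid => f /= []. Qed.

Definition emb_mx (s : n.-tuple L) : 'M[C]_n := \matrix_(i, k) emb k s`_i.

(** The powers of a primitive element give a Vandermonde matrix with distinct nodes, and it factors
    through [emb_mx s]. *)
Lemma emb_mx_unit (s : n.-tuple L) : basis_of {:L} s -> emb_mx s \in unitmx.
Proof.
move=> sb; have [theta inj_theta] := emb_separated.
pose T : 'M[rat]_n := \matrix_(i, j) coord s j (theta ^+ i).
pose a : 'rV[C]_n := \row_k emb k theta.
have eV : Vandermonde n a = map_mx ratr T *m emb_mx s.
  apply/matrixP => i k; rewrite !mxE -rmorphXn {1}(coord_basis sb (memvf (theta ^+ i))).
  by rewrite rmorph_sum; apply: eq_bigr => j _; rewrite !mxE rmorphZ_num.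
have : \det (Vandermonde n a) != 0.
  rewrite det_Vandermonde; apply/prodf_neq0 => i _; apply/prodf_neq0 => j ij.
  by rewrite !mxE subr_eq0; apply: contraTneq ij => /inj_theta->; rewrite ltnn.
by rewrite eV det_mulmx mulf_eq0 negb_or unitmxE unitfE => /andP[].
Qed.

Section MultMatrix.
Variables (s : n.-tuple L) (sb : basis_of {:L} s) (b : L) (B : 'M[rat]_n).
Hypothesis hB : forall i : 'I_n, b * s`_i = \sum_j B i j *: s`_j.

Let d : 'rV[C]_n := \row_k emb k b.

(** The embeddings diagonalize multiplication by b, so its determinant, trace and characteristic
    polynomial in any basis come from the conjugates of b. *)
Let conjB : map_mx ratr B *m emb_mx s = emb_mx s *m diag_mx d.
Proof.
apply/matrixP => i k; rewrite mul_mx_diag !mxE -rmorphM mulrC hB rmorph_sum.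
by apply: eq_bigr => j _; rewrite !mxE rmorphZ_num.
Qed.

Lemma ratr_det_mult : ratr (\det B) = \prod_k emb k b :> C.
Proof.
have /(congr1 determinant) := conjB; rewrite !det_mulmx mulrC => /mulfI e.
rewrite -det_map_mx e; last by have := emb_mx_unit sb; rewrite unitmxE unitfE.
by rewrite det_diag; apply: eq_bigr => k _; rewrite mxE.
Qed.

Lemma ratr_tr_mult : ratr (\tr B) = \sum_k emb k b :> C.
Proof.
rewrite -trace_map_mx -[map_mx _ _](mulmxK (emb_mx_unit sb)) conjB mxtrace_mulC mulmxA mulVmx ?emb_mx_unit //.
by rewrite mul1mx mxtrace_diag; apply: eq_bigr => k _; rewrite mxE.
Qed.

Lemma map_char_poly_mult :
  map_poly ratr (char_poly B) = \prod_k ('X - (emb k b)%:P) :> {poly C}.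
Proof.
rewrite map_char_poly.
transitivity (char_poly (diag_mx d)); last first.
  rewrite char_poly_trig ?diag_mx_is_trig //.
  by apply: eq_bigr => k _; rewrite !mxE eqxx mulr1n.
pose Ep := map_mx polyC (emb_mx s).
have : char_poly_mx (map_mx ratr B) *m Ep = Ep *m char_poly_mx (diag_mx d).
  rewrite /char_poly_mx mulmxBl mulmxBr -!map_mxM conjB.
  by rewrite scalar_mxC.
move/(congr1 determinant); rewrite !det_mulmx mulrC => /mulfI; apply.
rewrite det_map_mx polyC_eq0; by have := emb_mx_unit sb; rewrite unitmxE unitfE.
Qed.

End MultMatrix.

Definition mulm (b : L) : 'M[rat]_n := \matrix_(i, j) coord (vbasis {:L}) j (b * (vbasis {:L})`_i).

Lemma mulmE b (i : 'I_n) : b * (vbasis {:L})`_i = \sum_j mulm b i j *: (vbasis {:L})`_j.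
Proof.
rewrite {1}(coord_vbasis (memvf (b * (vbasis {:L})`_i))).
by apply: eq_bigr => j _; rewrite mxE.
Qed.

Definition nrm (b : L) : rat := \det (mulm b).

Lemma nrmE b : ratr (nrm b) = \prod_k emb k b :> C.
Proof. exact: (@ratr_det_mult (vbasis {:L}) (vbasisP {:L}) b (mulm b) (mulmE b)). Qed.

Definition trc (b : L) : rat := \tr (mulm b).

Lemma trcE b : ratr (trc b) = \sum_k emb k b :> C.
Proof. exact: (@ratr_tr_mult (vbasis {:L}) (vbasisP {:L}) b (mulm b) (mulmE b)). Qed.

Lemma char_mulmE b : map_poly ratr (char_poly (mulm b)) = \prod_k ('X - (emb k b)%:P) :> {poly C}.
Proof. exact: (@map_char_poly_mult (vbasis {:L}) (vbasisP {:L}) b (mulm b) (mulmE b)). Qed.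

End Embeddings.

Section Norm.
Variable L : fieldExtType rat.
Implicit Types a b : L.

Lemma nrmM a b : nrm (a * b) = nrm a * nrm b.
Proof.
apply: (@fmorph_inj _ _ (ratr : {rmorphism rat -> algC})).
rewrite rmorphM /= !(@nrmE algC) -big_split /=.
by apply: eq_bigr => k _; rewrite rmorphM.
Qed.

Lemma nrm_neq0 b : b != 0 -> nrm b != 0.
Proof.
move=> b0; rewrite -(fmorph_eq0 (ratr : {rmorphism rat -> algC})) /= (@nrmE algC).
by apply/prodf_neq0 => k _; rewrite fmorph_eq0.
Qed.

Lemma nrm_rat (q : rat) : nrm (q%:A : L) = q ^+ \dim {:L}.
Proof.
apply: (@fmorph_inj _ _ (ratr : {rmorphism rat -> algC})).
rewrite rmorphXn /= (@nrmE algC) -[in RHS](card_ord (\dim {:L})) -prodr_const.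
by apply: eq_bigr => k _; rewrite rmorphZ_num rmorph1 mulr1.
Qed.

Lemma nrmXz a (k : int) : nrm (a ^ k) = nrm a ^ k.
Proof.
apply: (@fmorph_inj _ _ (ratr : {rmorphism rat -> algC})).
rewrite fmorphXz /= !(@nrmE algC).
transitivity (\prod_(j < \dim {:L}) emb algC j a ^ k).
  by apply: eq_bigr => j _; rewrite fmorphXz.
case: k => k; first by rewrite -exprnP prodrXl.
by rewrite NegzE -invr_expz -exprnP -prodrXl -prodfV; apply: eq_bigr => j _; rewrite -invr_expz.
Qed.

Lemma nrm_basis (s : (\dim {:L}).-tuple L) b (B : 'M[rat]_(\dim {:L})) :
  basis_of {:L} s -> (forall i : 'I_(\dim {:L}), b * s`_i = \sum_j B i j *: s`_j) ->
  nrm b = \det B.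
Proof.
move=> sb hB; apply: (@fmorph_inj _ _ (ratr : {rmorphism rat -> algC})).
by rewrite /= (@nrmE algC) (ratr_det_mult algC sb hB).
Qed.

Lemma trcD a b : trc (a + b) = trc a + trc b.
Proof.
apply: (@fmorph_inj _ _ (ratr : {rmorphism rat -> algC})).
rewrite rmorphD /= !(@trcE algC) -big_split /=.
by apply: eq_bigr => k _; rewrite rmorphD.
Qed.

Lemma trcZ (q : rat) a : trc (q *: a) = q * trc a.
Proof.
apply: (@fmorph_inj _ _ (ratr : {rmorphism rat -> algC})).
rewrite rmorphM /= !(@trcE algC) mulr_sumr.
by apply: eq_bigr => k _; rewrite rmorphZ_num.
Qed.

Lemma trc1 : trc (1 : L) = (\dim {:L})%:R.
Proof.
apply: (@fmorph_inj _ _ (ratr : {rmorphism rat -> algC})).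
rewrite rmorph_nat /= (@trcE algC).
under eq_bigr do rewrite rmorph1.
by rewrite sumr_const card_ord.
Qed.

(* The conjugates of [u y] are algebraic integers. *)
Lemma trc_integral (F : {poly int}) (y : L) : (map_poly intr F).[y] = 0 -> F != 0 ->
  exists z : int, trc ((lead_coef F)%:~R * y) = z%:~R.
Proof.
move=> Fy F0; set u := lead_coef F.
suff : (ratr (trc (u%:~R * y)) : algC) \in Aint.
  by move/(Cint_rat_Aint (Crat_rat _)) => /intrP[z e]; exists z;
    apply: (@fmorph_inj _ _ (ratr : {rmorphism rat -> algC})); rewrite /= e ratr_int.
rewrite (@trcE algC); apply: rpred_sum => k _.
have [d Ed] : exists d, size F = d.+1.
  by exists (size F).-1; rewrite prednK // lt0n size_poly_eq0.
case: d => [|d] in Ed.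
  exfalso; have Fc := size1_polyC (eq_leq Ed); move: Fy; rewrite Fc map_polyC hornerC.
  by move/eqP; rewrite intrL_eq0 => /eqP F00; move: F0; rewrite Fc F00 eqxx.
(* G(X) = u^d F(X / u) is monic with integer coefficients and vanishes at u y. *)
pose G := \poly_(i < d.+2) (if i == d.+1 then 1 else F`_i * u ^+ (d - i)) : {poly int}.
have uF : u = F`_d.+1 by rewrite /u lead_coefE Ed.
have sG : size G = d.+2 by rewrite size_poly_eq // eqxx oner_eq0.
have mG : G \is monic by rewrite monicE lead_coefE sG coef_poly ltnSn eqxx.
apply: (@root_monic_Aint (map_poly intr G)).
- have smL (P : {poly int}) : (size (map_poly intr P : {poly L}) <= size P)%N by exact: size_poly.
  have smC (P : {poly int}) : (size (map_poly intr P : {poly algC}) <= size P)%N by exact: size_poly.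
  apply/rootP; rewrite (horner_coef_wide _ (smC G)) sG.
  transitivity (emb algC k (u%:~R ^+ d * (map_poly intr F).[y])); last by rewrite Fy mulr0 rmorph0.
  rewrite (horner_coef_wide _ (smL F)) Ed mulr_sumr rmorph_sum.
  apply: eq_bigr => i _; rewrite !coef_map /= coef_poly ltn_ord !rmorphM !rmorphXn !rmorph_int exprMn.
  have [-> |ne] := eqVneq (i : nat) d.+1; first by rewrite -uF exprSr; ring.
  have id : (i <= d)%N by have := ltn_ord i; lia.
  have e : (u%:~R : algC) ^+ d = u%:~R ^+ (d - i) * u%:~R ^+ i by rewrite -exprD subnK.
  rewrite rmorphM rmorphXn /= e; ring.
- exact: monic_map.
- by apply/polyOverP => i; rewrite coef_map /= intr_int.
Qed.

End Norm.

(** * The norm and the finite places *)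

Section RatOrder.
Variables (p : nat) (p_pr : prime p).

Definition ordq (q : rat) : int := (logn p `|numq q|)%:Z - (logn p `|denq q|)%:Z.

Lemma ordq_frac (x y : int) : x != 0 -> y != 0 ->
  ordq (x%:~R / y%:~R) = (logn p `|x|)%:Z - (logn p `|y|)%:Z.
Proof.
move=> x0 y0; set q := _ / _.
have q0 : q != 0 by rewrite mulf_neq0 ?invr_eq0 ?intr_eq0.
have e : numq q * y = x * denq q.
  apply: (@intr_inj rat); rewrite !rmorphM /=.
  have := divq_num_den q; rewrite {3}/q => /eqP.
  rewrite eqr_div ?intr_eq0 ?denq_neq0 // => /eqP ->; by rewrite mulrC.
have /(congr1 (fun z => logn p `|z|)) := e.
rewrite !abszM !lognM ?absz_gt0 ?numq_eq0 ?denq_eq0 // /ordq.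
move: (logn _ _) (logn _ _) (logn _ _) (logn _ _) => n1 n2 n3 n4 h; lia.
Qed.

Lemma ordqM q r : q != 0 -> r != 0 -> ordq (q * r) = ordq q + ordq r.
Proof.
move=> q0 r0; rewrite -[in LHS](divq_num_den q) -[in LHS](divq_num_den r) mulf_div -!rmorphM /=.
rewrite ordq_frac ?mulf_neq0 ?numq_eq0 ?denq_eq0 // !abszM !lognM ?absz_gt0 ?numq_eq0 ?denq_eq0 //.
rewrite /ordq; move: (logn _ _) (logn _ _) (logn _ _) (logn _ _) => n1 n2 n3 n4; lia.
Qed.

Lemma ordq1 : ordq 1 = 0. Proof. by rewrite /ordq (numq_int 1) (denq_int 1) logn1. Qed.

Lemma ordqV q : q != 0 -> ordq q^-1 = - ordq q.
Proof.
move=> q0; have : ordq q + ordq q^-1 = 0 by rewrite -ordqM ?invr_eq0 // divff // ordq1.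
lia.
Qed.

Lemma ordqX q k : q != 0 -> ordq (q ^+ k) = ordq q * k%:Z.
Proof.
move=> q0; elim: k => [|k IH]; first by rewrite expr0 ordq1 mulr0.
rewrite exprS ordqM ?expf_neq0 // IH; lia.
Qed.

Lemma ordqXz q (k : int) : q != 0 -> ordq (q ^ k) = ordq q * k.
Proof.
move=> q0; case: k => k; first by rewrite -exprnP ordqX.
by rewrite NegzE -invr_expz ordqV ?expfz_neq0 // -exprnP ordqX //; lia.
Qed.

Lemma ordq_prod (I : Type) (r : seq I) (P : pred I) (F : I -> rat) :
  (forall i, P i -> F i != 0) ->
  ordq (\prod_(i <- r | P i) F i) = \sum_(i <- r | P i) ordq (F i).
Proof.
move=> F0; suff [] : \prod_(i <- r | P i) F i != 0 /\
  ordq (\prod_(i <- r | P i) F i) = \sum_(i <- r | P i) ordq (F i) by [].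
apply: (big_rec2 (fun x y => x != 0 /\ ordq x = y)); first by rewrite oner_neq0 ordq1.
by move=> i x y Pi [x0 <-]; rewrite mulf_neq0 ?F0 // ordqM ?F0.
Qed.

Lemma ordq_p : ordq p%:R = 1.
Proof.
by rewrite /ordq (numq_int p) (denq_int p) logn1 logn_prime // eqxx.
Qed.

(* q lies in the localization of Z at p. *)
Definition pint (q : rat) := exists u z : int, ~~ (p %| u)%Z /\ u%:~R * q = z%:~R.

Lemma pdvd_mul (u w : int) : ~~ (p %| u)%Z -> ~~ (p %| w)%Z -> ~~ (p %| u * w)%Z.
Proof. by rewrite !dvdzE abszM Euclid_dvdM // negb_or => -> ->. Qed.

Lemma pint_int (z : int) : pint z%:~R.
Proof. by exists 1, z; rewrite mul1r dvdz1 /= neq_ltn prime_gt1 ?orbT. Qed.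

Lemma pintD q r : pint q -> pint r -> pint (q + r).
Proof.
move=> [u [z [pu e]]] [w [t [pw e']]]; exists (u * w), (w * z + u * t).
by rewrite pdvd_mul // rmorphM rmorphD !rmorphM /= -e -e'; split=> //; ring.
Qed.

Lemma pintM q r : pint q -> pint r -> pint (q * r).
Proof.
move=> [u [z [pu e]]] [w [t [pw e']]]; exists (u * w), (z * t).
by rewrite pdvd_mul // !rmorphM /= -e -e'; split=> //; ring.
Qed.

Lemma pint_ge0 q : q != 0 -> pint q -> 0 <= ordq q.
Proof.
move=> q0 [u [z [pu e]]].
have u0 : u != 0 by apply: contraNneq pu => ->; rewrite dvdz0.
have z0 : z != 0 by rewrite -(intr_eq0 rat) -e mulf_neq0 ?intr_eq0.
have -> : q = z%:~R / u%:~R by rewrite -e mulrC mulKf ?intr_eq0.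
rewrite ordq_frac //.
suff -> : logn p `|u| = 0%N by lia.
by apply/eqP; rewrite lognE; move: pu; rewrite dvdzE => /negPf->; rewrite !andbF.
Qed.

Lemma pint_det m (B : 'M[rat]_m) : (forall i j, pint (B i j)) -> pint (\det B).
Proof.
move=> hB; rewrite /determinant; elim/big_ind: _ => [||s _]; [exact: (pint_int 0)|exact: pintD|].
apply: pintM.
  by case: (perm.odd_perm s); [exact: (pint_int (-1))|exact: (pint_int 1)].
by elim/big_ind: _ => [||i _]; [exact: (pint_int 1)|exact: pintM|exact: hB].
Qed.

Lemma pint_divisible q : (forall N : nat, exists2 r, pint r & q = p%:R ^+ N * r) -> q = 0.
Proof.
move=> h; apply/eqP/contraT => q0; have [r pr e] := h `|ordq q|.+1.
have p0 : (p%:R : rat) != 0 by rewrite pnatr_eq0 -lt0n prime_gt0.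
have r0 : r != 0 by apply: contraNneq q0 => r0; rewrite e r0 mulr0.
have := pint_ge0 r0 pr; have : ordq q = `|ordq q|.+1%:Z + ordq r.
  by rewrite {1}e ordqM ?expf_neq0 // ordqX // ordq_p mul1r.
lia.
Qed.

End RatOrder.

Lemma val_prod (L : fieldExtType rat) (v : L -> int) (I : Type) (r : seq I) (P : pred I)
    (F : I -> L) : finite_place v -> (forall i, P i -> F i != 0) ->
  v (\prod_(i <- r | P i) F i) = \sum_(i <- r | P i) v (F i).
Proof.
move=> vP F0; suff [] : \prod_(i <- r | P i) F i != 0 /\
  v (\prod_(i <- r | P i) F i) = \sum_(i <- r | P i) v (F i) by [].
apply: (big_rec2 (fun x y => x != 0 /\ v x = y)); first by rewrite oner_neq0 val1.
by move=> i x y Pi [x0 <-]; rewrite mulf_neq0 ?F0 // valM ?F0.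
Qed.

Lemma nrm1 (L : fieldExtType rat) : nrm (1 : L) = 1.
Proof. by rewrite -(scale1r 1) nrm_rat expr1n. Qed.

(** * The order of the norm at one prime *)

Section NormFormula.
Variables (L : fieldExtType rat) (p : nat) (p_pr : prime p).
Variable vs : seq (L -> int).
Hypotheses (uvs : uniq vs) (vs_all : forall v, v \in vs <-> place_over p v).
Implicit Types (v w : L -> int) (a b y : L) (s t : seq L).

Let n := \dim {:L}.
Let vsP v : v \in vs -> place_over p v. Proof. by move/vs_all. Qed.
Let vsfin v : v \in vs -> finite_place v. Proof. by case/vsP. Qed.
Let vp_gt0 v : v \in vs -> 0 < v p%:R. Proof. by case/vsP. Qed.

(** The semilocal ring of elements integral at all the places over p; [fideal vs e] is p O. *)
Let O := fideal vs (fun=> 0).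
Let e v := v p%:R.
Let p0 : (p%:R : L) != 0. Proof. by rewrite natrL_eq0 -lt0n prime_gt0. Qed.

Let O_divp y : fideal vs e y -> O (y / p%:R).
Proof.
move=> /allP hy; apply/allP => v vvs.
by apply: (vge_div (vsfin vvs) (k' := e v)) => //; rewrite add0r; apply: hy.
Qed.

Let OM a b : O a -> O b -> O (a * b).
Proof.
move=> /allP ha /allP hb; apply/allP => v vvs; rewrite -[0]addr0.
by apply: (vgeM (vsfin vvs)); [exact: ha|exact: hb].
Qed.

Let O_int y : O y -> exists2 F : {poly int}, ~~ (p %| lead_coef F)%Z & (map_poly intr F).[y] = 0.
Proof.
move=> /allP hy; have [//|[v vp vy]] := integral_or_place y p_pr.
have vvs : v \in vs by apply/vs_all.
have y0 : y != 0 by apply: contraTneq vy => ->; case: vp => [[-> _ _ _] _].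
by have := hy v vvs; rewrite vge_neq0 //; lia.
Qed.

Let pint_trc y : O y -> pint p (trc y).
Proof.
move=> /O_int[F pF Fy]; have F0 : F != 0 by apply: contraNneq pF => ->; rewrite lead_coef0 dvdz0.
have [z hz] := trc_integral Fy F0; exists (lead_coef F), z; split=> //.
by rewrite -hz -trcZ -[in RHS]scaler_int scaler_int -mulr_algl intrLE.
Qed.

Let scale_in y : exists k, O (p%:R ^+ k * y).
Proof.
have [k hk] := seq_int_bound vs (fun v => - v y).
exists k; apply/allP => v vvs; have vP := vsfin vvs.
have [->|y0] := eqVneq y 0; first by rewrite mulr0 vge0r.
rewrite vge_neq0 ?mulf_neq0 ?expf_neq0 // valM ?expf_neq0 // valX //.
by have := hk _ vvs; have := vp_gt0 vvs; nia.
Qed.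

Section Basis.
Variables (s : seq L) (sb : modbasis p vs (fun=> 0) e s).

(** Iterates O = span(s) + p O. Precision p^N for every N stands in for p-adic completion. *)
Let s_exp N y : O y -> exists c, exists2 z, O z & y = zcomb c s + p%:R ^+ N * z.
Proof.
move=> Oy; elim: N => [|N [c [z Oz yE]]].
  by exists (fun=> 0), y => //; rewrite /zcomb big1 ?add0r ?expr0 ?mul1r // => i _; rewrite mul0r.
have [_ /(_ _ Oz)[d /O_divp Od] _] := sb.
exists (fun i => c i + (p ^ N)%N%:Z * d i), ((z - zcomb d s) / p%:R) => //.
have -> : zcomb (fun i => c i + (p ^ N)%N%:Z * d i) s = zcomb c s + p%:R ^+ N * zcomb d s.
  rewrite /zcomb mulr_sumr -big_split /=; apply: eq_bigr => i _.
  by rewrite rmorphD rmorphM /= -natrX mulrDl mulrA.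
rewrite yE exprSr; field; exact: p0.
Qed.

(* If there were fewer than [n] elements, some nonzero [theta] would be
   orthogonal to them for the trace form, hence to all of [O]. *)
Lemma modbasis_full : size s = n.
Proof.
apply/eqP; rewrite eqn_leq (modbasis_size p_pr sb) /= leqNgt; apply/negP => sn.
have [theta th0 hth] : exists2 theta, theta != 0 & forall i, (i < size s)%N -> trc (theta * s`_i) = 0.
  pose M : 'M[rat]_(n, size s) := \matrix_(i, j) trc ((vbasis {:L})`_i * s`_j).
  have kM : kermx M != 0.
    by rewrite kermx_eq0 -row_leq_rank -ltnNge (leq_ltn_trans (rank_leq_col _)).
  have [r /negP r0] : exists r, ~~ (row r (kermx M) == 0).
    apply/existsP; rewrite -negb_forall; apply: contra kM => /forallP h.
    by apply/eqP/row_matrixP => r; rewrite row0; apply/eqP.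
  pose u := row r (kermx M).
  exists (\sum_i u 0 i *: (vbasis {:L})`_i).
    apply/negP => /eqP h; apply: r0; apply/eqP/rowP => i; rewrite [RHS]mxE.
    have /freeP := basis_free (vbasisP {:L}); apply; exact: h.
  move=> i si; have : (u *m M) 0 (Ordinal si) = 0.
    by rewrite /u -row_mul mulmx_ker row0 mxE.
  rewrite mxE => h; rewrite -[RHS]h mulr_suml.
  have -> : forall f : 'I_n -> L, trc (\sum_j f j) = \sum_j trc (f j).
    by move=> f; apply: (big_morph _ (@trcD L)); rewrite -(scale0r 0) trcZ mul0r.
  by apply: eq_bigr => j _; rewrite -scalerAl trcZ !mxE.
wlog Oth : theta th0 hth / O theta.
  move=> wl; have [k Ok] := scale_in theta; apply: (wl (p%:R ^+ k * theta)) => //.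
    by rewrite mulf_neq0 ?expf_neq0.
  move=> i si; rewrite -mulrA -natrX.
  have -> : (p ^ k)%N%:R * (theta * s`_i) = (p ^ k)%N%:R *: (theta * s`_i).
    by rewrite scaler_nat mulr_natl.
  by rewrite trcZ hth // mulr0.
(* By orthogonality to s, the trace equals p^N tr(theta z) with tr(theta z) in Z_(p), for every
   N. *)
have tr0 y : O y -> trc (theta * y) = 0.
  move=> Oy; apply: (pint_divisible p_pr) => N.
  have [c [z Oz ->]] := s_exp N Oy.
  exists (trc (theta * z)); first by apply: pint_trc; apply: OM.
  rewrite mulrDr trcD [X in X + _](_ : _ = 0) ?add0r.
    have -> : theta * (p%:R ^+ N * z) = (p%:R ^+ N) *: (theta * z).
      by rewrite -!natrX scaler_nat mulrCA mulr_natl.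
    by rewrite trcZ.
  have trc0 : trc (0 : L) = 0 by rewrite -(scale0r 0) trcZ mul0r.
  rewrite /zcomb mulr_sumr (big_morph _ (@trcD L) trc0) big_nat big1 // => i /andP[_ si].
  by rewrite mulrCA mulrzl -scaler_int trcZ hth // mulr0.
(* Taking y = p^k / theta gives tr(theta y) = p^k n, which is not 0. *)
have [k Ok] := scale_in theta^-1.
have := tr0 _ Ok; rewrite mulrCA divff // mulr1 -natrX.
rewrite -[(p ^ k)%N%:R]/(1 *+ (p ^ k)) -scaler_nat trcZ trc1.
move/eqP; rewrite mulf_eq0 !pnatr_eq0 expn_eq0 -/n; have := prime_gt0 p_pr; lia.
Qed.

Let s_free : free s.
Proof.
apply: contraT => /(zcomb_not_free p_pr)[c [c0 [i si]]].
by have [_ _ ->] := sb; rewrite // c0 fideal0.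
Qed.

Lemma modbasis_basis : basis_of {:L} s.
Proof. by rewrite basisEfree s_free subvf modbasis_full leqnn. Qed.

(** There is a primitive integral relation between y and s. If p divided the coefficient of y,
    independence modulo p O would make p divide all the others; so that coefficient is invertible in
    Z_(p). *)
Lemma modbasis_coord y : O y ->
  exists c : nat -> rat, (forall i, pint p (c i)) /\ y = \sum_(0 <= i < size s) c i *: s`_i.
Proof.
move=> Oy.
have [|c [c0 [i si pi]]] := @zcomb_dependent _ p (y :: s) p_pr; first by rewrite /= modbasis_full.
move: c0; rewrite zcomb_cons => /eqP; rewrite addr_eq0 => /eqP c0.
have pc0 : ~~ (p %| c 0%N)%Z.
  apply: contra pi => pc0; case: i si => [//|i si].
  have [_ _ h] := sb; apply: (h (c \o S)) => //.
  rewrite -[zcomb _ _]opprK -c0 -mulNr -mulrNz.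
  by apply: (fideal_mulp vsP (k := fun=> 0)); [move=> v vvs; rewrite add0r|rewrite rpredN|].
have c00 : c 0%N != 0 by apply: contraNneq pc0 => ->; rewrite dvdz0.
exists (fun i => - (c i.+1)%:~R / (c 0%N)%:~R); split.
  move=> j; exists (c 0%N), (- c j.+1); split=> //.
  by rewrite mulrCA divff ?intr_eq0 // mulr1 mulrNz.
have -> : y = (c 0%N)%:~R^-1 * ((c 0%N)%:~R * y) by rewrite mulKf // intrL_eq0.
rewrite c0 /zcomb mulrN -mulNr mulr_sumr; apply: eq_bigr => j _.
rewrite -[in RHS]mulr_algl mulrA; congr (_ * _).
by rewrite -[RHS]/(in_alg L _) rmorphM fmorphV rmorphN !rmorph_int mulrC mulrN mulNr.
Qed.

End Basis.

(** In the basis s, row i of the matrix of b is p^(D i) times a row over Z_(p), and these powers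
    come out of the determinant. *)
Let nrm_rows s b (D : nat -> nat) : modbasis p vs (fun=> 0) e s ->
  (forall i, (i < n)%N -> O (b * s`_i / p%:R ^+ D i)) ->
  exists2 r, pint p r & nrm b = p%:R ^+ (\sum_(i < n) D i) * r.
Proof.
move=> sb hD; have sn := modbasis_full sb.
have ex i : exists c : nat -> rat, (i < n)%N -> (forall j, pint p (c j)) /\
    b * s`_i / p%:R ^+ D i = \sum_(0 <= j < size s) c j *: s`_j.
  have [ltin|_] := ltnP i n; last by exists (fun=> 0).
  by have [c hc] := modbasis_coord sb (hD i ltin); exists c.
have [c hc] := choice ex.
pose Cm : 'M[rat]_n := \matrix_(i, j) c i j.
exists (\det Cm).
  by apply: (pint_det p_pr) => i j; rewrite mxE; have [] := hc _ (ltn_ord i).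
have tP : size s == n by rewrite sn.
rewrite (@nrm_basis _ (Tuple tP) b (diag_mx (\row_i p%:R ^+ D i) *m Cm)).
- rewrite det_mulmx det_diag -prodrXr; congr (_ * _).
  by apply: eq_bigr => i _; rewrite mxE.
- exact: modbasis_basis.
move=> i; have [_ h] := hc i (ltn_ord i).
transitivity (p%:R ^+ D i * (b * s`_i / p%:R ^+ D i)).
  by rewrite mulrCA divff ?mulr1 // expf_neq0.
rewrite h sn big_mkord mulr_sumr; apply: eq_bigr => j _.
by rewrite mul_diag_mx !mxE -natrX mulr_natl -scaler_nat scalerA natrX.
Qed.

Let exists_basis : exists s, modbasis p vs (fun=> 0) e s.
Proof.
have [|v vvs|s sb _] := @modbasis_chain _ p p_pr vs uvs vsP (fun=> 0) e; last by exists s.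
  by move=> v /vp_gt0/ltW.
by rewrite add0r.
Qed.

Lemma sum_local_degrees : \sum_(v <- vs) v p%:R * (rdeg p v)%:Z = n%:Z.
Proof.
have [|v vvs|s sb ss] := @modbasis_chain _ p p_pr vs uvs vsP (fun=> 0) e.
- by move=> v /vp_gt0/ltW.
- by rewrite add0r.
rewrite -(modbasis_full sb) ss; by under [RHS]eq_bigr do rewrite subr0.
Qed.

Let ordq_nrm_ge0 b : b != 0 -> O b -> 0 <= ordq p (nrm b).
Proof.
move=> b0 Ob; apply: (pint_ge0 p_pr); first exact: nrm_neq0.
have [s sb] := exists_basis.
have [|r pr ->] := @nrm_rows s b (fun=> 0%N) sb.
  move=> i ltin; rewrite expr0 divr1; apply: OM => //.
  by case: (sb) => /allP h _ _; apply: h; rewrite mem_nth // (modbasis_full sb).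
by rewrite big1 // expr0 mul1r.
Qed.

Let ordq_nrm_unit b : b != 0 -> (forall v, v \in vs -> v b = 0) -> ordq p (nrm b) = 0.
Proof.
move=> b0 vb.
have Ob : O b by apply/allP => v vvs; rewrite vge_neq0 // vb.
have ObV : O b^-1 by apply/allP => v vvs; rewrite vge_neq0 ?invr_eq0 // (valV (vsfin vvs)) // vb.
have h1 := ordq_nrm_ge0 b0 Ob; have h2 := ordq_nrm_ge0 (invr_neq0 b0) ObV.
have : ordq p (nrm b) + ordq p (nrm b^-1) = 0.
  rewrite -ordqM ?nrm_neq0 ?invr_eq0 // -nrmM divff //.
  have -> : (1 : L) = 1%:A by rewrite scale1r.
  by rewrite nrm_rat expr1n ordq1.
lia.
Qed.

Let ordq_nrm_unif v b : v \in vs -> b != 0 -> v b = 1 ->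
  (forall w, w \in vs -> w != v -> w b = 0) -> (rdeg p v)%:Z <= ordq p (nrm b).
Proof.
(* One unit below e at v: b maps I(k) into I(e) = p O, and the part t of the basis that comes from
   I(k) / I(e) has f_v elements. *)
move=> vvs b0 vb wb; pose k w := e w - (w == v)%:Z.
have k0 w : w \in vs -> 0 <= k w.
  by move=> wvs; have := vp_gt0 wvs; rewrite /k /e; case: (w == v) => /=; lia.
have ke w : w \in vs -> k w <= 0 + w p%:R by move=> wvs; rewrite /k /e; lia.
have [s sb _] := modbasis_chain p_pr uvs vsP k0 ke.
have [t tb st] := modbasis_step p_pr uvs vsP k vvs.
have incrE : incr v k = e by apply/funext => w; rewrite /incr /k subrK.
rewrite incrE in tb.
have sb' : modbasis p vs (fun=> 0) e (s ++ t).
  apply: (modbasis_cat vsP k0 _ _ sb tb) => w wvs; last by rewrite add0r.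
  by have := vp_gt0 wvs; rewrite /k; lia.
have sn := modbasis_full sb'; rewrite size_cat in sn.
have [|r pr rE] := @nrm_rows (s ++ t) b (fun i => (size s <= i)%N : nat) sb'.
  move=> i ltin; rewrite nth_cat; have [si|si] := ltnP i (size s).
    rewrite expr0 divr1; apply: OM.
      by apply/allP => w wvs; rewrite vge_neq0 //; have [->|/(wb w wvs)->//] := eqVneq w v; rewrite vb.
    by case: sb => /allP h _ _; apply: h; rewrite mem_nth.
  rewrite expr1; apply: O_divp; apply/allP => w wvs.
  have ti : t`_(i - size s) \in t by rewrite mem_nth // ltn_subLR // sn.
  have -> : e w = w b + k w.
    by rewrite /k; have [->|wv] := eqVneq w v; rewrite ?vb ?(wb w) //=; lia.
  apply: (vgeM (vsfin wvs)); first exact: vge_val.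
  by case: tb => /allP h _ _; apply: (allP (h _ ti)).
have r0 : r != 0 by apply: contraTneq (nrm_neq0 b0) => r0; rewrite rE r0 mulr0 eqxx.
have pq0 : (p%:R : rat) != 0 by rewrite pnatr_eq0 -lt0n prime_gt0.
have sumD : (\sum_(i < n) (size s <= i)%N)%N = rdeg p v.
  rewrite -st -(big_mkord xpredT (fun i => (size s <= i : nat)%N)) -sn.
  rewrite (big_cat_nat (leq0n (size s)) (leq_addr _ _)) /= big_nat big1 ?add0n; last first.
    by move=> i /andP[_ si]; rewrite leqNgt si.
  rewrite big_nat (eq_bigr (fun=> 1%N)); last by move=> i /andP[->].
  by rewrite -big_nat sum_nat_const_nat muln1 addKn.
rewrite rE sumD ordqM ?expf_neq0 // ordqX // ordq_p // mul1r lerDl.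
exact: (pint_ge0 p_pr).
Qed.

(* The norm is multiplicative, so it suffices to know it on units and on local
   uniformizers, where the bound of [ordq_nrm_unif] is sharp because its
   consequence for [p] is. *)
Theorem ordq_nrm b : b != 0 -> ordq p (nrm b) = \sum_(v <- vs) v b * (rdeg p v)%:Z.
Proof.
have ex v : exists b, v \in vs -> [/\ b != 0, v b = 1 &
    forall w, w \in vs -> w != v -> w b = 0].
  have [vvs|_] := boolP (v \in vs); last by exists 0.
  have [t t0 ht] := exists_val (fun w => (w == v)%:Z) uvs vsfin.
  exists t => _; split=> // [|w wvs /negPf wv]; first by rewrite ht // eqxx.
  by rewrite ht // wv.
have [pi hpi] := choice ex.
have pi0 v : v \in vs -> pi v != 0 by case/hpi.
(* g a has the valuations of a on vs, so a / g a is a unit there. *)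
pose g a := \prod_(v <- vs) pi v ^ v a.
have valXz v a (k : int) : v \in vs -> a != 0 -> v (a ^ k) = v a * k.
  move=> vvs a0; have vP := vsfin vvs; case: k => k; first by rewrite -exprnP valX.
  by rewrite NegzE -invr_expz valV ?expfz_neq0 // -exprnP valX //; lia.
have g0 a : g a != 0.
  by rewrite /g big_seq; elim/big_ind: _ => [||v vvs]; rewrite ?oner_neq0 ?expfz_neq0 ?pi0 //;
    exact: mulf_neq0.
have vg a w : w \in vs -> w (g a) = w a.
  move=> wvs; have wP := vsfin wvs.
  have -> : w (g a) = \sum_(v <- vs) w (pi v ^ v a).
    by rewrite /g big_seq [RHS]big_seq val_prod // => v vvs; rewrite expfz_neq0 ?pi0.
  rewrite (bigD1_seq w) //= valXz ?pi0 //; have [_ -> _] := hpi w wvs; rewrite mul1r.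
  rewrite big_seq_cond big1 ?addr0 // => v /andP[vvs vw]; rewrite valXz ?pi0 //.
  by have [_ _ ->] := hpi v vvs; rewrite ?mul0r // eq_sym.
have nrm_g a : ordq p (nrm (g a)) = \sum_(v <- vs) v a * ordq p (nrm (pi v)).
  rewrite /g (big_morph _ (@nrmM L) (nrm1 L)) big_seq [RHS]big_seq.
  rewrite ordq_prod // => [|v vvs]; last by rewrite nrm_neq0 ?expfz_neq0 ?pi0.
  by apply: eq_bigr => v vvs; rewrite mulrC -ordqXz ?nrm_neq0 ?pi0 // nrmXz.
have total a : a != 0 -> ordq p (nrm a) = \sum_(v <- vs) v a * ordq p (nrm (pi v)).
  move=> a0; have ag0 : a / g a != 0 by rewrite mulf_neq0 ?invr_eq0 ?g0.
  rewrite -nrm_g -[in LHS](divfK (g0 a) a) nrmM ordqM ?nrm_neq0 ?g0 //.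
  rewrite (ordq_nrm_unit ag0) ?add0r // => v vvs; have vP := vsfin vvs.
  by rewrite valM ?invr_eq0 ?g0 // valV ?g0 // vg // subrr.
have eqv v : v \in vs -> ordq p (nrm (pi v)) = rdeg p v.
  move=> vvs; apply/eqP; apply: contraT => ne.
  have := total p%:R p0.
  have -> : ordq p (nrm (p%:R : L)) = n%:Z.
    have -> : (p%:R : L) = (p%:R : rat)%:A by rewrite scaler_nat.
    by rewrite nrm_rat ordqX ?pnatr_eq0 -?lt0n ?prime_gt0 // ordq_p // mul1r.
  rewrite -sum_local_degrees => /eqP; rewrite eq_le => /andP[_]; rewrite leNgt => /negP[].
  rewrite !(bigD1_seq v) //=; apply: ltr_leD.
    have [h1 h2 h3] := hpi v vvs; have := ordq_nrm_unif vvs h1 h2 h3.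
    by rewrite ltr_pM2l ?vp_gt0 // lt_neqAle eq_sym ne.
  rewrite big_seq_cond [leRHS]big_seq_cond; apply: ler_sum => w /andP[wvs _].
  have [h1 h2 h3] := hpi w wvs; rewrite ler_pM2l ?vp_gt0 //; exact: ordq_nrm_unif h3.
move=> b0; rewrite total // big_seq [RHS]big_seq; apply: eq_bigr => v vvs.
by rewrite eqv.
Qed.

End NormFormula.

(** * Places over all primes *)

Section Places.
Variable L : fieldExtType rat.
Implicit Types (v w : L -> int) (a b y : L).

Lemma int_relation a : exists (m : nat) (c : nat -> int),
  \sum_(i < m) (c i)%:~R * a ^+ i = 0 /\ exists2 i, (i < m)%N & c i != 0.
Proof.
pose m := (\dim {:L}).+1; pose s := [seq a ^+ i | i <- iota 0 m].
have ss : size s = m by rewrite size_map size_iota.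
(* The prime 2 is arbitrary: a coefficient it does not divide is nonzero. *)
have [|c [c0 [i si pi]]] := @zcomb_dependent _ 2 s isT; first by rewrite ss.
exists m, c; split; last first.
  by exists i; [rewrite -ss|apply: contraNneq pi => ->; rewrite dvdz0].
rewrite -[RHS]c0 /zcomb big_mkord ss; apply: eq_bigr => j _.
by rewrite (nth_map 0%N) ?size_iota // nth_iota.
Qed.

(* If the coefficients of a relation are units at [v], then [v a] <> 0 would
   give all its terms different valuations. *)
Lemma val_eq0_relation v a m (c : nat -> int) : finite_place v -> a != 0 ->
  \sum_(i < m) (c i)%:~R * a ^+ i = 0 -> (exists2 i, (i < m)%N & c i != 0) ->
  (forall i, c i != 0 -> v (c i)%:~R = 0) -> v a = 0.
Proof.
move=> vP a0 rel [i1 i1m ci1] vc.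
pose F (i : 'I_m) := (c i)%:~R * a ^+ i.
have vF (i : 'I_m) : c i != 0 -> F i != 0 /\ v (F i) = v a * (i : nat)%:Z.
  move=> ci; have c0 : (c i)%:~R != 0 :> L by rewrite intrL_eq0.
  by rewrite /F mulf_neq0 ?expf_neq0 // valM ?expf_neq0 // vc // valX // add0r.
have main (i0 : 'I_m) : c i0 != 0 -> ~ (forall i : 'I_m, c i != 0 -> i != i0 ->
    v a * (i0 : nat)%:Z < v a * (i : nat)%:Z).
  move=> ci0 h; have [F0 vF0] := vF _ ci0; move/eqP: rel; apply/negP.
  apply: (sum_neq0_min vP F0) => i ii0.
  have [ci|ci] := eqVneq (c i) 0; first by rewrite /F ci mul0r vge0r.
  have [Fi vFi] := vF _ ci; rewrite vge_neq0 // vF0 vFi.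
  by have := h _ ci ii0; lia.
have [va|va|//] := ltgtP (v a) 0.
  have [i0 ci0 hi0] := @arg_maxnP _ (Ordinal i1m) (fun i : 'I_m => c i != 0) (@nat_of_ord m) ci1.
  case: (main i0 ci0) => i ci ii0; have := hi0 _ ci.
  by move: ii0; rewrite -val_eqE /=; nia.
have [i0 ci0 hi0] := @arg_minnP _ (Ordinal i1m) (fun i : 'I_m => c i != 0) (@nat_of_ord m) ci1.
case: (main i0 ci0) => i ci ii0; have := hi0 _ ci.
by move: ii0; rewrite -val_eqE /=; nia.
Qed.

(** If all nonzero integers were units at v, an integral relation for a uniformizer would force its
    valuation to be 0. For the least N > 0 with v(N) > 0, the least prime factor has positive
    valuation, as otherwise the cofactor would be a smaller such N. *)
Lemma place_prime v : finite_place v -> exists2 p, prime p & place_over p v.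
Proof.
move=> vP; have [a a0 va] := uniformizer vP.
have [m [c [rel nz]]] := int_relation a.
have [N [N0 vN]] : exists N, (0 < N)%N /\ 0 < v N%:R.
  apply: contrapT => H; suff : v a = 0 by rewrite va.
  apply: (val_eq0_relation vP a0 rel nz) => i ci.
  have e : v (c i)%:~R = v `|c i|%:R.
    have [h|h] := leP 0 (c i); first by rewrite -[in LHS](gez0_abs h).
    by rewrite -(valN vP) -mulrNz -ltz0_abs.
  have := vge_nat vP `|c i|; rewrite vge_neq0 ?natrL_eq0 ?absz_eq0 // -e le_eqVlt => /orP[/eqP//|h].
  by case: H; exists `|c i|%N; rewrite absz_gt0 -e.
have exN : exists N, (0 < N)%N && (0 < v N%:R) by exists N; rewrite N0.
case: (ex_minnP exN) => {N0 vN}N /andP[N0 vN] Nmin.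
have N1 : (1 < N)%N by case: N N0 vN {Nmin} => [|[|N]] // _; rewrite val1.
exists (pdiv N); rewrite ?pdiv_prime //; split=> //.
rewrite ltNge; apply/negP => vp.
have dv := pdiv_dvd N.
have q0 : (0 < N %/ pdiv N)%N by rewrite divn_gt0 ?pdiv_gt0 // dvdn_leq.
have vNE : v N%:R = v (N %/ pdiv N)%:R + v (pdiv N)%:R.
  by rewrite -{1}(divnK dv) natrM valM ?natrL_eq0 -?lt0n ?pdiv_gt0.
have : (N <= N %/ pdiv N)%N by apply: Nmin; rewrite q0 (lt_le_trans vN) // vNE gerDl.
by rewrite leqNgt ltn_Pdiv // prime_gt1 // pdiv_prime.
Qed.

Lemma place_over_inj p q v : prime p -> prime q -> place_over p v -> place_over q v -> p = q.
Proof.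
move=> p_pr q_pr [vP vp] [_ vq]; apply/eqP; apply: contraT => pq.
have := @v_int_coprime L v vP p p_pr vp q.
rewrite dvdzE /= dvdn_prime2 // pq => /(_ isT) e; by move: vq; rewrite -[q%:R]/(q%:Z%:~R) e.
Qed.

Lemma val_support a : a != 0 -> exists B, forall p v, prime p -> (B <= p)%N ->
  place_over p v -> v a = 0.
Proof.
move=> a0; have [m [c [rel nz]]] := int_relation a.
(* A prime this large divides no nonzero coefficient of the relation. *)
exists (\sum_(i < m) `|c i|).+1%N => p v p_pr Bp [vP vp].
pose c' i := if (i < m)%N then c i else 0.
apply: (@val_eq0_relation v a m c') => //.
- by rewrite -[RHS]rel; apply: eq_bigr => i _; rewrite /c' ltn_ord.
- by case: nz => i im ci; exists i; rewrite // /c' im.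
move=> i; rewrite /c'; case: ifP => [im ci|_]; last by rewrite eqxx.
apply: (v_int_coprime vP p_pr vp); rewrite dvdzE /=; apply/negP => /dvdn_leq.
rewrite absz_gt0 => /(_ ci); rewrite leqNgt => /negP; apply.
apply: leq_trans Bp; rewrite ltnS (bigD1 (Ordinal im)) //=; exact: leq_addr.
Qed.

Definition plist (p : nat) : seq (L -> int) :=
  if pselect (prime p) is left h then projT1 (cid (places_finite L h)) else [::].

Lemma plist_uniq p : uniq (plist p).
Proof. by rewrite /plist; case: pselect => // h; case: cid => s []. Qed.

Lemma plistP p v : prime p -> v \in plist p <-> place_over p v.
Proof. by rewrite /plist; case: pselect => [h _|] //; case: cid => s [_ hs] /=; exact: hs. Qed.

(** Finite truncations of the set of finite places; for a given nonzero number, the places left out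
    have valuation 0 once B is large. *)
Definition places_upto (B : nat) : seq (L -> int) :=
  flatten [seq plist p | p <- iota 0 B & prime p].

Lemma places_upto_sum (R : realType) (F : (L -> int) -> R) B :
  \sum_(v <- places_upto B) F v = \sum_(p < B | prime p) \sum_(v <- plist p) F v.
Proof.
rewrite big_flatten /= big_map big_filter -/(index_iota 0 B).
by rewrite -(big_mkord (fun p => prime p) (fun p => \sum_(v <- plist p) F v)) /index_iota subn0.
Qed.

Lemma places_uptoP B v :
  v \in places_upto B <-> exists p, [/\ prime p, (p < B)%N & place_over p v].
Proof.
split=> [/flattenP[s /mapP[p + ->]]|[p [p_pr pB vp]]].
  rewrite mem_filter mem_iota add0n => /andP[p_pr /andP[_ pB]] /(plistP _ p_pr) vp.
  by exists p.
apply/flattenP; exists (plist p); last exact/plistP.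
by apply: map_f; rewrite mem_filter p_pr mem_iota add0n.
Qed.

Lemma places_upto_uniq B : uniq (places_upto B).
Proof.
rewrite /places_upto; have : uniq (iota 0 B) by exact: iota_uniq.
elim: (iota 0 B) => //= p s IH /andP[ps us].
case: ifP => [p_pr|_]; last exact: IH.
rewrite /= cat_uniq plist_uniq IH // andbT /=.
apply/hasPn => v /flattenP[t /mapP[q + ->]]; rewrite mem_filter => /andP[q_pr qs].
move=> /(plistP _ q_pr) vq; apply/negP => /(plistP _ p_pr) vp.
by move: ps; rewrite (place_over_inj p_pr q_pr vp vq) qs.
Qed.

(** Pigeonhole on the residues of 1, a, ..., a^q, where q is the norm of v. *)
Lemma residue_order p v a : prime p -> place_over p v -> a != 0 -> v a = 0 ->
  exists2 d, (0 < d <= p ^ \dim {:L})%N & vge v 1 (a ^+ d - 1).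
Proof.
move=> p_pr vp a0 va; have [vP _] := vp.
pose q := place_norm v; have qE : q = (p ^ rdeg p v)%N := place_normE p_pr vp.
(* [fset_set] of an infinite set is empty, so a positive norm shows finiteness. *)
have fin : finite_set (residue_field v).
  apply: contrapT => nf; have : (0 < q)%N by rewrite qE expn_gt0 prime_gt0.
  by rewrite /q /place_norm /fset_set; case: pselect.
pose g (i : 'I_q.+1) : set L := [set b | valuation_ideal v (b - a ^+ i)].
have [i [j [ij gij]]] : exists i j : 'I_q.+1, (i < j)%N /\ g i = g j.
  apply: contrapT => H.
  have ginj : injective g.
    move=> i j e; apply/val_inj/eqP; apply: contraT; rewrite neq_ltn => /orP[h|h].
      by case: H; exists i, j.
    by case: H; exists j, i.
  have := card_fset_set_range ginj; rewrite card_ord => e.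
  suff : (q.+1 <= q)%N by rewrite ltnn.
  rewrite -{1}e; apply: fsubset_leq_card.
  rewrite -fset_set_sub //; last exact/finite_image/finite_setT_fin.
  move=> _ [i _ <-]; exists (a ^+ i) => //.
  by right; rewrite valX // va mul0r.
exists (j - i)%N.
  rewrite subn_gt0 ij /= (leq_trans (leq_subr _ _)) //.
  have jq : (j <= q)%N by rewrite -ltnS.
  by rewrite (leq_trans jq) // qE leq_exp2l ?prime_gt1 // (rdeg_le p_pr vp).
have : g j (a ^+ j) by rewrite /g /= subrr; left.
rewrite -gij /g /= => h.
have {}h : vge v 1 (a ^+ j - a ^+ i).
  by rewrite /vge; case: h => [->|h]; rewrite ?eqxx // -gtz0_ge1 h orbT.
have -> : a ^+ (j - i) - 1 = (a ^+ j - a ^+ i) / a ^+ i.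
  by rewrite -{2}(subnK (ltnW ij)) exprD mulrBl mulfK ?divff ?expf_neq0.
apply: (vge_div vP (k' := 0)); rewrite ?expf_neq0 ?addr0 //.
by rewrite valX // va mul0r.
Qed.

(** One exponent for all places over p, and for all fields of degree at most N. *)
Lemma residue_order_fact p v a N : prime p -> place_over p v -> a != 0 -> v a = 0 ->
  (\dim {:L} <= N)%N -> vge v 1 (a ^+ (p ^ N)`! - 1).
Proof.
move=> p_pr vp a0 va nN; have [d /andP[d0 dq] hd] := residue_order p_pr vp a0 va.
have [vP _] := vp.
have /dvdnP[k ->] : (d %| (p ^ N)`!)%N.
  by apply: dvdn_fact; rewrite d0 (leq_trans dq) // leq_exp2l // prime_gt1.
rewrite mulnC exprM; elim: k => [|k IH]; first by rewrite expr0 subrr vge0r.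
have -> : (a ^+ d) ^+ k.+1 - 1 = a ^+ d * ((a ^+ d) ^+ k - 1) + (a ^+ d - 1).
  by rewrite exprS; ring.
apply: (vgeD vP) => //; rewrite -(add0r (1 : int)); apply: (vgeM vP) => //.
by rewrite vge_neq0 ?expf_neq0 // valX // va mul0r.
Qed.

End Places.

(** * Absolute values and multiplicative relations *)

Lemma ln_exprz (R : realType) (x : R) (k : int) : 0 < x -> ln (x ^ k) = k%:~R * ln x.
Proof.
move=> x0; case: k => k; first by rewrite -exprnP lnXn // mulr_natl.
by rewrite NegzE -invr_expz lnV ?posrE ?exprz_gt0 // -exprnP lnXn // mulrNz mulNr mulr_natl.
Qed.

Lemma ln_prod (R : realType) (I : Type) (r : seq I) (P : pred I) (F : I -> R) :
  (forall i, P i -> 0 < F i) ->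
  ln (\prod_(i <- r | P i) F i) = \sum_(i <- r | P i) ln (F i).
Proof.
move=> F0; suff [] : 0 < \prod_(i <- r | P i) F i /\
  ln (\prod_(i <- r | P i) F i) = \sum_(i <- r | P i) ln (F i) by [].
apply: (big_rec2 (fun x y : R => 0 < x /\ ln x = y)); first by rewrite ltr01 ln1.
by move=> i y x Pi [y0 <-]; rewrite mulr_gt0 ?F0 // lnM ?posrE ?F0.
Qed.

Section AbsoluteValues.
Variables (R : realType) (L : fieldExtType rat).
Implicit Types (N : L -> R) (a b : L).

(* The weak triangle inequality with constant [c] treats the archimedean
   absolute values (c = 2) and the finite ones (c = 1) uniformly. *)
Definition is_abs N (c : R) :=
  [/\ 1 <= c, N 0 = 0, forall a, a != 0 -> 0 < N a,
      forall a b, N (a * b) = N a * N b &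
      forall a b, N (a + b) <= c * Num.max (N a) (N b)].

(** The function log^+, of which heights are sums. *)
Definition lnp (x : R) : R := ln (Num.max 1 x).

Lemma lnp_ge0 x : 0 <= lnp x.
Proof. by rewrite ln_ge0 // le_max lexx. Qed.

Lemma lnpE x : 0 < x -> lnp x = Num.max 0 (ln x).
Proof.
move=> x0; rewrite /lnp; have [x1|x1] := leP x 1.
  by rewrite ln1 max_l // ln_le0.
by rewrite max_r // ln_ge0 // ltW.
Qed.

Lemma lnp_le (x y : R) : x <= y -> lnp x <= lnp y.
Proof.
move=> xy; rewrite ler_ln ?posrE ?lt_max ?ltr01 //.
by rewrite ge_max !le_max lexx xy orbT.
Qed.

Lemma ln_le_lnp (x : R) : 0 < x -> ln x <= lnp x.
Proof. by move=> x0; rewrite lnpE // le_max lexx orbT. Qed.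

Lemma lnpM (x y : R) : 0 <= x -> 0 <= y -> lnp (x * y) <= lnp x + lnp y.
Proof.
move=> x0 y0; rewrite /lnp -lnM ?posrE ?lt_max ?ltr01 //.
rewrite ler_ln ?posrE ?mulr_gt0 ?lt_max ?ltr01 // ge_max.
have x1 : 1 <= Num.max 1 x by rewrite le_max lexx.
have y1 : 1 <= Num.max 1 y by rewrite le_max lexx.
apply/andP; split; first exact: mulr_ege1.
by apply: ler_pM => //; rewrite le_max lexx orbT.
Qed.

Section OneAbs.
Variables (N : L -> R) (c : R) (NP : is_abs N c).

Lemma abs0 : N 0 = 0. Proof. by case: NP. Qed.
Lemma abs_gt0 a : a != 0 -> 0 < N a. Proof. by case: NP => _ _ + _ _; apply. Qed.
Lemma absM a b : N (a * b) = N a * N b. Proof. by case: NP. Qed.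
Lemma absD a b : N (a + b) <= c * Num.max (N a) (N b). Proof. by case: NP. Qed.
Lemma abs_ge0 a : 0 <= N a.
Proof. by have [->|/abs_gt0/ltW//] := eqVneq a 0; rewrite abs0. Qed.
Lemma abs_c_ge1 : 1 <= c. Proof. by case: NP. Qed.

Lemma abs1 : N 1 = 1.
Proof.
have h : N 1 * N 1 = N 1 by rewrite -absM mulr1.
have := abs_gt0 (oner_neq0 L); move: (N 1) h => x h x0.
by apply: (@mulIf _ x); rewrite ?gt_eqF // h mul1r.
Qed.

Lemma absV a : N a^-1 = (N a)^-1.
Proof.
have [->|a0] := eqVneq a 0; first by rewrite invr0 abs0 invr0.
apply: (mulfI (lt0r_neq0 (abs_gt0 a0))).
by rewrite -absM !divff ?abs1 // lt0r_neq0 // abs_gt0.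
Qed.

Lemma absX a k : N (a ^+ k) = N a ^+ k.
Proof. by elim: k => [|k IH]; rewrite ?expr0 ?abs1 // !exprS absM IH. Qed.

Lemma absXz a (k : int) : N (a ^ k) = N a ^ k.
Proof.
case: k => k; first by rewrite -!exprnP absX.
by rewrite NegzE -!invr_expz absV -!exprnP absX.
Qed.

Lemma absN a : N (- a) = N a.
Proof.
rewrite -mulN1r absM.
suff -> : N (-1) = 1 by rewrite mul1r.
apply: (pexpIrn (n := 2)); rewrite ?nnegrE ?abs_ge0 ?ler01 //.
by rewrite -absX sqrrN expr1n abs1 expr1n.
Qed.

Lemma abs_prod (I : Type) (r : seq I) (P : pred I) (F : I -> L) :
  N (\prod_(i <- r | P i) F i) = \prod_(i <- r | P i) N (F i).
Proof. exact: (big_morph _ absM abs1). Qed.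

Lemma lnp_absD a b : lnp (N (a + b)) <= ln c + lnp (N a) + lnp (N b).
Proof.
have c0 : 0 < c := lt_le_trans ltr01 abs_c_ge1.
apply: (le_trans (lnp_le (absD a b))).
have m0 : 0 <= Num.max (N a) (N b) by rewrite le_max abs_ge0.
apply: (le_trans (lnpM (ltW c0) m0)).
have -> : lnp c = ln c by rewrite /lnp max_r // abs_c_ge1.
rewrite -addrA lerD2l; have [h|h] := leP (N a) (N b).
  by rewrite lerDr lnp_ge0.
by rewrite lerDl lnp_ge0.
Qed.

Lemma lnp_absM a b : lnp (N (a * b)) <= lnp (N a) + lnp (N b).
Proof. by rewrite absM lnpM ?abs_ge0. Qed.

(** Summed over the places, this and the product formula give h(1/a) = h(a). *)
Lemma lnp_absV a : a != 0 -> lnp (N a^-1) = lnp (N a) - ln (N a).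
Proof.
move=> a0; have Na := abs_gt0 a0; rewrite absV !lnpE ?invr_gt0 // lnV ?posrE //.
have [h|h] := leP (ln (N a)) 0; first by rewrite sub0r max_r // oppr_ge0.
by rewrite subrr max_l // oppr_le0 ltW.
Qed.

(* Either [z] is not very small, or every [s j] is comparable to [1 - c j],
   and then the relation bounds [z] since [e i0] is the largest exponent. *)
Lemma lnp_relation (I : finType) (i0 : I) (e : I -> int) (s cc : I -> L) :
  e i0 != 0 -> (forall i, `|e i| <= `|e i0|) -> (forall i, s i != 0) ->
  \prod_i s i ^ e i = 1 ->
  (forall j, j != i0 -> [/\ cc j != 0, 1 - cc j != 0 & s j = (1 - cc j) + cc j * s i0]) ->
  lnp (N (s i0)^-1) <= \sum_(j | j != i0)
     (ln c + lnp (N (cc j)) + lnp (N (1 - cc j)) + lnp (N (1 - cc j)^-1)).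
Proof.
move=> e0 emax s0 rel hs; pose t j := ln c + lnp (N (cc j)) + lnp (N (1 - cc j)) + lnp (N (1 - cc j)^-1).
rewrite -[leRHS]/(\sum_(j | j != i0) t j).
have c1 := abs_c_ge1; have c0 : 0 < c := lt_le_trans ltr01 c1.
have lnc : 0 <= ln c by rewrite ln_ge0.
have t0 j : 0 <= t j by rewrite /t !addr_ge0 ?lnp_ge0.
set z := s i0; have z0 : z != 0 := s0 i0; have Nz := abs_gt0 z0.
(* If z is not small compared with one 1 - c_j, the single term t j already bounds log^+ |1/z|. *)
have [[j jn hj]|far] := pselect (exists2 j, j != i0 & N (1 - cc j) <= c * N (cc j) * N z).
  have [cj0 cj1 _] := hs j jn; have Nc := abs_gt0 cj0; have N1 := abs_gt0 cj1.
  apply: (@le_trans _ _ (t j)); last by rewrite (bigD1 j) //= lerDl sumr_ge0.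
  have : N z^-1 <= c * N (cc j) * N (1 - cc j)^-1.
    rewrite !absV ler_pdivlMr // mulrC ler_pdivrMr //.
  move=> /lnp_le/le_trans; apply.
  apply: (le_trans (lnpM _ _)); rewrite ?mulr_ge0 ?abs_ge0 ?(ltW c0) //.
  have := lnpM (ltW c0) (abs_ge0 (cc j)).
  have -> : lnp c = ln c by rewrite /lnp max_r.
  by have := lnp_ge0 (N (1 - cc j)); rewrite /t; lra.
(* Now c |c_j z| < |1 - c_j|, so |s_j| and |1 - c_j| agree up to a factor c in both directions. *)
have {}far j : j != i0 -> `|ln (N (s j))| <= t j.
  move=> jn; have [cj0 cj1 sj] := hs j jn; have Nc := abs_gt0 cj0; have N1 := abs_gt0 cj1.
  have lt : c * (N (cc j) * N z) < N (1 - cc j).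
    by rewrite mulrA ltNge; apply/negP => h; apply: far; exists j.
  have Nsj := abs_gt0 (s0 j).
  have up : N (s j) <= c * N (1 - cc j).
    rewrite sj; apply: (le_trans (absD _ _)); rewrite ler_pM2l // ge_max lexx absM /=.
    apply: le_trans (ltW lt); rewrite ler_peMl // mulr_ge0 ?abs_ge0 //.
  have dn : N (1 - cc j) <= c * N (s j).
    have : N (1 - cc j) <= c * Num.max (N (s j)) (N (cc j * z)).
      have {1}-> : 1 - cc j = s j + - (cc j * z) by rewrite sj addrK.
      by apply: (le_trans (absD _ _)); rewrite absN.
    have [//|h] := leP (N (cc j * z)) (N (s j)); rewrite absM.
    by move/(lt_le_trans lt); rewrite ltxx.
  have ln_up : ln (N (s j)) <= ln c + ln (N (1 - cc j)).
    by rewrite -lnM ?posrE // ler_ln ?posrE ?mulr_gt0.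
  have ln_dn : ln (N (1 - cc j)) <= ln c + ln (N (s j)).
    by rewrite -lnM ?posrE // ler_ln ?posrE ?mulr_gt0.
  have h1 := ln_le_lnp N1.
  have h2 : - ln (N (1 - cc j)) <= lnp (N (1 - cc j)^-1).
    by rewrite absV -lnV ?posrE // ln_le_lnp // invr_gt0.
  have := lnp_ge0 (N (cc j)); have := lnp_ge0 (N (1 - cc j)); have := lnp_ge0 (N (1 - cc j)^-1).
  by rewrite /t ler_norml; move=> *; apply/andP; split; lra.
have relS : \sum_i (e i)%:~R * ln (N (s i)) = 0.
  have pos i : 0 < N (s i) ^ e i by rewrite exprz_gt0 // abs_gt0.
  have e1 : \prod_i N (s i) ^ e i = 1.
    transitivity (N (\prod_i s i ^ e i)); last by rewrite rel abs1.
    by rewrite abs_prod; apply: eq_bigr => i _; rewrite absXz.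
  transitivity (ln (\prod_i N (s i) ^ e i)); last by rewrite e1 ln1.
  by rewrite ln_prod //; apply: eq_bigr => i _; rewrite ln_exprz // abs_gt0.
(* After division by |e i0|, the relation weighs each |log |s_j|| by at most 1. *)
have key : `|ln (N z)| <= \sum_(j | j != i0) t j.
  have ei0 : 0 < `|(e i0)%:~R| :> R by rewrite normr_gt0 intr_eq0.
  rewrite -(ler_pM2l ei0) -normrM.
  move/eqP: relS; rewrite (bigD1 i0) //= addr_eq0 => /eqP ->; rewrite normrN.
  apply: (le_trans (ler_norm_sum _ _ _)); rewrite mulr_sumr; apply: ler_sum => j jn.
  rewrite normrM; apply: ler_pM => //; last exact: far.
  by rewrite -!intr_norm ler_int.
rewrite lnpE absV ?invr_gt0 // lnV ?posrE // ge_max sumr_ge0 //=.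
by apply: le_trans key; rewrite -normrN ler_norm.
Qed.

End OneAbs.
End AbsoluteValues.

(** * Heights as sums over absolute values *)

Section Family.
Variables (R : realType) (L : fieldExtType rat).
Let n := \dim {:L}.
Implicit Types (N : L -> R) (a b : L) (v : L -> int).

Definition arch (k : 'I_n) (a : L) : R := complex.Re `|emb R[i] k a|.

Lemma re_normE (z : R[i]) : real_complex R (complex.Re `|z|) = `|z|.
Proof. by rewrite RRe_real // normr_real. Qed.

Lemma arch_abs k : is_abs (arch k) 2.
Proof.
split=> [||a a0|a b|a b]; first by rewrite ler1n.
- by rewrite /arch rmorph0 normr0.
- by rewrite -ltcR re_normE normr_gt0 fmorph_eq0.
- by apply: (@complexI R); rewrite rmorphM /= !re_normE rmorphM normrM.
- have : arch k (a + b) <= arch k a + arch k b.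
    by rewrite -lecR rmorphD /= !re_normE rmorphD ler_normD.
  move/le_trans; apply; rewrite mulr_natl mulr2n.
  by apply: lerD; rewrite le_max lexx ?orbT.
Qed.

Lemma sum_embeddings (F : (L -> R[i]) -> R) :
  \sum_(f \in @embeddings L R[i]) F f = \sum_(k < n) F (emb R[i] k : L -> R[i]).
Proof.
pose r := [seq (emb R[i] k : L -> R[i]) | k <- enum 'I_n].
have ur : uniq r.
  rewrite map_inj_uniq ?enum_uniq // => i j e.
  have [theta inj_theta] := emb_separated R[i] L.
  by apply: inj_theta => /=; rewrite [LHS](congr1 (fun f => f theta) e).
have -> : @embeddings L R[i] = [set` r].
  apply/seteqP; split=> [_ [g _ <-]|f /mapP[k _ ->]]; last by exists (emb R[i] k).
  have [k gk] := emb_onto g; apply/mapP; exists k; first by rewrite mem_enum.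
  exact/funext.
by rewrite -fsbig_seq // big_map big_enum.
Qed.

Section Finite.
Variables (p : nat) (p_pr : prime p) (v : L -> int) (vp : place_over p v).
Let vP : finite_place v. Proof. by case: vp. Qed.
Let q : R := (place_norm v)%:R.

Let q_gt1 : 1 < q.
Proof.
rewrite /q (place_normE p_pr vp) -[1]/(1%:R) ltr_nat.
by rewrite -[1%N](expn0 p) ltn_exp2l ?prime_gt1 // (rdeg_gt0 p_pr vp).
Qed.

Let q_gt0 : 0 < q. Proof. exact: lt_trans ltr01 q_gt1. Qed.

Lemma finite_absP : is_abs (finite_abs R v) 1.
Proof.
have faE a : a != 0 -> finite_abs R v a = q ^ (- v a) by rewrite /finite_abs => /negPf->.
have fa0 : finite_abs R v 0 = 0 by rewrite /finite_abs eqxx.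
have fa_gt0 a : a != 0 -> 0 < finite_abs R v a by move=> /faE->; rewrite exprz_gt0.
split=> // a b.
  have [->|a0] := eqVneq a 0; first by rewrite mul0r fa0 mul0r.
  have [->|b0] := eqVneq b 0; first by rewrite mulr0 fa0 mulr0.
  rewrite !faE ?mulf_neq0 // valM // opprD expfzDr //; exact: lt0r_neq0.
rewrite mul1r; have [->|a0] := eqVneq a 0; first by rewrite add0r le_max lexx orbT.
have [->|b0] := eqVneq b 0; first by rewrite addr0 le_max lexx.
have [->|ab0] := eqVneq (a + b) 0; first by rewrite fa0 le_max ltW // fa_gt0.
have := vgeD vP (k := Num.min (v a) (v b)) (a := a) (b := b).
rewrite !vge_neq0 // !ge_min !lexx orbT /= => /(_ isT isT) h.
rewrite !faE // le_max !(ler_eXz2l q_gt1) !lerN2.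
by case/orP: h => ->; rewrite ?orbT.
Qed.

Lemma ln_finite_abs a : a != 0 ->
  ln (finite_abs R v a) = - (v a * (rdeg p v)%:Z)%:~R * ln p%:R.
Proof.
move=> a0; rewrite /finite_abs (negPf a0).
rewrite ln_exprz // /q (place_normE p_pr vp) natrX lnXn ?ltr0n ?prime_gt0 //.
by rewrite mulrNz rmorphM /= -mulr_natl; ring.
Qed.

End Finite.

(** F takes the absolute value as argument, so that local inequalities can be summed over all places
    at once. The normalization of the absolute values already contains the local degrees. *)
Definition gsum B (F : (L -> R) -> R) : R :=
  \sum_(k < n) F (arch k) + \sum_(v <- places_upto L B) F (finite_abs R v).

(** The constant c is 2 at the n embeddings and 1 at the finite places, where log c vanishes. *)
Lemma gsum_le B (m : R) F G : 
  (forall N c, is_abs N c -> F N <= m * ln c + G N) ->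
  gsum B F <= n%:R * (m * ln 2) + gsum B G.
Proof.
move=> h; rewrite /gsum addrA; apply: lerD.
  rewrite -[n in n%:R](card_ord n) mulr_natl -sumr_const -big_split /=.
  by apply: ler_sum => k _; apply: h; apply: arch_abs.
rewrite big_seq [leRHS]big_seq; apply: ler_sum => v /places_uptoP[p [p_pr _ vp]].
by have := h _ _ (finite_absP p_pr vp); rewrite ln1 mulr0 add0r.
Qed.

Lemma gsumD B F G : gsum B (fun N => F N + G N) = gsum B F + gsum B G.
Proof. by rewrite /gsum !big_split /=; ring. Qed.

Lemma gsum_sum (I : finType) (P : pred I) B (F : I -> (L -> R) -> R) :
  gsum B (fun N => \sum_(i | P i) F i N) = \sum_(i | P i) gsum B (F i).
Proof. by rewrite /gsum big_split /= exchange_big [X in _ + X]exchange_big. Qed.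

Lemma eq_gsum B F G : (forall N c, is_abs N c -> F N = G N) -> gsum B F = gsum B G.
Proof.
move=> h; apply/eqP; rewrite eq_le; apply/andP; split.
  have := @gsum_le B 0 F G; rewrite mul0r mulr0 add0r; apply => N c /h ->.
  by rewrite mul0r add0r.
have := @gsum_le B 0 G F; rewrite mul0r mulr0 add0r; apply => N c /h ->.
by rewrite mul0r add0r.
Qed.

Lemma prod_arch a : \prod_k arch k a = `|ratr (nrm a)|.
Proof.
apply: (@complexI R); rewrite rmorph_prod /=.
under eq_bigr do rewrite /arch re_normE.
rewrite -normr_prod -nrmE -(fmorph_rat (real_complex R)) /=.
by rewrite normc_def /= expr0n /= addr0 sqrtr_sqr.
Qed.

Lemma ln_nat_sum (m B : nat) : (0 < m)%N -> (m < B)%N ->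
  ln (m%:R : R) = \sum_(p < B | prime p) (logn p m)%:R * ln p%:R.
Proof.
move=> m0 mB; have e := partnT m0.
have -> : ln (m%:R : R) = \sum_(0 <= p < m.+1) (logn p m)%:R * ln p%:R.
  rewrite -{1}e /partn big_mkord natr_prod.
  rewrite (eq_bigr (fun p : 'I_m.+1 => (p%:R : R) ^+ logn p m)); last by move=> i _; rewrite natrX.
  have pos (p : 'I_m.+1) : 0 < (p%:R : R) ^+ logn p m.
    have [->|p0] := posnP p; first by rewrite lognE /= expr0 ltr01.
    by rewrite exprn_gt0 // ltr0n.
  rewrite ln_prod // big_mkord; apply: eq_bigr => p _.
  have [->|p0] := posnP p; first by rewrite lognE /= expr0 ln1 mul0r.
  by rewrite lnXn ?ltr0n // mulr_natl.
rewrite -(big_mkord (fun p => prime p) (fun p => (logn p m)%:R * ln p%:R)).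
rewrite (big_cat_nat (leq0n m.+1) mB) /= [X in _ = _ + X]big_nat_cond [X in _ = _ + X]big1; last first.
  move=> p /andP[/andP[mp _] _]; rewrite lognE.
  have -> : (p %| m)%N = false by apply: contraTF mp => /(dvdn_leq m0); rewrite -ltnNge.
  by rewrite !andbF mul0r.
rewrite addr0 [RHS]big_mkcond /=; apply: eq_bigr => p _.
by case: ifP => // pn; rewrite lognE pn mul0r.
Qed.

(** The embeddings contribute log |N(a)| and the places over p contribute - ord_p(N(a)) log p, so
    this is the product formula for the rational number N(a). B0 exceeds its numerator and
    denominator. *)
Lemma product_formula a : a != 0 -> exists B0, forall B, (B0 <= B)%N ->
  gsum B (fun N => ln (N a)) = 0.
Proof.
move=> a0; set q := nrm a; have q0 : q != 0 := nrm_neq0 a0.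
exists (maxn `|numq q| `|denq q|).+1 => B; rewrite gtn_max => /andP[B1 B2].
have lnq : ln `|ratr q : R| = \sum_(p < B | prime p) (ordq p q)%:~R * ln p%:R.
  have num0 : (0 < `|numq q|)%N by rewrite absz_gt0 numq_eq0.
  have den0 : (0 < `|denq q|)%N by rewrite absz_gt0 denq_eq0.
  have -> : `|ratr q : R| = `|numq q|%:R / `|denq q|%:R.
    by rewrite /ratr normrM normfV -!intr_norm !natr_absz.
  rewrite ln_div ?posrE ?ltr0n // (ln_nat_sum num0 B1) (ln_nat_sum den0 B2) -sumrB.
  by apply: eq_bigr => p _; rewrite -mulrBl /ordq rmorphB.
rewrite /gsum.
have -> : \sum_(k < n) ln (arch k a) = ln `|ratr q : R|.
  by rewrite -prod_arch ln_prod // => k _; apply: abs_gt0 (arch_abs k) _ a0.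
rewrite lnq places_upto_sum -big_split /= big1 // => p p_pr.
rewrite (ordq_nrm p_pr (plist_uniq L p) (fun v => plistP v p_pr) a0).
rewrite rmorph_sum mulr_suml -big_split big_seq big1 // => v /(plistP _ p_pr) vp.
by rewrite (ln_finite_abs p_pr vp a0) mulNr; exact: subrr.
Qed.

(** For B large, [L : Q] times the absolute height. *)
Definition hgt B a : R := gsum B (fun N => lnp (N a)).

Lemma field_heightE a : exists B0, forall B, (B0 <= B)%N ->
  field_height R a = n%:R^-1 * hgt B a.
Proof.
have [B0 hB0] : exists B0, forall p v, prime p -> (B0 <= p)%N -> place_over p v ->
    lnp (finite_abs R v a) = 0.
  have [->|a0] := eqVneq a 0.
    by exists 0%N => p v _ _ _; rewrite /finite_abs eqxx /lnp max_l // ln1.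
  have [B hB] := val_support a0; exists B => p v p_pr Bp vp.
  by rewrite /finite_abs (negPf a0) (hB p v) // oppr0 expr0z /lnp maxxx ln1.
exists B0 => B BB; rewrite /field_height; congr (_ * (_ + _)).
  exact: (sum_embeddings (fun f => ln (Num.max 1 (complex.Re `|f a|)))).
rewrite [RHS]fsbig_seq ?places_upto_uniq //; apply/esym; apply: (fsbig_widen [set` places_upto L B] (@finite_place L) (fun v => lnp (finite_abs R v a))).
  by move=> v /= /places_uptoP[p [_ _ []]].
move=> v /= [vP nv]; have [p p_pr vp] := place_prime vP.
apply: (hB0 p) => //; apply: leq_trans BB _; rewrite leqNgt; apply/negP => pB.
by apply: nv; apply/places_uptoP; exists p.
Qed.

End Family.

(** * Independence of the height from the field *)

Section Conjugates.
Variables (L : fieldExtType rat) (iota : {rmorphism L -> algC}) (a : L) (mu : {poly rat}).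
Hypotheses (mu_monic : mu \is monic)
  (mu_min : forall q, root (map_poly ratr q) (iota a) = (mu %| q)).
Let n := \dim {:L}.

Let emb_root (C : numClosedFieldType) (g : {rmorphism L -> C}) (q : {poly rat}) :
  root (map_poly ratr q) (g a) = ((map_poly (in_alg L) q).[a] == 0).
Proof.
rewrite /root -(fmorph_eq0 g) -horner_map -map_poly_comp /=.
by rewrite (eq_map_poly (g := ratr)) // => t /=; rewrite rmorphZ_num rmorph1 mulr1.
Qed.

Lemma size_minpoly_gt1 : (1 < size mu)%N.
Proof.
have r1 : root (map_poly ratr mu) (iota a) by rewrite mu_min dvdpp.
rewrite -(size_map_poly (ratr : {rmorphism rat -> algC})).
by apply: root_size_gt1 r1; rewrite map_poly_eq0 monic_neq0.
Qed.

(* All complex roots of the characteristic polynomial are conjugates of [a]. *)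
Lemma char_poly_power : exists2 r, char_poly (mulm a) = mu ^+ r & n = (r * (size mu).-1)%N.
Proof.
have [r cE] : exists r, char_poly (mulm a) = mu ^+ r.
  have hroot (z : algC) : root (map_poly ratr (char_poly (mulm a))) z ->
      forall q, root (map_poly ratr q) z = (mu %| q).
    rewrite (char_mulmE algC a) => /rootP; rewrite horner_prod => /eqP/prodf_eq0[k _].
    rewrite hornerXsubC subr_eq0 => /eqP-> q.
    by rewrite emb_root -mu_min emb_root.
  have := char_poly_monic (mulm a).
  move: {2}(size (char_poly (mulm a))) (leqnn (size (char_poly (mulm a)))) => m.
  elim: m (char_poly (mulm a)) hroot => [|m IH] P hroot sP mP.
    by move: sP; rewrite leqn0 size_poly_eq0 (negPf (monic_neq0 mP)).
  have [s1|s1] := leqP (size P) 1.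
    exists 0%N; rewrite expr0; apply/eqP; rewrite -eqp_monic ?monic1 //.
    by rewrite -size_poly_eq1 eqn_leq s1 size_poly_gt0 monic_neq0.
  have [z rz] : exists z : algC, root (map_poly ratr P) z.
    by apply/closed_rootP; rewrite size_map_poly neq_ltn s1 orbT.
  have /dvdpP[Q PE] : mu %| P by rewrite -(hroot z rz).
  have mQ : Q \is monic by rewrite -(monicMr _ mu_monic) -PE.
  have [||//|r QE] := IH Q.
  - by move=> w rw; apply: hroot; rewrite PE rmorphM rootM rw.
  - have Q0 : (0 < size Q)%N by rewrite size_poly_gt0 monic_neq0.
    have := size_minpoly_gt1; move: sP; rewrite PE size_Mmonic ?monic_neq0 //.
    move: (size Q) (size mu) Q0 => x y; lia.
  by exists r.+1; rewrite PE QE exprSr.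
exists r => //; have := size_char_poly (mulm a); rewrite cE => /(congr1 predn).
by rewrite /= size_exp mulnC => ->.
Qed.

Lemma big_conjugates (C : numClosedFieldType) (rs : seq C) r :
  map_poly ratr mu = \prod_(z <- rs) ('X - z%:P) -> char_poly (mulm a) = mu ^+ r ->
  perm_eq [seq emb C k a | k <- enum 'I_n] (flatten (nseq r rs)).
Proof.
move=> rsE cE.
have e : \prod_(z <- [seq emb C k a | k <- enum 'I_n]) ('X - z%:P)
       = \prod_(z <- flatten (nseq r rs)) ('X - z%:P).
  rewrite big_map big_enum /= -(char_mulmE C a) cE rmorphXn /= rsE.
  rewrite big_flatten /= big_nseq; elim: r {cE} => [|r IH] //=.
  by rewrite exprS IH.
exact: prod_XsubC_eq.
Qed.

Lemma sum_conjugates (C : numClosedFieldType) (V : nmodType) (rs : seq C) r (g : C -> V) :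
  map_poly ratr mu = \prod_(z <- rs) ('X - z%:P) -> char_poly (mulm a) = mu ^+ r ->
  \sum_k g (emb C k a) = (\sum_(z <- rs) g z) *+ r.
Proof.
move=> rsE cE.
transitivity (\sum_(z <- [seq emb C k a | k <- enum 'I_n]) g z); first by rewrite big_map big_enum.
rewrite (perm_big _ (big_conjugates rsE cE)) big_flatten /= big_nseq.
by elim: r {cE} => [|r IH] //=; rewrite IH mulrS.
Qed.

Lemma prod_conjugates (C : numClosedFieldType) (rs : seq C) r (g : C -> C) :
  map_poly ratr mu = \prod_(z <- rs) ('X - z%:P) -> char_poly (mulm a) = mu ^+ r ->
  \prod_k g (emb C k a) = (\prod_(z <- rs) g z) ^+ r.
Proof.
move=> rsE cE.
transitivity (\prod_(z <- [seq emb C k a | k <- enum 'I_n]) g z); first by rewrite big_map big_enum.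
rewrite (perm_big _ (big_conjugates rsE cE)) big_flatten /= big_nseq.
by elim: r {cE} => [|r IH] //=; rewrite IH exprS.
Qed.

End Conjugates.

(* [theta p m a] has negative valuation exactly where [a] does, and is a unit at
   the other places over [p] for a suitable [m]; its norm then computes the
   finite part of the height of [a]. *)
Definition theta (K : fieldType) (p m : nat) (a : K) : K :=
  1 + a ^+ m + (if p == 2%N then (a ^+ m) ^+ 2 else 0).

(** The degree of [theta] as a polynomial in a^m. *)
Definition thetad (p : nat) : nat := if p == 2%N then 2 else 1.

Lemma theta_morph (K K' : fieldType) (f : {rmorphism K -> K'}) p m a :
  f (theta p m a) = theta p m (f a).
Proof.
by rewrite /theta !rmorphD rmorph1 rmorphXn; case: ifP => _; rewrite ?rmorphXn ?rmorph0.
Qed.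

Section FinitePart.
Variables (L : fieldExtType rat) (p : nat) (p_pr : prime p) (a : L) (a0 : a != 0).
Variables (N : nat) (nN : (\dim {:L} <= N)%N).
Let m := (p ^ N)`!.

(** A pole of a makes the top power of a^m dominate, and a zero of a leaves 1. If v a = 0, then a^m
    is congruent to 1, so 1 + a^m is congruent to 2, a unit for odd p; for p = 2 the square turns
    this into the unit 3. *)
Lemma theta_val v : place_over p v ->
  theta p m a != 0 /\ v (theta p m a) = Num.min 0 (v a) * (thetad p * m)%N%:Z.
Proof.
move=> vp; have [vP vp0] := vp; have m0 : (0 < m)%N by rewrite fact_gt0.
have am0 : a ^+ m != 0 by rewrite expf_neq0.
have two : ~~ (p %| (if p == 2%N then 3 else 2)%N%:Z)%Z.
  rewrite dvdzE /=; case: eqVneq => [->//|p2].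
  by rewrite dvdn_prime2.
have [va|va|va] := ltgtP (v a) 0.
- have vam : v (a ^+ m) < 0 by rewrite valX //; nia.
  have [h0 h] := val_add1_lt0 vP am0 vam.
  rewrite /theta /thetad; case: ifP => _; last first.
    by rewrite addr0 h0 h valX // mul1n.
  rewrite addrC; have := @vge_lt _ _ vP (v (a ^+ m)) ((a ^+ m) ^+ 2) (1 + a ^+ m).
  rewrite expf_neq0 // vge_neq0 // h lexx [v ((a ^+ m) ^+ 2)]valX //.
  move=> /(_ isT _ isT) [|-> ->]; first by lia.
  by split=> //; rewrite valX //; lia.
- have vam : vge v 1 (a ^+ m) by rewrite vge_neq0 // valX //; nia.
  rewrite mul0r /theta -addrA; apply: val_add1_gt0 => //.
  apply: vgeD => //; case: ifP => _; last exact: vge0r.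
  by apply: (vge_le (k := 1 * 2%:Z)) => //; apply: vgeX.
- rewrite ?va ?minxx mul0r.
  have am1 := residue_order_fact p_pr vp a0 va nN; rewrite -/m in am1.
  pose c : L := (if p == 2%N then 3 else 2)%N%:R.
  have c0 : c != 0 by rewrite natrL_eq0; case: ifP.
  have vc : v c = 0 by exact: (v_int_coprime vP p_pr vp0 two).
  have -> : theta p m a = c + (theta p m a - c) by rewrite addrC subrK.
  rewrite -vc; apply: (vge_lt vP (k := 1)) => //; first by rewrite vc.
  have vA : vge v 0 (a ^+ m) by rewrite vge_neq0 // valX // va mul0r.
  rewrite /theta /c; case: ifP => _.
    have -> : 1 + a ^+ m + (a ^+ m) ^+ 2 - 3%:R = (a ^+ m - 1) * (a ^+ m + 2%:R).
      by ring.
    rewrite -(addr0 (1 : int)); apply: vgeM => //; apply: vgeD => //; exact: vge_nat.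
  by have -> : 1 + a ^+ m + 0 - 2%:R = a ^+ m - 1 by ring.
Qed.

Lemma finite_part_nrm : theta p m a != 0 /\
  ordq p (nrm (theta p m a)) =
  \sum_(v <- plist L p) Num.min 0 (v a) * (rdeg p v)%:Z * (thetad p * m)%N%:Z.
Proof.
have full := sum_local_degrees p_pr (plist_uniq L p) (fun v => plistP v p_pr).
(* Some place lies over p because the local degrees add up to [L : Q] > 0; it shows that
   [theta p m a] is not 0. *)
have [v vp] : exists v, v \in plist L p.
  case: (plist L p) full => [|v s]; last by exists v; rewrite mem_head.
  by rewrite big_nil => /esym/eqP; rewrite eqz_nat gtn_eqF // adim_gt0.
have t0 : theta p m a != 0 by have [] := theta_val ((plistP _ p_pr).1 vp).
split=> //; rewrite (ordq_nrm p_pr (plist_uniq L p) (fun v => plistP v p_pr)) //.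
rewrite big_seq [RHS]big_seq; apply: eq_bigr => w /(plistP _ p_pr)/theta_val[_ ->].
by rewrite mulrAC.
Qed.

End FinitePart.

Section Invariance.
Variable R : realType.

Lemma lnp_finite_abs (L : fieldExtType rat) p v (a : L) : prime p -> place_over p v -> a != 0 ->
  lnp (finite_abs R v a) = - (Num.min 0 (v a) * (rdeg p v)%:Z)%:~R * ln p%:R.
Proof.
move=> p_pr vp a0; have fP := finite_absP R p_pr vp.
rewrite lnpE ?(abs_gt0 fP) // (ln_finite_abs _ p_pr vp) //.
have lp : 0 <= ln p%:R :> R by rewrite ln_ge0 // ler1n prime_gt0.
have [va|va] := leP 0 (v a).
  rewrite mul0r oppr0 mul0r max_l // mulNr oppr_le0 mulr_ge0 // ler0z; nia.
by rewrite max_r // mulNr oppr_ge0 mulr_le0_ge0 // lerz0; nia.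
Qed.

Lemma field_height0 (L : fieldExtType rat) : field_height R (0 : L) = 0.
Proof.
have [B hB] := field_heightE R (0 : L); rewrite (hB B) // /hgt.
have -> : gsum B (fun N : L -> R => lnp (N 0)) = gsum B (fun _ : L -> R => 0).
  by apply: eq_gsum => N c NP; rewrite (abs0 NP) /lnp max_l // ln1.
by rewrite /gsum !big1 ?addr0 ?mulr0.
Qed.

(** The characteristic polynomials of a and a' are powers mu^r and mu^r' of one minimal polynomial.
    The archimedean terms, and the factors of the norm of [theta], are therefore repeated r and r'
    times, in proportion to the degrees r deg(mu) and r' deg(mu). *)
Lemma field_height_eq (L L' : fieldExtType rat) (iota : {rmorphism L -> algC})
    (iota' : {rmorphism L' -> algC}) (a : L) (a' : L') :
  iota a = iota' a' -> field_height R a = field_height R a'.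
Proof.
move=> aa'; have [a0|a0] := eqVneq a 0.
  have a'0 : a' = 0 by apply/eqP; rewrite -(fmorph_eq0 iota') -aa' a0 rmorph0.
  by rewrite a0 a'0 !field_height0.
have a'0 : a' != 0 by rewrite -(fmorph_eq0 iota') -aa' fmorph_eq0.
have [mu [_ mu_monic mu_min]] := minCpolyP (iota a).
have mu_min' : forall q, root (map_poly ratr q) (iota' a') = (mu %| q) by rewrite -aa'.
have [r cE nE] := char_poly_power mu_monic mu_min.
have [r' cE' nE'] := char_poly_power mu_monic mu_min'.
set n := \dim {:L} in nE; set n' := \dim {:L'} in nE'.
have n0 : (0 < n)%N by exact: adim_gt0.
have n'0 : (0 < n')%N by exact: adim_gt0.
have sum_eq (V W : R) : V *+ r' = W *+ r -> n%:R^-1 * V = n'%:R^-1 * W.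
  rewrite -[V *+ r']mulr_natl -[W *+ r]mulr_natl => e.
  have : (0 < r * (size mu).-1)%N by rewrite -nE.
  have : (0 < r' * (size mu).-1)%N by rewrite -nE'.
  rewrite !muln_gt0 => /andP[r'0 d0] /andP[r0 _].
  have R0 : (r%:R : R) != 0 by rewrite pnatr_eq0 -lt0n.
  have R'0 : (r'%:R : R) != 0 by rewrite pnatr_eq0 -lt0n.
  have D0 : ((size mu).-1%:R : R) != 0 by rewrite pnatr_eq0 -lt0n.
  rewrite nE nE' !natrM; apply: (mulfI R0); apply: (mulfI R'0).
  transitivity ((size mu).-1%:R^-1 * (r'%:R * V)); first by field; apply/andP.
  rewrite e; by field; apply/andP.
have [B hB] := field_heightE R a; have [B' hB'] := field_heightE R a'.
rewrite (hB (maxn B B')) ?leq_maxl // (hB' (maxn B B')) ?leq_maxr //.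
rewrite -/n -/n'; apply: sum_eq; rewrite /hgt /gsum !mulrnDl; congr (_ + _).
  have [rs rsE] := closed_field_poly_normal (map_poly (ratr : rat -> R[i]) mu).
  rewrite lead_coef_map (monicP mu_monic) rmorph1 scale1r in rsE.
  pose g (z : R[i]) : R := lnp (complex.Re `|z|).
  have -> : \sum_k lnp (arch R k a) = \sum_k g (emb R[i] k a) by [].
  have -> : \sum_k lnp (arch R k a') = \sum_k g (emb R[i] k a') by [].
  rewrite (sum_conjugates g rsE cE) (sum_conjugates g rsE cE').
  by rewrite -!mulrnA mulnC.
rewrite !places_upto_sum -!sumrMnl; apply: eq_bigr => p p_pr.
(* A common exponent m, so that the same polynomial [theta] is used in both fields. *)
pose N := maxn n n'; pose m := (p ^ N)`!.
have [t0 tE] := finite_part_nrm p_pr a0 (leq_maxl n n').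
have [t'0 t'E] := finite_part_nrm p_pr a'0 (leq_maxr n n').
have nrm_eq : nrm (theta p m a) ^+ r' = nrm (theta p m a') ^+ r.
  have [rs rsE] := closed_field_poly_normal (map_poly (ratr : rat -> algC) mu).
  rewrite lead_coef_map (monicP mu_monic) rmorph1 scale1r in rsE.
  apply: (@fmorph_inj _ _ (ratr : {rmorphism rat -> algC})); rewrite !rmorphXn /=.
  rewrite !(@nrmE algC).
  under eq_bigr do rewrite theta_morph.
  under [in RHS]eq_bigr do rewrite theta_morph.
  rewrite (prod_conjugates (theta p m) rsE cE) (prod_conjugates (theta p m) rsE cE').
  by rewrite -!exprM mulnC.
have := congr1 (ordq p) nrm_eq; rewrite !ordqX ?nrm_neq0 // tE t'E -!mulr_suml.
set S := \sum_(v <- _) _; set S' := \sum_(v <- _) _ => e.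
have eS : S * r' = S' * r.
  have D0 : (thetad p * m)%N%:Z != 0.
    by rewrite eqz_nat muln_eq0 negb_or -!lt0n fact_gt0 andbT /thetad; case: ifP.
  by apply: (mulIf D0); rewrite mulrAC e mulrAC.
have fin (M : fieldExtType rat) (b : M) : b != 0 -> \sum_(v <- plist M p) lnp (finite_abs R v b) =
    - (\sum_(v <- plist M p) Num.min 0 (v b) * (rdeg p v)%:Z)%:~R * ln p%:R.
  move=> b0; rewrite rmorph_sum -sumrN mulr_suml big_seq [RHS]big_seq.
  by apply: eq_bigr => v /(plistP _ p_pr) vp; rewrite (lnp_finite_abs p_pr vp b0).
rewrite [X in X *+ _ = _](fin L a a0 : _ = - S%:~R * ln p%:R).
rewrite [X in _ = X *+ _](fin L' a' a'0 : _ = - S'%:~R * ln p%:R).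
have {}eS : S%:~R * r'%:R = S'%:~R * r%:R :> R by have := congr1 (fun x : int => x%:~R : R) eS; rewrite !intrM.
move: (S%:~R : R) (S'%:~R : R) eS => x y xy.
by rewrite -(mulr_natr (- x * _) r') -(mulr_natr (- y * _) r) mulrAC [RHS]mulrAC !mulNr xy.
Qed.

Lemma heightE (L : fieldExtType rat) (iota : {rmorphism L -> algC}) (a : L) :
  height R (iota a) = field_height R a.
Proof.
rewrite /height; case: num_field_proj => f /= f0 fK.
have [s1 es _] := projT2 (projT2 (num_field_exists [:: iota a])).
case: s1 es => [|a' [|? ?]] //= [ea].
have fa : f (iota a) = a' := etrans (congr1 f (esym ea)) (fK a').
rewrite fa.
by apply: (@field_height_eq _ _ (numfield_emb [:: iota a]) iota).
Qed.

End Invariance.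

(** * Heights and a multiplicative relation *)

Lemma eventually_forall (I : finType) (P : I -> nat -> Prop) :
  (forall i, exists B0, forall B, (B0 <= B)%N -> P i B) ->
  exists B0, forall B, (B0 <= B)%N -> forall i, P i B.
Proof.
move=> /choice[b hb]; exists (\max_i b i)%N => B bB i; apply: hb.
exact: leq_trans (leq_bigmax i) bB.
Qed.

Section HeightLaws.
Variables (R : realType) (L : fieldExtType rat) (B : nat).
Implicit Types a b : L.
Let n := \dim {:L}.
Local Notation h := (@hgt R L B).

Lemma hgt_ge0 a : 0 <= h a.
Proof. by rewrite /hgt /gsum addr_ge0 // sumr_ge0 // => *; exact: lnp_ge0. Qed.

Lemma hgtM a b : h (a * b) <= h a + h b.
Proof.
rewrite /hgt -gsumD.
have := @gsum_le R L B 0 (fun N => lnp (N (a * b))) (fun N => lnp (N a) + lnp (N b)).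
rewrite mul0r mulr0 add0r; apply => N c NP; rewrite mul0r add0r; exact: lnp_absM NP _ _.
Qed.

Lemma hgtD a b : h (a + b) <= n%:R * ln 2 + h a + h b.
Proof.
rewrite /hgt -addrA -gsumD.
have := @gsum_le R L B 1 (fun N => lnp (N (a + b))) (fun N => lnp (N a) + lnp (N b)).
rewrite mul1r; apply => N c NP; rewrite mul1r addrA; exact: lnp_absD NP _ _.
Qed.

Lemma hgtN a : h (- a) = h a.
Proof. by apply: eq_gsum => N c NP; rewrite (absN NP). Qed.

Lemma hgt1 : h 1 = 0.
Proof.
rewrite /hgt; have -> : gsum B (fun N : L -> R => lnp (N 1)) = gsum B (fun _ : L -> R => 0).
  by apply: eq_gsum => N c NP; rewrite (abs1 NP) /lnp maxxx ln1.
by rewrite /gsum !big1 ?addr0.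
Qed.

Lemma hgtV a : a != 0 -> gsum B (fun N : L -> R => ln (N a)) = 0 -> h a^-1 = h a.
Proof.
move=> a0 pf; rewrite -[LHS]addr0 -pf /hgt -gsumD.
by apply: eq_gsum => N c NP; rewrite (lnp_absV NP) // subrK.
Qed.

(** Since x = xi_i0 (1 - z), it remains to bound h(z) = h(1/z). With D = [L : Q], each j costs D log
    2 + h(c_j) + h(1 - c_j) + h(1/(1 - c_j)); then h(1 - c_j) <= D log 2 + h(c_j) and h(c_j) <=
    h(xi_i0) + h(xi_j) produce the factors 3. *)
Lemma hgt_relation (I : finType) (i0 : I) (e : I -> int) (x : L) (xi : I -> L) :
  let s i := 1 - x / xi i in
  e i0 != 0 -> (forall i, `|e i| <= `|e i0|) -> injective xi ->
  (forall i, xi i != 0) -> (forall i, s i != 0) -> \prod_i s i ^ e i = 1 ->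
  (forall i, gsum B (fun N : L -> R => ln (N (xi i))) = 0) ->
  (forall i, gsum B (fun N : L -> R => ln (N (s i))) = 0) ->
  (forall j, j != i0 -> gsum B (fun N : L -> R => ln (N (1 - xi i0 / xi j))) = 0) ->
  h x <= h (xi i0) + n%:R * ln 2 +
    \sum_(j | j != i0) (3 * (n%:R * ln 2) + 3 * h (xi i0) + 3 * h (xi j)).
Proof.
move=> s e0 emax xi_inj xi0 s0 rel pf_xi pf_s pf_c.
pose cc j := xi i0 / xi j.
have cc1 j : j != i0 -> 1 - cc j != 0.
  move=> ji; rewrite subr_eq0 eq_sym; apply: contra ji => /eqP e1.
  by apply/eqP/xi_inj; rewrite -[LHS]mul1r -e1 /cc divfK.
have hs j : j != i0 -> [/\ cc j != 0, 1 - cc j != 0 & s j = (1 - cc j) + cc j * s i0].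
  move=> ji; split; [by rewrite mulf_neq0 ?invr_eq0|exact: cc1|].
  by rewrite /s /cc; field; rewrite !xi0.
have xE : x = xi i0 * (1 - s i0) by rewrite /s; field; exact: xi0.
have -> : h x = h (xi i0 * (1 - s i0)) by rewrite -xE.
apply: le_trans (hgtM _ _) _; rewrite -[leRHS]addrA lerD2l.
apply: le_trans (hgtD _ _) _; rewrite hgt1 addr0 hgtN lerD2l -hgtV //.
pose m : R := #|[pred j | j != i0]|%:R.
pose G j (N : L -> R) := lnp (N (cc j)) + lnp (N (1 - cc j)) + lnp (N (1 - cc j)^-1).
have main : h (s i0)^-1 <= n%:R * (m * ln 2) + gsum B (fun N => \sum_(j | j != i0) G j N).
  apply: gsum_le => N c NP.
  apply: le_trans (lnp_relation NP e0 emax s0 rel hs) _.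
  rewrite /m mulr_natl -sumr_const -big_split /=.
  by apply: ler_sum => j _; rewrite /G !addrA.
apply: le_trans main _; rewrite gsum_sum.
have -> : n%:R * (m * ln 2) = \sum_(j | j != i0) (n%:R * ln 2) :> R.
  by rewrite sumr_const /m -[RHS]mulr_natl mulrCA.
rewrite -big_split /=; apply: ler_sum => j ji.
have -> : gsum B (G j) = h (cc j) + h (1 - cc j) + h (1 - cc j)^-1 by rewrite !gsumD.
rewrite (hgtV (cc1 _ ji)) //; last exact: pf_c.
have h1 : h (1 - cc j) <= n%:R * ln 2 + h (cc j).
  by apply: le_trans (hgtD _ _) _; rewrite hgt1 addr0 hgtN.
have h2 : h (cc j) <= h (xi i0) + h (xi j).
  by apply: le_trans (hgtM _ _) _; rewrite hgtV.
lra.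
Qed.

End HeightLaws.

Lemma height_ge0 (R : realType) (x : algC) : 0 <= height R x.
Proof.
rewrite /height; have [B hB] := field_heightE R (sval (num_field_proj (numfield_emb [:: x])) x).
by rewrite (hB B) // mulr_ge0 ?invr_ge0 ?ler0n // hgt_ge0.
Qed.

(** Summing over the n - 1 indices j gives (3n - 2)(h(xi_i0) + log 2) plus 3 times the other
    heights, and 3 <= 3n - 2 because n >= 2. *)
Theorem height_multiplicative_relation (R : realType) (n : nat) (x : algC)
    (xi : 'I_n -> algC) (e : 'I_n -> int) :
  (2 <= n)%N -> injective xi -> (forall i, xi i != 0) -> (forall i, 1 - x / xi i != 0) ->
  (exists i, e i != 0) -> \prod_i (1 - x / xi i) ^ e i = 1 ->
  height R x <= (3 * n%:R - 2) * (\sum_i height R (xi i) + ln 2).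
Proof.
move=> n2 xi_inj xi0 s0 [i1 ei1] rel.
have [i0 _ emax] := @arg_maxnP _ i1 xpredT (fun i => `|e i|%N) isT.
have e0 : e i0 != 0.
  by rewrite -absz_gt0 (leq_trans _ (emax i1 isT)) // absz_gt0.
have {}emax i : `|e i| <= `|e i0| by have := emax i isT; lia.
have [M [iota [s1 es _]]] := num_field_exists (x :: [seq xi i | i <- enum 'I_n]).
case: s1 es => [|xM s1] //= [xME sE].
have ss : size s1 = n.
  have := congr1 size sE; rewrite size_map => ->.
  by rewrite size_map size_enum_ord.
pose xiM (i : 'I_n) := s1`_i.
have xiME i : iota (xiM i) = xi i.
  have := congr1 (fun s => s`_i) sE; rewrite (nth_map 0) ?ss //.
  by rewrite (nth_map i0) ?size_enum_ord // nth_ord_enum.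
have sM i : iota (1 - xM / xiM i) = 1 - x / xi i.
  by rewrite rmorphB rmorph1 fmorph_div xME xiME.
have xiM_inj : injective xiM by move=> i j ij; apply: xi_inj; rewrite -!xiME ij.
have xiM0 i : xiM i != 0 by rewrite -(fmorph_eq0 iota) xiME.
have sM0 i : 1 - xM / xiM i != 0 by rewrite -(fmorph_eq0 iota) sM.
have relM : \prod_i (1 - xM / xiM i) ^ e i = 1.
  apply: (fmorph_inj iota); rewrite rmorph1 rmorph_prod -[RHS]rel.
  by apply: eq_bigr => i _; rewrite fmorphXz sM.
have cM0 j : j != i0 -> 1 - xiM i0 / xiM j != 0.
  move=> ji; rewrite subr_eq0 eq_sym; apply: contra ji => /eqP e1.
  by apply/eqP/xiM_inj; rewrite -[LHS]mul1r -e1 divfK.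
have [B1 hB1] := eventually_forall (fun i => product_formula R (xiM0 i)).
have [B2 hB2] := eventually_forall (fun i => product_formula R (sM0 i)).
have [B3 hB3] : exists B0, forall B, (B0 <= B)%N -> forall j, j != i0 ->
    gsum B (fun N : M -> R => ln (N (1 - xiM i0 / xiM j))) = 0.
  apply: (eventually_forall (P := fun j B => j != i0 ->
    gsum B (fun N : M -> R => ln (N (1 - xiM i0 / xiM j))) = 0)) => j.
  have [->|ji] := eqVneq j i0; first by exists 0%N.
  by have [B hB] := product_formula R (cM0 j ji); exists B => B' /hB.
have [B4 hB4] := field_heightE R xM.
have [B5 hB5] := eventually_forall (fun i => field_heightE R (xiM i)).
pose B := (B1 + B2 + B3 + B4 + B5)%N.
have main := @hgt_relation R M B _ i0 e xM xiM e0 emax xiM_inj xiM0 sM0 relM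
  (hB1 B _) (hB2 B _) (hB3 B _).
have {}main := main ltac:(rewrite /B; lia) ltac:(rewrite /B; lia) ltac:(rewrite /B; lia).
set D : R := (\dim {:M})%:R in main.
have D0 : 0 < D by rewrite ltr0n adim_gt0.
have hx : hgt R B xM = D * height R x.
  by rewrite -xME heightE (hB4 B) ?mulVKf ?gt_eqF // /B; lia.
have hxi i : hgt R B (xiM i) = D * height R (xi i).
  by rewrite -xiME heightE (hB5 B) ?mulVKf ?gt_eqF // /B; lia.
move: main; rewrite hx hxi.
rewrite [X in _ <= _ + X](eq_bigr (fun j =>
  3 * (D * ln 2) + 3 * (D * height R (xi i0)) + 3 * (D * height R (xi j)))); last first.
  by move=> j _; rewrite hxi.
set l2 : R := ln 2; pose H0 := height R (xi i0).
pose H1 := \sum_(j < n | j != i0) height R (xi j).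
have l2_ge0 : 0 <= l2 by rewrite ln_ge0 // ler1n.
have -> : \sum_(j | j != i0) (3 * (D * l2) + 3 * (D * height R (xi i0)) + 3 * (D * height R (xi j)))
   = D * ((n%:R - 1) * (3 * l2 + 3 * H0) + 3 * H1).
  rewrite !big_split /= !sumr_const -!mulr_sumr -/H1 -/H0.
  have -> : #|[pred j | j != i0]| = n.-1 by have := cardC1 i0; rewrite card_ord.
  rewrite -[_ *+ n.-1]mulr_natl -[X in _ + X + _]mulr_natl -subn1 natrB; last by lia.
  ring.
have -> : \sum_i height R (xi i) = H0 + H1 by rewrite (bigD1 i0).
have H0_ge0 : 0 <= H0 by exact: height_ge0.
have H1_ge0 : 0 <= H1 by apply: sumr_ge0 => j _; exact: height_ge0.
have n2R : 2 <= n%:R :> R by rewrite ler_nat.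
rewrite -/H0 -!mulrDr ler_pM2l // => /le_trans; apply.
nra.
Qed.

(** * Subgroups of the torus *)

(* Dedekind's independence of characters. *)
Lemma characters_dependent (F : fieldType) (T : Type) (X : set T) (op : T -> T -> T) (one : T)
    (I : eqType) (S : seq I) (chi : I -> T -> F) (c : I -> F) :
  X one -> (forall s t, X s -> X t -> X (op s t)) ->
  (forall i, chi i one = 1) -> (forall i s t, chi i (op s t) = chi i s * chi i t) ->
  uniq S -> (forall t, X t -> \sum_(i <- S) c i * chi i t = 0) ->
  (exists2 i, i \in S & c i != 0) ->
  exists i j, i != j /\ forall t, X t -> chi i t = chi j t.
Proof.
move=> X1 XM chi1 chiM; elim: S c => [|i S IH] c; first by move=> _ _ [].
move=> /= /andP[iS uS] hc [j0 j0S cj0].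
have [ci|ci] := eqVneq (c i) 0.
  apply: (IH c) => //.
    by move=> t Xt; have := hc t Xt; rewrite big_cons ci mul0r add0r.
  exists j0 => //; move: j0S; rewrite inE => /orP[/eqP e|//].
  by rewrite e ci eqxx in cj0.
have [[j jS cj]|H] := pselect (exists2 j, j \in S & c j != 0); last first.
  have := hc _ X1; rewrite big_cons chi1 mulr1 big_seq big1 ?addr0 => [/eqP|j jS].
    by rewrite (negPf ci).
  have [->|cj] := eqVneq (c j) 0; first by rewrite mul0r.
  by case: H; exists j.
have [[s Xs ne]|H] := pselect (exists2 s, X s & chi j s != chi i s); last first.
  exists i, j; split=> [|t Xt]; first by apply: contraNneq iS => ->.
  by apply/eqP; apply: contraT => e; case: H; exists t; rewrite // eq_sym.
(* Subtracting chi_i(s) times the relation at t from the relation at s t removes the term i and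
   keeps the term j. *)
apply: (IH (fun k => c k * (chi k s - chi i s))) => //.
  move=> t Xt; have := hc _ (XM _ _ Xs Xt); have := hc _ Xt.
  rewrite !big_cons => e1 e2.
  transitivity (c i * chi i (op s t) + \sum_(k <- S) c k * chi k (op s t)
     - chi i s * (c i * chi i t + \sum_(k <- S) c k * chi k t)); last by rewrite e1 e2 mulr0 subr0.
  rewrite mulrDr mulr_sumr chiM opprD addrACA.
  have -> : c i * (chi i s * chi i t) - chi i s * (c i * chi i t) = 0 by ring.
  rewrite add0r -sumrB; apply: eq_bigr => k _; rewrite chiM; ring.
by exists j; rewrite // mulf_neq0 // subr_eq0.
Qed.

Lemma poly_nonroot (F : numFieldType) (p : {poly F}) : p != 0 -> exists u, p.[u] != 0.
Proof.
move=> p0; apply: contrapT => H.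
pose rs := [seq (k%:R : F) | k <- iota 0 (size p)].
have : (size rs < size p)%N.
  apply: max_poly_roots => //.
    apply/allP => u _; apply/rootP/eqP; apply: contraT => pu; case: H; by exists u.
  by rewrite map_inj_uniq ?iota_uniq // => a b /eqP; rewrite eqr_nat => /eqP.
by rewrite size_map size_iota ltnn.
Qed.

Section Geometry.
Variable n : nat.
Implicit Types (s t : 'I_n -> algC) (X Z : set ('I_n -> algC)) (P : mpoly.mpoly n algC).

Let Xi (i : 'I_n) : mpoly.mpoly n algC := mpoly.mpolyX algC (mpoly.mnm1 i).

Lemma closure_sub Z : Z `<=` zariski_closure Z.
Proof. by move=> s Zs P; apply. Qed.

(** The restriction of P to the line through s (parameter 0) and t (parameter 1). *)
Definition line_poly P s t : {poly algC} :=
  \sum_(m <- mpoly.msupp P) (mpoly.mcoeff m P)%:P *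
    \prod_(i < n) ((s i)%:P + 'X * (t i - s i)%:P) ^+ mpoly.fun_of_multinom m i.

Lemma line_polyE P s t u :
  (line_poly P s t).[u] = mpoly.meval (fun i => s i + u * (t i - s i)) P.
Proof.
rewrite mpoly.mevalE /line_poly horner_sum; apply: eq_bigr => m _.
rewrite hornerM hornerC horner_prod; congr (_ * _); apply: eq_bigr => i _.
by rewrite horner_exp hornerD hornerM hornerX !hornerC.
Qed.

Lemma line_poly0 P s t : (line_poly P s t).[0] = mpoly.meval s P.
Proof. by rewrite line_polyE; congr (mpoly.meval _ _); apply/funext => i; rewrite mul0r addr0. Qed.

Lemma line_poly1 P s t : (line_poly P s t).[1] = mpoly.meval t P.
Proof. by rewrite line_polyE; congr (mpoly.meval _ _); apply/funext => i; rewrite mul1r addrC subrK. Qed.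

(** If s is outside A and t outside B, equations of A and B that are nonzero at s and t, together
    with the coordinates, restrict to nonzero polynomials on the line through s and t. A common
    nonroot is a point of Z outside both A and B. *)
Lemma irreducible_convex Z : Z !=set0 -> Z `<=` Gm n ->
  (forall s t u, Z s -> Z t -> Gm n (fun i => s i + u * (t i - s i)) ->
     Z (fun i => s i + u * (t i - s i))) ->
  zariski_irreducible Z.
Proof.
move=> Z0 ZG Zline; split=> // A B cA cB ZAB.
have [ZA|nA] := pselect (Z `<=` A); [by left|right] => t Zt; apply: contrapT => nBt.
apply: nA => s Zs; apply: contrapT => nAs.
have sep (W : set ('I_n -> algC)) w : zariski_closed_in setT W -> ~ W w ->
    exists2 P, forall z, W z -> mpoly.meval z P = 0 & mpoly.meval w P != 0.
  move=> cW nW; apply: contrapT => H; apply: nW; rewrite cW; split=> // P hP.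
  by apply/eqP; apply: contraT => Pw; case: H; exists P.
have [P hP Ps] := sep _ _ cA nAs; have [Q hQ Qt] := sep _ _ cB nBt.
pose lin i : {poly algC} := (s i)%:P + 'X * (t i - s i)%:P.
have linE i u : (lin i).[u] = s i + u * (t i - s i).
  by rewrite hornerD hornerM hornerX !hornerC.
have : line_poly P s t * line_poly Q s t * \prod_i lin i != 0.
  rewrite !mulf_neq0 //.
  - by apply: contraNneq Ps => e; rewrite -(line_poly0 P s t) e horner0.
  - by apply: contraNneq Qt => e; rewrite -(line_poly1 Q s t) e horner0.
  - apply/prodf_neq0 => i _; apply: contraNneq (ZG _ Zs i) => e.
    by have := linE i 0; rewrite e horner0 mul0r addr0 => <-.
case/poly_nonroot => u; rewrite !hornerM horner_prod !mulf_eq0 !negb_or => /andP[/andP[Pu Qu] /prodf_neq0 lu].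
have Zu : Z (fun i => s i + u * (t i - s i)).
  by apply: Zline => // i; rewrite -linE; apply: lu.
case: (ZAB _ Zu) => [/hP e|/hQ e]; first by rewrite line_polyE e eqxx in Pu.
by rewrite line_polyE e eqxx in Qu.
Qed.

(** The subtorus of the first k coordinates; for k = 0, ..., n these form a chain of length n, so
    the whole torus has dimension at least n. *)
Definition coord_torus (k : nat) : set ('I_n -> algC) :=
  [set s | Gm n s /\ forall j : 'I_n, (k <= j)%N -> s j = 1].

Lemma Gm_codim : ~ codim_ge 2 (Gm n).
Proof.
move=> h; have := h n coord_torus; suff hc : irreducible_chain (Gm n) n coord_torus.
  by move=> /(_ hc); lia.
have one k : coord_torus k (fun=> 1) by split=> // i; rewrite oner_eq0.
split=> [k kn|k kn]; first split.
- apply/seteqP; split=> [s Zs|s [Gs cs]]; first by split; [case: Zs|exact: closure_sub].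
  split=> // j kj; apply/eqP; rewrite -subr_eq0.
  have := cs (Xi j - 1); rewrite mpoly.mevalB mpoly.mevalXU mpoly.meval1 => -> // t [_ /(_ j kj)].
  by rewrite mpoly.mevalB mpoly.mevalXU mpoly.meval1 => ->; rewrite subrr.
- apply: irreducible_convex; [by exists (fun=> 1)|by move=> s []|].
  move=> s t u [_ s1] [_ t1] G; split=> // j kj.
  by rewrite s1 // t1 // subrr mulr0 addr0.
- split=> [s [Gs s1]|].
    by split=> // j kj; apply: s1; apply: ltnW.
  pose s0 (i : 'I_n) : algC := if i == Ordinal kn then 2 else 1.
  move=> /(_ s0)[|_ /(_ (Ordinal kn) (leqnn _))].
    split=> [i|j kj]; first by rewrite /s0; case: ifP => _; rewrite ?oner_eq0 // pnatr_eq0.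
    by rewrite /s0; case: eqP => // e; move: kj; rewrite e ltnn.
  by rewrite /s0 eqxx => /eqP; rewrite -[1]/(1%:R) eqr_nat.
Qed.

(** X is not the whole torus, so a nonzero polynomial vanishes on it. Its monomials restrict to
    linearly dependent characters of X, hence two of them coincide, and e is the difference of their
    exponents. *)
Lemma subgroup_relation X : algebraic_subgroup X -> codim_ge 2 X ->
  exists2 e : 'I_n -> int, (exists i, e i != 0) & forall s, X s -> \prod_i s i ^ e i = 1.
Proof.
move=> [cX X1 XM XV] cod.
have XG : X `<=` Gm n by move=> s; rewrite cX => -[].
have [P P0 hP] : exists2 P, P != 0 & forall s, X s -> mpoly.meval s P = 0.
  apply: contrapT => H; apply: Gm_codim; suff <- : X = Gm n by [].
  apply/seteqP; split=> // s Gs; rewrite cX; split=> // P hP.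
  have [->|P0] := eqVneq P 0; first by rewrite mpoly.meval0.
  by case: H; exists P.
pose chi (m : mpoly.multinom n) s : algC := \prod_(i < n) s i ^+ mpoly.fun_of_multinom m i.
have [m [m' [mm' hm]]] : exists m m', m != m' /\ forall s, X s -> chi m s = chi m' s.
  apply: (@characters_dependent algC _ X (fun s t i => s i * t i) (fun=> 1) _
    (mpoly.msupp P) chi (fun m => mpoly.mcoeff m P)) => //.
  - by move=> m; rewrite /chi big1 // => i _; rewrite expr1n.
  - by move=> m s t; rewrite /chi -big_split /=; apply: eq_bigr => i _; rewrite exprMn.
  - have : mpoly.msupp P != [::] by rewrite mpoly.msupp_eq0.
    case E : (mpoly.msupp P) => [//|m ms] _; exists m; rewrite ?mem_head //.
    by rewrite -mpoly.mcoeff_msupp E mem_head.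
exists (fun i => (mpoly.fun_of_multinom m i)%:Z - (mpoly.fun_of_multinom m' i)%:Z).
  apply: contrapT => H; move/negP: mm'; apply; apply/eqP/mpoly.mnmP => i.
  by apply/eqP; apply: contraT => ne; case: H; exists i; move: ne; lia.
move=> s Xs; have Gs := XG _ Xs.
have e := hm _ Xs; have m'0 : chi m' s != 0 by apply/prodf_neq0 => i _; rewrite expf_neq0 // Gs.
transitivity (chi m s / chi m' s); last by rewrite e divff.
rewrite /chi -prodf_div; apply: eq_bigr => i _.
by rewrite expfzDr ?Gs // -invr_expz -!exprnP.
Qed.

(** Applied to coordinates and the constant 1, for the subgroups s_i = 1 and s_i = s_j. *)
Lemma equation_subgroup (F G : mpoly.mpoly n algC) :
  (forall s t, mpoly.meval (fun i => s i * t i) F = mpoly.meval s F * mpoly.meval t F) ->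
  (forall s t, mpoly.meval (fun i => s i * t i) G = mpoly.meval s G * mpoly.meval t G) ->
  mpoly.meval (fun=> 1) F = 1 -> mpoly.meval (fun=> 1) G = 1 ->
  algebraic_subgroup [set s | Gm n s /\ mpoly.meval s F = mpoly.meval s G].
Proof.
move=> FM GM F1 G1; split=> /=.
- apply/seteqP; split=> [s Zs|s [Gs cs]]; first by split; [case: Zs|exact: closure_sub].
  split=> //; apply/eqP; rewrite -subr_eq0.
  by have := cs (F - G); rewrite mpoly.mevalB => -> // t [_]; rewrite mpoly.mevalB => ->; rewrite subrr.
- by split=> [i|]; rewrite ?oner_eq0 // F1 G1.
- move=> s t [Gs es] [Gt et]; split=> [i|]; first by rewrite mulf_neq0.
  by rewrite FM GM es et.
- move=> s [Gs es]; split=> [i|]; first by rewrite invr_eq0.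
  have VV (H : mpoly.mpoly n algC) : (forall s t, mpoly.meval (fun i => s i * t i) H
        = mpoly.meval s H * mpoly.meval t H) -> mpoly.meval (fun=> 1) H = 1 ->
      mpoly.meval s H * mpoly.meval (fun i => (s i)^-1) H = 1.
    move=> HM H1; rewrite -HM -[RHS]H1; congr (mpoly.meval _ _).
    by apply/funext => i; rewrite divff // Gs.
  have Fs : mpoly.meval s F != 0.
    by apply/eqP => e; have /eqP := VV F FM F1; rewrite e mul0r eq_sym oner_eq0.
  by apply: (mulfI Fs); rewrite (VV F) // {1}es (VV G).
Qed.

End Geometry.

(** * The line and the final estimates *)

Section LineCoordinates.
Variables (n : nat) (K : fieldExtType rat) (iota : {rmorphism K -> algC}).
Variables (X : set ('I_n -> algC)) (x : ('I_n -> algC) -> algC).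
Hypotheses (X_line : line_over iota X) (x_iso : iso_to_A1_over iota X x).
Hypotheses (X1 : X (fun=> 1)) (x1 : x (fun=> 1) = 0).

(** Isomorphisms between lines are affine: x is a polynomial G in the parameter of the line, the
    parameter is a polynomial T in x, and G o T = X forces deg T <= 1. The constant terms are 1
    because x vanishes at (1, ..., 1). *)
Lemma line_coordinates : exists q : 'I_n -> algC,
  (forall s, X s -> forall i, s i = 1 + q i * x s) /\
  (forall t, X (fun i => 1 + q i * t) /\ x (fun i => 1 + q i * t) = t).
Proof.
have [b [d [[i0 di0] XE]]] := X_line; have [P [Q [xE]]] := x_iso.
pose y (t : algC) (i : 'I_n) : algC := (map_poly iota (Q i)).[t].
rewrite -/y => yX yx xy.
pose l (u : algC) (i : 'I_n) : algC := iota (b i) + u * iota (d i).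
have lX u : X (l u) by rewrite XE; exists u.
have d0 : iota (d i0) != 0 by rewrite fmorph_eq0.
pose T : {poly algC} := (iota (d i0))^-1 *: (map_poly iota (Q i0) - (iota (b i0))%:P).
have yl t : y t = l T.[t].
  have := yX t; rewrite XE => -[u _ uE].
  suff -> : T.[t] = u by exact: esym uE.
  have : l u i0 = (map_poly iota (Q i0)).[t] by rewrite /l [X in X = _](congr1 (fun f => f i0) uE).
  rewrite /T hornerZ hornerD hornerN hornerC => <-.
  by rewrite /l addrAC subrr add0r mulrC mulfK.
pose G := line_poly (mpoly.map_mpoly iota P) (l 0) (l 1).
have GE u : G.[u] = x (l u).
  rewrite (xE _ (lX u)) line_polyE; congr (mpoly.meval _ _); apply/funext => i.
  by rewrite /l; ring.
have GT : G \Po T = 'X.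
  apply/eqP; rewrite -subr_eq0; apply: contraT => /poly_nonroot[t].
  by rewrite hornerD hornerN horner_comp hornerX GE -yl xy subrr eqxx.
have sT : (size T <= 2)%N.
  have := size_comp_poly G T; rewrite GT size_polyX /= => /esym/eqP.
  by rewrite muln_eq1 => /andP[_ /eqP]; move: (size T) => m; lia.
have TE t : T.[t] = T`_0 + T`_1 * t.
  by rewrite (horner_coef_wide _ sT) !big_ord_recl big_ord0 /= expr0 mulr1 expr1 addr0.
have y0 i : l T`_0 i = 1.
  have e : y (x (fun=> 1)) = (fun=> 1) := yx _ X1.
  by rewrite x1 yl TE mulr0 addr0 in e; rewrite e.
have yE t : y t = fun i => 1 + T`_1 * iota (d i) * t.
  by apply/funext => i; rewrite yl TE -(y0 i) /l; ring.
exists (fun i => T`_1 * iota (d i)); split=> [s Xs i|t].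
  have e : y (x s) = s := yx s Xs.
  by rewrite yE in e; rewrite -[in LHS]e.
by rewrite -yE; split; [exact: yX|exact: xy].
Qed.

End LineCoordinates.

(** * Lower bounds for the constants of the statement *)

Section Numeric.
Variable R : realType.

(** The normalizing factors are inverses of smaller binomial coefficients: (4k + 1)(4k) / 2 is 4k +
    1 choose 4k - 1, and 4k + 2 is 4k + 2 choose 4k + 1. *)
Lemma C1_odd_ge1 eta : odd eta -> 1 <= C1_odd R eta.
Proof.
move=> odd_eta; rewrite /C1_odd; case: ifP => [/eqP e3|/eqP e3].
  set k := (eta.+1 %/ 4)%N; have k0 : (0 < k)%N by rewrite /k divn_gt0 //; lia.
  have h : ((4 * k + 1) * (4 * k) <= 2 * 'C(5 * k + 2, 4 * k - 1))%N.
    apply: (@leq_trans (2 * 'C(4 * k + 1, 4 * k - 1))); last first.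
      by rewrite leq_mul2l leq_bin2l //; lia.
    rewrite -bin_sub; last by lia.
    have -> : (4 * k + 1 - (4 * k - 1) = 2)%N by lia.
    by rewrite mul_bin_left bin1; lia.
  have D0 : 0 < (((4 * k + 1) * (4 * k))%N%:R : R) by rewrite ltr0n; lia.
  by rewrite mulrAC ler_pdivlMr // mul1r -natrM ler_nat.
set k := (eta %/ 4)%N.
have h : (4 * k + 2 <= 'C(5 * k + 3, 4 * k + 1))%N.
  apply: (@leq_trans 'C(4 * k + 2, 4 * k + 1)); last by apply: leq_bin2l; lia.
  by rewrite (_ : (4 * k + 2 = (4 * k + 1).+1)%N) ?binSn //; lia.
have D0 : 0 < ((4 * k + 2)%N%:R : R) by rewrite ltr0n; lia.
by rewrite mulrAC ler_pdivlMr // !mul1r ler_nat.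
Qed.

Lemma C1_ge1 eta : (0 < eta)%N -> 1 <= C1 R eta.
Proof.
move=> eta0; rewrite /C1; case: ifP => [|/negbT even]; first exact: C1_odd_ge1.
have := C1_odd_ge1 (_ : odd eta.-1).
by case: eta eta0 even => //= m _; rewrite negbK => om /(_ om); lra.
Qed.

(* Pairing the factors [i + 1] and [n - i] of the factorial. *)
Lemma fact_le_exp n : (n`! * 2 ^ n <= n.+1 ^ n)%N.
Proof.
have e1 : (n`! = \prod_(i < n) i.+1)%N by rewrite fact_prod big_add1 /= big_mkord.
have e2 : (n`! = \prod_(i < n) (n - i))%N.
  rewrite e1 (reindex_inj rev_ord_inj) /=; apply: eq_bigr => i _; have := ltn_ord i; lia.
have key : (n`! * n`! * 4 ^ n <= (n.+1 ^ 2) ^ n)%N.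
  have cst c : (c ^ n = \prod_(i < n) c)%N by rewrite prod_nat_const card_ord.
  rewrite {1}e1 e2 !cst -!big_split /=; apply: leq_prod => i _.
  have -> : n.+1 = (i.+1 + (n - i))%N by have := ltn_ord i; lia.
  by rewrite mulnC nat_AGM2.
rewrite -leq_sqr -expnM [(n * 2)%N]mulnC expnM (leq_trans _ key) //.
by rewrite expnMn -mulnn -expnM [(n * 2)%N]mulnC expnM.
Qed.

(** The hypothesis gives (n + 1) / 2 <= 3 d, and n! <= ((n + 1) / 2)^n by [fact_le_exp]. *)
Lemma C2_ge1 n d : (0 < n)%N -> (n%:R + 2) / 4 <= d%:R :> R -> 1 <= C2 R n * d%:R ^+ n.
Proof.
move=> n0 hd; have f0 : 0 < n`!%:R :> R by rewrite ltr0n fact_gt0.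
have key : 1 <= 3 ^+ n / n`!%:R * d%:R ^+ n :> R.
  rewrite mulrAC ler_pdivlMr // mul1r -exprMn.
  have h : ((n.+1)%:R / 2) ^+ n <= (3 * d%:R) ^+ n :> R.
    have n0R : 0 <= n%:R :> R by rewrite ler0n.
    by rewrite -natr1 lerXn2r ?nnegrE; move: (n%:R : R) (d%:R : R) hd n0R => u w hd n0R; lra.
  apply: le_trans h; rewrite expr_div_n ler_pdivlMr ?exprn_gt0 //.
  by rewrite -!natrX -natrM ler_nat fact_le_exp.
rewrite /C2; case: ifP => _ //; apply: (le_trans key); rewrite ler_wpM2r ?exprn_ge0 //.
have : 0 <= 3 ^+ n / n`!%:R :> R by rewrite divr_ge0 ?exprn_ge0 // ltW.
lra.
Qed.

Lemma ln2_le1 : ln 2 <= 1 :> R.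
Proof. by rewrite -[2]/(1 + 1) le_ln1Dx // (lt_trans _ ltr01) // ltrN10. Qed.

End Numeric.

Theorem theorem6p1 (R : realType) (n : nat) (n_ge2 : (2 <= n)%N)
    (K : fieldExtType rat) (iota : {rmorphism K -> algC})
    (C : set ('I_n -> algC))
    (C_closed : zariski_closed_in (Gm n) C)
    (C_line : line_over iota (zariski_closure C))
    (C_s0 : C (fun=> 1))
    (C_nondeg : ~ exists X : set ('I_n -> algC),
       [/\ algebraic_subgroup X, X `<` Gm n & C `<=` X])
    (x : ('I_n -> algC) -> algC)
    (x_iso : iso_to_A1_over iota (zariski_closure C) x)
    (x_s0 : x (fun=> 1) = 0)
    (H : R)
    (H_ge : \sum_(a \in x @` (zariski_closure C `\` C)) height R a <= H) :
  forall s : 'I_n -> algC, C s -> Sigma 2 s ->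
  let delta := maxn 1 (tau R (point_field iota s)) in
  let lambda : R := 'C(n + delta, delta)%:R in
  height R (x s) <
    n%:R * (8 * lambda ^+ 3 - 38 / 10 * lambda ^+ 2) *
    (ln delta%:R + 2) * (H + 1)
  /\
  ((n%:R + 2) / 4 <= delta%:R :> R ->
   height R (x s) <
     8 * n%:R * C1 R n ^+ 2 * C2 R n * delta%:R ^+ n *
     (ln (3 * delta%:R) + 2) * (H + 1)).
Proof.
move=> s Cs [Y [Y_grp Y_codim Ys]] delta lambda.
have C_sub := closure_sub (Z := C); have C_Gm : C `<=` Gm n by move=> t; rewrite C_closed => -[].
have [q [sE tE]] := line_coordinates C_line x_iso (C_sub _ C_s0) x_s0.
have no_eq (F G : mpoly.mpoly n algC) (t0 : 'I_n -> algC) :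
    (forall s t, mpoly.meval (fun i => s i * t i) F = mpoly.meval s F * mpoly.meval t F) ->
    (forall s t, mpoly.meval (fun i => s i * t i) G = mpoly.meval s G * mpoly.meval t G) ->
    mpoly.meval (fun=> 1) F = 1 -> mpoly.meval (fun=> 1) G = 1 ->
    Gm n t0 -> mpoly.meval t0 F <> mpoly.meval t0 G ->
    ~ (forall t, C t -> mpoly.meval t F = mpoly.meval t G).
  move=> FM GM F1 G1 Gt0 ne eqC; apply: C_nondeg.
  exists [set t | Gm n t /\ mpoly.meval t F = mpoly.meval t G]; split.
  - exact: equation_subgroup.
  - split=> [t []//|sub]; by have [] := sub _ Gt0.
  - by move=> t Ct; split; [exact: C_Gm|exact: eqC].
pose Xi (i : 'I_n) : mpoly.mpoly n algC := mpoly.mpolyX algC (mpoly.mnm1 i).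
pose t0 (i : 'I_n) : 'I_n -> algC := fun j => if j == i then 2 else 1.
have Gt0 i : Gm n (t0 i).
  by move=> j; rewrite /t0; case: ifP => _; rewrite ?oner_eq0 // pnatr_eq0.
have ne21 : (2 : algC) <> 1 by move/eqP; rewrite -[1]/(1%:R) eqr_nat.
have XiM i u w : mpoly.meval (fun j => u j * w j) (Xi i) = mpoly.meval u (Xi i) * mpoly.meval w (Xi i).
  by rewrite !mpoly.mevalXU.
have q0 i : q i != 0.
  apply/eqP => qi0; apply: (no_eq (Xi i) 1 (t0 i)) => //.
  - by move=> u w; rewrite !mpoly.meval1 mulr1.
  - by rewrite mpoly.mevalXU.
  - by rewrite mpoly.meval1.
  - by rewrite mpoly.mevalXU mpoly.meval1 /t0 eqxx.
  - by move=> t /C_sub Ct; rewrite mpoly.mevalXU mpoly.meval1 (sE t Ct) qi0 mul0r addr0.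
have q_inj : injective q.
  move=> i j qij; apply/eqP; apply: contraT => ij.
  case: (no_eq (Xi i) (Xi j) (t0 i)) => //.
  - by rewrite mpoly.mevalXU.
  - by rewrite mpoly.mevalXU.
  - by rewrite !mpoly.mevalXU /t0 eqxx eq_sym (negPf ij).
  - by move=> t /C_sub Ct; rewrite !mpoly.mevalXU !(sE t Ct) qij.
(* The value of x where the i-th coordinate 1 + q_i x vanishes, that is, at a point of the line
   missing from C. *)
pose xi i := - (q i)^-1.
have xi0 i : xi i != 0 by rewrite oppr_eq0 invr_eq0.
have xi_inj : injective xi by move=> i j /oppr_inj/invr_inj/q_inj.
have coordE t i : 1 - t / xi i = 1 + q i * t by rewrite /xi invrN invrK mulrN opprK mulrC.
have Xi_set : x @` (zariski_closure C `\` C) = [set` [seq xi i | i <- enum 'I_n]].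
  apply/seteqP; split=> [_ [t [Ct nCt] <-]|_ /mapP[i _ ->]].
    have [i ti] : exists i, t i = 0.
      apply: contrapT => h; apply: nCt; rewrite C_closed; split=> // i.
      by apply/eqP => ti; apply: h; exists i.
    apply/mapP; exists i; first by rewrite mem_enum.
    move: ti; rewrite (sE t Ct) => /eqP; rewrite addrC addr_eq0 => /eqP e.
    by rewrite /xi; apply: (mulfI (q0 i)); rewrite e mulrN divff.
  have [Xt xt] := tE (xi i); exists (fun j => 1 + q j * xi i) => //; split=> // /C_Gm /(_ i).
  by rewrite /xi mulrN divff // subrr eqxx.
have H_sum : \sum_i height R (xi i) <= H.
  have uxi : uniq [seq xi i | i <- enum 'I_n] by rewrite map_inj_uniq ?enum_uniq.
  by apply: le_trans H_ge; rewrite Xi_set -fsbig_seq // big_map big_enum.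
have [e e0 rel] := subgroup_relation Y_grp Y_codim.
have bound := @height_multiplicative_relation R n (x s) xi e n_ge2 xi_inj xi0.
have Xs := C_sub _ Cs.
have {}bound : height R (x s) <= (3 * n%:R - 2) * (\sum_i height R (xi i) + ln 2).
  apply: bound => // [i|]; first by rewrite coordE -(sE s Xs) (C_Gm _ Cs).
  by rewrite -[RHS](rel s Ys); apply: eq_bigr => i _; rewrite coordE -(sE s Xs).
have sum_ge0 : 0 <= \sum_i height R (xi i) by apply: sumr_ge0 => i _; exact: height_ge0.
have n2 : 2 <= n%:R :> R by rewrite ler_nat.
have H0 : 0 <= H by apply: le_trans H_sum.
have small : height R (x s) < 3 * n%:R * (H + 1).
  apply: (le_lt_trans bound); apply: (@le_lt_trans _ _ ((3 * n%:R - 2) * (H + 1))).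
    by rewrite ler_wpM2l ?lerD ?ln2_le1 //; lra.
  by rewrite ltr_pM2r; lra.
(* Both claimed bounds are of this form, which leaves a lower bound for c in each case. *)
have big (c : R) : 3 <= c -> height R (x s) < n%:R * c * (H + 1).
  move=> c3; apply: (lt_le_trans small); rewrite ler_wpM2r ?addr_ge0 //.
  by rewrite mulrC ler_wpM2l // (le_trans _ n2).
have d1 : 1 <= delta%:R :> R by rewrite ler1n leq_max.
split.
  have l1 : 1 <= lambda by rewrite /lambda ler1n bin_gt0 leq_addl.
  have ld : 0 <= ln delta%:R :> R by rewrite ln_ge0.
  rewrite -(mulrA n%:R); apply: big.
  have : 4 <= 8 * lambda ^+ 3 - 38 / 10 * lambda ^+ 2 by nra.
  by move: (8 * lambda ^+ 3 - _) (ln _) ld => a b b0 a4; nra.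
move=> hd.
have c1 : 1 <= C1 R n ^+ 2 by rewrite exprn_ege1 // C1_ge1 // (leq_trans _ n_ge2).
have c2 : 1 <= C2 R n * delta%:R ^+ n by apply: C2_ge1; rewrite // (leq_trans _ n_ge2).
have ld : 0 <= ln (3 * delta%:R) :> R by rewrite ln_ge0 //; lra.
have -> : 8 * n%:R * C1 R n ^+ 2 * C2 R n * delta%:R ^+ n * (ln (3 * delta%:R) + 2) * (H + 1)
  = n%:R * (8 * (C1 R n ^+ 2 * (C2 R n * delta%:R ^+ n)) * (ln (3 * delta%:R) + 2)) * (H + 1).
  by ring.
apply: big; have := mulr_ege1 c1 c2.
by move: (C1 R n ^+ 2 * _) (ln _) ld => a b b0 a1; nra.
Qed.
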